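(* Let $a$ be a prime of the form $a=2^r\cdot 3+1$ with \[ r\in\{1,2,5,6,8,12,18,30,36,41,66,189,201,209,276,353,408,438,534,2208,2816,3168,3189,3912\}. \] Let $b,c$ be positive integers with $b>1$ such that $a,b,c$ are pairwise relatively prime. Then the equation $a^x-b^y=c$ has at most one solution in positive integers $x,y$, except for $(a,b,c)=(13,3,10)$, for which it has exactly two solutions. *)

(* Defs.v *)
From mathcomp Require Import all_boot.
Set Implicit Arguments. Unset Strict Implicit. Unset Printing Implicit Defensive.

Definition r_list : seq nat :=
  [:: 1; 2; 5; 6; 8; 12; 18; 30; 36; 41; 66; 189; 201; 209; 276; 353; 408;
      438; 534; 2208; 2816; 3168; 3189; 3912].

(* (x, y) is a solution in positive integers of a^x - b^y = c.
   Since c > 0 (stated as a hypothesis), the integer equation a^x - b^y = c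
   is equivalent to the nat equation a^x = b^y + c. *)
Definition is_sol (a b c : nat) (s : nat * nat) : Prop :=
  0 < s.1 /\ 0 < s.2 /\ a ^ s.1 = b ^ s.2 + c.

(* Main.v *)
(* Suppose [a ^ x1 = b ^ y1 + c] and [a ^ x2 = b ^ y2 + c] with [y1 < y2]; put [d = y2 - y1].

   If [d] is even and [c > 1], put [w = b ^ y1].  A descent shows that every representation of a power
   of [a] by [w p ^ 2 + c q ^ 2] with [p] prime to [a] comes from an odd power of
   [sqrt w + sqrt (- c)], so [b ^ (d / 2)] and [1] are, up to sign, the two coefficients of such a
   power.  These coefficients are divisibility sequences, which leaves only [b = 3], [y1 = 1],
   [c = 10].  The case [c = 1] is elementary for every parity of [d].

   If [d] is odd, Fermat's little theorem and [a - 1 = 3 * 2 ^ r] show that [b] has order [n = 1] or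
   [n = 3] modulo [a].  Write [d = n nu] and let [Z = a ^ t] and [a ^ e] be the exact powers of [a] in
   [b ^ n - 1] and [nu]; lifting the exponent gives [x1 = t + e].  As
   [b ^ y1 (b ^ n) ^ nu = b ^ y1 - a ^ x1] modulo [a ^ x2], an interpolation determinant with entries
   [C(r + nu s, k) (g ^ r h1 ^ s h2 ^ (S - s)) ^ l], where [g = b ^ n], is divisible by a power of [Z]
   that exceeds its size as soon as [nu] is large.  Conversely, the binomial expansion of
   [(b ^ n) ^ nu] to second order bounds [Z] in terms of [nu].  So [a ^ t] is bounded, only the small
   values of [r] matter, and the remaining [t], [e], [nu], [b] and [y1] are excluded one by one by
   computation. *)

Require Import Defs.
From Stdlib Require Import NArith.
From HB Require Import structures.
From mathcomp Require Import all_boot all_order all_fingroup all_algebra all_solvable.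
From mathcomp Require Import zify ring lra.
Set Implicit Arguments. Unset Strict Implicit. Unset Printing Implicit Defensive.
Import Order.TTheory GRing.Theory Num.Theory.

(** For odd [d] the descent does not apply, since [b ^ y2] is not [b ^ y1] times a square, and
    neither of the two bounds suffices alone. For each [u] the determinant only excludes the window
    [det_threshold u <= nu <= Z ^ u]. Consecutive windows overlap from the first [u] with
    [det_threshold (u + 1) <= Z ^ u] on, so [nu] is bounded by a constant, which drops to 325 once
    [Z >= 1323]. The congruence bound on [Z] is a polynomial of degree 4 in [nu], hence then
    absolute: about [3.6 * 10 ^ 12], which is less than [3 * 2 ^ 41]. This is why every [r >= 41] is
    settled without computation, and why each of the nine smaller primes needs only finitely many
    powers [a ^ t]. *)

Local Notation ofn := N.of_nat.

(** * Interpolation determinants *)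

(** Expanding every column over [M] turns the determinant into a sum over all [f : 'I_N -> M]. A
    non-injective [f] repeats a column of [P], so only injective ones contribute, each with a factor
    [z ^+ B]. *)
Lemma dvdz_det_expansion (N : nat) (M : finType) (A : 'M[int]_N)
    (P : 'I_N -> M -> int) (E : M -> nat) (Q : M -> 'I_N -> int) (z : int) (B : nat) :
  (forall i j, A i j = \sum_m P i m * (z ^+ E m * Q m j))%R ->
  (forall f : {ffun 'I_N -> M}, injective f -> B <= \sum_j E (f j)) ->
  (z ^+ B %| (\det A)%R)%Z.
Proof.
move=> defA leB; rewrite -det_tr /determinant.
have -> : (\sum_(s : 'S_N) (-1) ^+ s * \prod_i A^T i (s i) =
  \sum_(f : {ffun 'I_N -> M}) (\prod_j (z ^+ E (f j) * Q (f j) j)) *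
     \det (\matrix_(j, i) P i (f j)))%R.
  under [RHS]eq_bigr => f _ do rewrite /determinant mulr_sumr.
  rewrite exchange_big /=; apply: eq_bigr => s _.
  under eq_bigr => j _ do rewrite mxE defA.
  rewrite bigA_distr_bigA /= mulr_sumr; apply: eq_bigr => f _.
  rewrite big_split /= [(_ * \prod_i (_ * _))%R]mulrC mulrCA.
  by congr (_ * (_ * _))%R; apply: eq_bigr => j _; rewrite mxE.
apply: rpred_sum => f _.
have [/injectiveP injf|] := boolP (injectiveb f).
  rewrite dvdz_mulr // big_split dvdz_mulr //= prodrXr.
  exact: dvdz_exp2l (leB f injf).
case/injectivePn=> j1 [j2 neq eqf].
rewrite (determinant_alternate neq) ?mulr0 ?dvdz0 // => i.
by rewrite !mxE eqf.
Qed.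

Lemma ler_norm_det (N : nat) (A : 'M[int]_N) (B : 'I_N -> int) :
  (forall i j, `|A i j| <= B j)%R -> (`|\det A| <= N`!%:R * \prod_j B j)%R.
Proof.
move=> leB; apply: le_trans (ler_norm_sum _ _ _) _.
have -> : (N`!%:R * \prod_j B j = \sum_(s : 'S_N) \prod_j B j :> int)%R.
  by rewrite sumr_const card_Sn mulr_natl.
apply: ler_sum => s _; rewrite normrM normrX normrN1 expr1n mul1r normr_prod.
rewrite [leRHS](reindex_inj (@perm_inj _ s)) /=.
by apply: ler_prod => i _; rewrite normr_ge0 leB.
Qed.

(* [\sum_j E_j] counts the pairs [(h, j)] with [h < E_j], and the values below [N] are distinct. *)
Lemma leq_sum_injective (N : nat) (f : {ffun 'I_N -> 'I_N + 'I_N}) :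
  injective f ->
  \sum_(i < N) i <= \sum_j (match f j with inl n => n : nat | inr _ => N end).
Proof.
move=> injf; pose E j := match f j with inl n => n : nat | inr _ => N end.
rewrite -[leqRHS]/(\sum_j E j).
have leE j : E j <= N by rewrite /E; case: (f j) => // n; apply: ltnW.
have sumE j : E j = \sum_(h < N) (h < E j).
  by rewrite -[LHS]card_ord -sum1_card (big_ord_widen N (fun=> 1) (leE j)) big_mkcond.
rewrite (eq_bigr _ (fun j _ => sumE j)) exchange_big /=.
rewrite (reindex_inj rev_ord_inj) /=; apply: leq_sum => h _.
rewrite -big_mkcond sum1_card /=.
have : #|[set j : 'I_N | E j <= h]| <= h.+1.
  pose F (j : 'I_N) : 'I_h.+1 := inord (E j).
  rewrite -[leqRHS]card_ord -(card_in_imset (f := F)) ?max_card //.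
  move=> j1 j2; rewrite !inE => le1 le2 /(congr1 val) /=; rewrite !inordK // => eqE.
  apply: injf; move: le1 le2 eqE; rewrite /E.
  case: (f j1) (f j2) => [n1|n1] [n2|n2] //=; last 3 first.
  - by move=> _; rewrite leqNgt ltn_ord.
  - by rewrite leqNgt ltn_ord.
  - by rewrite leqNgt ltn_ord.
  by move=> _ _ /val_inj ->.
have := cardC [set j : 'I_N | E j <= h]; rewrite card_ord.
have -> : #|[predC [set j | E j <= h]]| = #|(fun i : 'I_N => h < E i)|.
  by apply: eq_card => j; rewrite !inE -ltnNge.
by move=> eqN leh; rewrite leq_subLR -[leqLHS]eqN leq_add2r.
Qed.

(** * Zero estimate for exponential polynomials *)

Section ZeroEstimate.
Variable F : fieldType.
Local Open Scope ring_scope.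

Lemma coef_prod_top (I : Type) (s : seq I) (p : I -> {poly F}) (d : I -> nat) :
  (forall i, size (p i) <= (d i).+1)%N ->
  (size (\prod_(i <- s) p i)%R <= (\sum_(i <- s) d i).+1)%N /\
  (\prod_(i <- s) p i)`_(\sum_(i <- s) d i)%N = \prod_(i <- s) (p i)`_(d i).
Proof.
move=> szp; elim: s => [|i s [szs IHs]]; first by rewrite !big_nil coef1 size_poly1.
rewrite !big_cons -IHs; split.
  apply: leq_trans (size_polyMleq _ _) _.
  have := leq_add (szp i) szs; rewrite addSn addnS.
  by case: (size _ + size _)%N.
have lti : (d i < (d i + \sum_(j <- s) d j).+1)%N by rewrite ltnS leq_addr.
rewrite coefM (bigD1 (Ordinal lti)) //= addKn [X in _ + X]big1 ?addr0 // => j neq.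
have [ltj|gtj|eqj] := ltngtP j (d i).
- rewrite [X in _ * X]nth_default ?mulr0 //.
  apply: leq_trans szs _; move: (ltn_ord j); lia.
- by rewrite [X in X * _]nth_default ?mul0r // (leq_trans (szp i)).
- by case/eqP: neq; apply: val_inj.
Qed.

Lemma coef_det_top (m : nat) (B : 'M[{poly F}]_m) (d : 'I_m -> nat) :
  (forall i j, size (B i j) <= (d j).+1)%N ->
  (size (\det B) <= (\sum_j d j).+1)%N /\
  (\det B)`_(\sum_j d j)%N = \det (\matrix_(i, j) (B i j)`_(d j)).
Proof.
move=> szB; rewrite -det_tr -[in RHS]det_tr /determinant.
have sz (s : 'S_m) i : (size (B^T i (s i)) <= (d i).+1)%N by rewrite mxE szB.
split.
  apply: leq_trans (size_sum _ _ _) _; apply/bigmax_leqP => s _.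
  by rewrite size_Msign; case: (coef_prod_top (index_enum _) (sz s)).
rewrite coef_sum; apply: eq_bigr => s _.
rewrite -polyC1 -polyCN -polyC_exp coefCM; congr (_ * _).
case: (coef_prod_top (index_enum _) (sz s)) => _ ->.
by apply: eq_bigr => i _; rewrite !mxE.
Qed.

(* The matrix [Q_l('X + i) x_l^i] is singular at every point of [zs], so its
   determinant vanishes; but its top coefficient is a Vandermonde determinant
   times the leading coefficients of the [Q_l]. *)
Lemma exp_poly_eq0 (L K : nat) (Q : 'I_L -> {poly F}) (x : 'I_L -> F) (zs : seq F) :
  (forall l, size (Q l) <= K)%N -> injective x ->
  uniq zs -> (L * K.-1 < size zs)%N ->
  (forall z, z \in zs -> exists2 w : 'I_L -> F, forall l, w l != 0 &
     forall i : nat, (i < L)%N -> \sum_l (Q l).[z + i%:R] * x l ^+ i * w l = 0) ->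
  forall l, Q l = 0.
Proof.
move=> szQ injx uzs szzs vanish.
(* Dropping the zero [Q l] keeps every leading coefficient nonzero; the [m <= L] columns left use
   only the first [m] of the [L] equations at each point. *)
pose S := [set l | Q l != 0]; pose m := #|S|; pose e (j : 'I_m) := enum_val j.
suff m0 : m = 0%N.
  move=> l; apply/eqP; move/eqP: m0; rewrite cards_eq0 => /eqP S0.
  by have := in_set0 l; rewrite -S0 inE => /negbFE.
apply/eqP; apply/negPn/negP; rewrite -lt0n => m_gt0.
have leqmL : (m <= L)%N by rewrite -[leqRHS]card_ord max_card.
pose B : 'M[{poly F}]_m :=
  \matrix_(i, j) ((Q (e j) \Po ('X + (i%:R)%:P)) * (x (e j) ^+ i)%:P).
pose d j := (size (Q (e j))).-1.
have Qe j : Q (e j) != 0 by have := enum_valP j; rewrite inE.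
have sizeQ j : size (Q (e j)) = (d j).+1 by rewrite /d prednK // lt0n size_poly_eq0.
have size2 (i : nat) : size ('X + (i%:R)%:P : {poly F}) = 2 by rewrite size_XaddC.
have szB i j : (size (B i j) <= (d j).+1)%N.
  rewrite mxE mulrC mul_polyC; apply: leq_trans (size_scale_leq _ _) _.
  by rewrite size_comp_poly2 // sizeQ.
have [szD coefD] := coef_det_top szB.
have D0 : \det B = 0.
  apply/eqP; apply: contraTT szzs => nzD; rewrite -leqNgt.
  have allr : all (root (\det B)) zs.
    apply/allP => z /vanish[w nzw sumw]; rewrite /root -horner_evalE -det_map_mx.
    apply/negPn/negP => nzdet.
    have unitB : (map_mx (horner_eval z) B)^T \in unitmx by rewrite unitmx_tr unitmxE unitfE.
    have := mulmxK unitB (\row_j w (e j)).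
    have -> : (\row_j w (e j)) *m (map_mx (horner_eval z) B)^T = 0.
      apply/rowP => i; rewrite !mxE; have := sumw i (leq_trans (ltn_ord i) leqmL).
      rewrite (bigID (mem S)) /= [X in _ + X]big1 => [|l]; last first.
        by rewrite inE negbK => /eqP ->; rewrite horner0 !mul0r.
      rewrite addr0 big_enum_val => sum0; rewrite -[RHS]sum0.
      apply: eq_bigr => j _; rewrite !mxE horner_evalE hornerM horner_comp.
      by rewrite hornerD hornerX !hornerC mulrC.
    rewrite mul0mx => /rowP/(_ (Ordinal m_gt0)); rewrite !mxE => /esym/eqP.
    by rewrite (negPf (nzw _)).
  have := leq_trans (max_poly_roots nzD allr uzs) szD; rewrite ltnS.
  move=> /leq_trans-> //.
  have -> : (L * K.-1 = \sum_(j < L) K.-1)%N by rewrite sum_nat_const card_ord.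
  apply: (@leq_trans (\sum_(j < m) K.-1)); last first.
    by rewrite !sum_nat_const !card_ord leq_mul2r leqmL orbT.
  by apply: leq_sum => j _; rewrite /d -!subn1 leq_sub2r.
move: coefD; rewrite D0 coef0 => /esym/eqP; apply/negP.
have -> : \matrix_(i, j) (B i j)`_(d j) =
    Vandermonde m (\row_j x (e j)) *m diag_mx (\row_j lead_coef (Q (e j))).
  apply/matrixP => i j; rewrite mul_mx_diag !mxE.
  rewrite coefMC mulrC; congr (_ * _).
  have -> : d j = (size (Q (e j) \Po ('X + (i%:R)%:P))).-1.
    by rewrite size_comp_poly2.
  rewrite -[LHS]lead_coefE lead_coef_comp ?size2 //.
  by rewrite (eqP (monicXaddC _)) expr1n mulr1.
rewrite det_mulmx det_diag det_Vandermonde mulf_neq0 //; apply/prodf_neq0 => i _.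
  apply/prodf_neq0 => j ltij; rewrite !mxE subr_eq0 (inj_eq injx).
  by rewrite (inj_eq enum_val_inj) eq_sym; apply: contraTneq ltij => ->; rewrite ltnn.
by rewrite mxE lead_coef_eq0.
Qed.
End ZeroEstimate.

Lemma big_enum_val_all (T : Type) (idx : T) (op : Monoid.com_law idx) (I : finType) (F : I -> T) :
  \big[op/idx]_(j < #|{: I}|) F (enum_val j) = \big[op/idx]_p F p.
Proof. by rewrite -(big_enum_val F); apply: eq_bigl. Qed.

Section Interpolation.
Local Open Scope ring_scope.

Lemma prod_sub_nat (R : comNzRingType) (n k : nat) :
  \prod_(i < k) (n%:R - i%:R) = (n ^_ k)%:R :> R.
Proof.
elim: k => [|k IHk]; first by rewrite big_ord0 ffactn0.
rewrite big_ord_recr /= IHk ffactnSr natrM.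
have [lekn|ltnk] := leqP k n; first by rewrite natrB.
by rewrite ffact_small // !mul0r.
Qed.

Definition bin_poly (k : nat) : {poly rat} :=
  (k`!%:R)^-1 *: \prod_(i < k) ('X - (i%:R)%:P).

Lemma size_bin_poly k : (size (bin_poly k) <= k.+1)%N.
Proof.
apply: leq_trans (size_scale_leq _ _) _.
by rewrite size_prod_XsubC /index_enum -enumT size_enum_ord.
Qed.

Lemma horner_bin_poly k (n : nat) : (bin_poly k).[n%:R] = 'C(n, k)%:R.
Proof.
rewrite hornerZ horner_prod.
under eq_bigr => i _ do rewrite hornerXsubC.
rewrite prod_sub_nat -bin_ffact natrM mulrC mulfK //.
by rewrite pnatr_eq0 -lt0n fact_gt0.
Qed.

(** Modulo [Z ^+ N], where [h2 * g ^+ nu] is congruent to [h1], the factor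
    [h1 ^+ s * h2 ^+ (S.-1 - s)] is [h2 ^+ S.-1 * g ^+ (nu * s)]. Up to a factor of its column, the
    entry is thus the value at [z = r + nu * s] of the exponential monomial
    ['C(z, k) * g ^+ (l * z)], while the integer itself avoids the large power [g ^+ nu]. *)
Definition interp_entry (K L R S nu g h2 : nat) (h1 : int)
    (p : 'I_R * 'I_S) (c : 'I_K * 'I_L) : int :=
  'C(p.1 + nu * p.2, c.1)%:R *
  (g%:R ^+ p.1 * h1 ^+ p.2 * h2%:R ^+ (S.-1 - p.2)) ^+ c.2.

(** A relation between the columns gives polynomials [Q l] to which the zero estimate applies. The
    points [r + nu * s] with [r < R0 <= nu] are distinct, and the [L.-1] further values of [r]
    supply the shifts [z + i]. *)
Lemma interpolation_rows (K L R0 S nu g h2 : nat) (h1 : int) :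
  (1 < g)%N -> (0 < h2)%N -> h1 != 0 -> (R0 <= nu)%N -> (L * K.-1 < R0 * S)%N ->
  exists f : 'I_#|{: 'I_K * 'I_L}| -> 'I_(R0 + L.-1) * 'I_S,
    \det (\matrix_(i, j) interp_entry nu g h2 h1 (f i) (enum_val j)) != 0.
Proof.
move=> g_gt1 h2_gt0 h1_neq0 leR0 ltLK.
set N := #|_|; set R := (R0 + L.-1)%N.
pose M : 'M[rat]_(#|{: 'I_R * 'I_S}|, N) :=
  \matrix_(i, j) (interp_entry nu g h2 h1 (enum_val i) (enum_val j))%:~R.
have fullM : row_full M.
  rewrite -col_leq_rank -mxrank_tr -[N]/(N) row_leq_rank.
  apply: inj_row_free => v vM.
  pose Q (l : 'I_L) : {poly rat} := \sum_(k < K) v 0 (enum_rank (k, l)) *: bin_poly k.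
  have sizeQ l : (size (Q l) <= K)%N.
    apply: leq_trans (size_sum _ _ _) _; apply/bigmax_leqP => k _.
    apply: leq_trans (size_scale_leq _ _) _.
    exact: leq_trans (size_bin_poly k) (ltn_ord k).
  have Q0 : forall l, Q l = 0.
    pose zs := [seq ((p.1 + nu * p.2)%N%:R : rat) | p : 'I_R0 * 'I_S <- enum {: 'I_R0 * 'I_S}].
    apply: (@exp_poly_eq0 _ L K Q (fun l : 'I_L => g%:R ^+ l) zs sizeQ).
    - move=> l1 l2 /eqP; rewrite -!natrX eqr_nat eqn_exp2l // => /eqP.
      exact: val_inj.
    - rewrite map_inj_uniq ?enum_uniq // => -[r1 s1] [r2 s2] /= /eqP.
      rewrite eqr_nat => /eqP eqz.
      have lt1 := leq_trans (ltn_ord r1) leR0; have lt2 := leq_trans (ltn_ord r2) leR0.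
      have nu_gt0 : (0 < nu)%N by apply: leq_trans lt1.
      have eqr : (r1 = r2 :> nat).
        by move/(congr1 (modn^~ nu)): eqz; rewrite ![(_ + nu * _)%N]addnC !(mulnC nu) /= !modnMDl !modn_small.
      move: eqz; rewrite eqr => /addnI /eqP; rewrite eqn_pmul2l // => /eqP eqs.
      by congr (_, _); apply: val_inj.
    - by rewrite size_map -cardE card_prod !card_ord.
    - move=> z /mapP[[r s] _ /= ->].
      (* Raising [r] by [i] multiplies the base of the [l]-th power by [g ^+ i], so [g ^+ l] serves
         as [x l] and [y ^+ l] as the weight [w l]. *)
      pose y : rat := (g%:R ^+ r * h1%:~R ^+ s * h2%:R ^+ (S.-1 - s)).
      have y0 : y != 0.
        rewrite !mulf_neq0 ?expf_neq0 ?intr_eq0 ?pnatr_eq0 -?lt0n //.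
        exact: ltnW.
      exists (fun l : 'I_L => y ^+ l) => [l|i ltiL]; first by rewrite expf_neq0.
      have ltr : (r + i < R)%N.
        by rewrite /R; move: (ltn_ord r); case: (L) ltiL => // L' /=; lia.
      have /rowP/(_ (enum_rank (Ordinal ltr, s))) := vM.
      rewrite !mxE => sum0; rewrite -[RHS]sum0.
      transitivity (\sum_(c : 'I_K * 'I_L)
         v 0 (enum_rank c) * (interp_entry nu g h2 h1 (Ordinal ltr, s) c)%:~R); last first.
        rewrite -big_enum_val_all; apply: eq_bigr => j _.
        by rewrite enum_valK !mxE enum_rankK.
      transitivity (\sum_l \sum_k v 0 (enum_rank (k, l)) *
         (interp_entry nu g h2 h1 (Ordinal ltr, s) (k, l))%:~R); last first.
        by rewrite exchange_big pair_bigA; apply: eq_bigr => -[k l].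
      apply: eq_bigr => l _; rewrite /Q horner_sum !mulr_suml.
      apply: eq_bigr => k _; rewrite hornerZ -natrD.
      have -> : (r + nu * s + i = r + i + nu * s)%N by lia.
      rewrite horner_bin_poly /interp_entry /= intrM rmorphXn /= !rmorphM /= !rmorphXn /=.
      rewrite !rmorph_nat -[LHS]mulrA -[LHS]mulrA; congr (_ * (_ * _)).
      by rewrite exprAC -exprMn /y exprD !mulrA [_ ^+ i * _]mulrC.
  apply/rowP => j; rewrite mxE -[j]enum_valK; case: (enum_val j) => k l.
  (* The binomial polynomials are triangular at [0, 1, 2, ...], so [Q l = 0] kills the coefficients
     one after another. *)
  move: (Q0 l) => Ql0.
  have [m lem] := ubnP k; elim: m k lem => // m IHm k lem.
  have := congr1 (horner^~ k%:R) Ql0; rewrite horner0 /Q horner_sum.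
  rewrite (bigD1 k) //= big1 ?addr0 => [|k' neq]; rewrite hornerZ horner_bin_poly.
    by rewrite binn mulr1.
  have [ltk|gtk|eqk] := ltngtP k k'; first by rewrite bin_small // mulr0.
    by rewrite IHm ?mul0r // (leq_trans gtk).
  by case/eqP: neq; apply: val_inj.
exists (fun i => enum_val (fullrankfun fullM i)).
have := fullrowsub_unit fullM; rewrite unitmxE unitfE; apply: contra_neq => det0.
have -> : rowsub (fullrankfun fullM) M = map_mx intr
   (\matrix_(i, j) interp_entry nu g h2 h1 (enum_val (fullrankfun fullM i)) (enum_val j)).
  by apply/matrixP => i j; rewrite !mxE.
by rewrite det_map_mx det0 rmorph0.
Qed.
End Interpolation.

(** * Divisibility of the determinant by a power of [Z] *)

Section Divisibility.
Local Open Scope ring_scope.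

Lemma bin_trinomial (m k j : nat) :
  ('C(m, k + j) * 'C(k + j, k) = 'C(m, k) * 'C(m - k, j))%N.
Proof.
have kj := bin_fact (leq_addr j k); rewrite addKn in kj.
have ffactD : (m ^_ (k + j) = m ^_ k * (m - k) ^_ j)%N.
  by elim: k {kj} m => [|k IHk] [|m]; rewrite ?ffactn0 ?mul1n ?subn0 ?addSn ?ffactSS ?ffact0n ?IHk ?mulnA.
apply/eqP; rewrite -(eqn_pmul2r (_ : 0 < k`! * j`!)%N) ?muln_gt0 ?fact_gt0 //.
by rewrite -mulnA kj bin_ffact ffactD mulnACA !bin_ffact.
Qed.

(** Newton expansion in [m]: the coefficient of ['C(m, n)] carries [x ^+ (n - k)]. The free upper
    limit [T] allows the sum to be split at the same index for all rows. *)
Lemma binom_newton (A : comNzRingType) (x : A) (m k T : nat) : (m < T)%N ->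
  (1 + x) ^+ m * 'C(m, k)%:R =
  \sum_(n < T) if (k <= n)%N then (1 + x) ^+ k * ('C(m, n) * 'C(n, k))%:R * x ^+ (n - k) else 0.
Proof.
move=> ltmT.
have [lekm|ltmk] := leqP k m; last first.
  rewrite bin_small // mulr0 big1 // => n _; case: ifP => // lekn.
  by rewrite [X in (X * _)%N]bin_small ?mul0n ?mulr0 ?mul0r // (leq_trans ltmk).
rewrite -big_mkcond -(big_mkord (fun n => k <= n)%N
  (fun n => (1 + x) ^+ k * ('C(m, n) * 'C(n, k))%:R * x ^+ (n - k))) /=.
rewrite (@big_cat_nat _ _ _ m.+1) //= [X in _ = _ + X]big_nat_cond [X in _ = _ + X]big1 ?addr0; last first.
  by move=> n /andP[/andP[ltmn _] _]; rewrite bin_small ?mul0n ?mulr0 ?mul0r.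
rewrite (@big_cat_nat _ _ _ k) //= ?(leqW lekm) //.
rewrite [X in _ = X + _]big_nat_cond [X in _ = X + _]big1 ?add0r; last first.
  by move=> n /andP[/andP[_ ltnk]]; rewrite leqNgt ltnk.
rewrite -{1}[k in RHS]add0n big_addn subSn // big_mkord.
rewrite -{1}(subnKC lekm) exprD -mulrA.
transitivity ((1 + x) ^+ k * \sum_(i < (m - k).+1) ('C(m, k) * 'C(m - k, i))%:R * x ^+ i).
  congr (_ * _); rewrite exprDn mulr_suml; apply: eq_bigr => i _.
  by rewrite expr1n mul1r -mulr_natr natrM -mulrA mulrC; congr (_ * _); rewrite mulrC.
rewrite mulr_sumr; apply: congr_big => // i; rewrite ?leq_addl //= => _.
by rewrite addnK [(i + k)%N]addnC bin_trinomial mulrA.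
Qed.

Lemma dvdz_exp_sub (d x y : int) (n : nat) : (d %| x - y)%Z -> (d %| x ^+ n - y ^+ n)%Z.
Proof. by move=> dxy; rewrite subrXX dvdz_mulr. Qed.

(** Multiplied by [Z ^+ k], the column [(k, l)] is modulo [Z ^+ N] a combination of the vectors
    ['C(zeta, n)], each weighted by [Z ^+ n]. Distinct columns must use distinct [n], which gives
    the exponent [0 + 1 + ... + (N - 1)]; the extra power of [Z] on the right pays for the
    scaling. *)
Lemma dvdz_interp_det (K L R S nu g h2 Z : nat) (h1 : int)
    (f : 'I_#|{: 'I_K * 'I_L}| -> 'I_R * 'I_S) :
  (Z %| g.-1)%N -> (0 < g)%N -> (0 < Z)%N ->
  (Z%:R ^+ #|{: 'I_K * 'I_L}| %| h2%:R * g%:R ^+ nu - h1)%Z ->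
  (Z%:R ^+ (\sum_(i < #|{: 'I_K * 'I_L}|) i)%N %|
    Z%:R ^+ (\sum_(c : 'I_K * 'I_L) c.1)%N *
      \det (\matrix_(i, j) interp_entry nu g h2 h1 (f i) (enum_val j)))%Z.
Proof.
move=> /dvdnP[y0 defg] g_gt0 Z_gt0 dvdh; set N := #|_| in f dvdh *.
pose z : int := Z%:R; pose kk (j : 'I_N) : nat := (enum_val j).1.
pose ll (j : 'I_N) : nat := (enum_val j).2.
pose zeta i : nat := ((f i).1 + nu * (f i).2)%N.
set A := \matrix_(i, j) _.
pose A' : 'M[int]_N := A *m diag_mx (\row_j z ^+ kk j).
have -> : z ^+ (\sum_(c : 'I_K * 'I_L) c.1)%N * \det A = \det A'.
  rewrite det_mulmx det_diag mulrC -prodrXr -big_enum_val_all /=.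
  by congr (_ * _); apply: eq_bigr => j _; rewrite mxE.
have dvdG l : (z %| g%:R ^+ l - 1)%Z.
  rewrite -[X in _ - X](expr1n _ l); apply: dvdz_exp_sub.
  have -> : (g%:R - 1 = z * y0%:R :> int).
    by rewrite -(prednK g_gt0) defg -natr1 addrK mulnC natrM.
  exact: dvdz_mulr.
pose yy l : int := ((g%:R ^+ l - 1) %/ z)%Z.
have defG l : g%:R ^+ l = 1 + z * yy l.
  by rewrite mulrC /yy divzK ?dvdG // addrC subrK.
pose Q0 (n : nat) (j : 'I_N) : int := if (kk j <= n)%N then
  h2%:R ^+ (S.-1 * ll j) * (g%:R ^+ ll j) ^+ kk j * 'C(n, kk j)%:R * yy (ll j) ^+ (n - kk j) else 0.
pose B0 i j : int := \sum_(n < N) 'C(zeta i, n)%:R * (z ^+ n * Q0 n j).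
have dvdA i j : (z ^+ N %| A' i j - B0 i j)%Z.
  have -> : A' i j = z ^+ kk j * A i j by rewrite /A' mul_mx_diag; move: (A) => A0; rewrite !mxE mulrC.
  pose e : int := 'C(zeta i, kk j)%:R * (g%:R ^+ zeta i * h2%:R ^+ S.-1) ^+ ll j.
  have -> : z ^+ kk j * A i j - B0 i j = z ^+ kk j * (A i j - e) + (z ^+ kk j * e - B0 i j).
    by ring.
  apply: rpredD.
    rewrite dvdz_mull // mxE /interp_entry -/(zeta i) -/(kk j) -/(ll j) -mulrBr dvdz_mull //.
    apply: dvdz_exp_sub; rewrite /zeta exprD exprM -!mulrA -mulrBr dvdz_mull //.
    have les : ((f i).2 <= S.-1)%N by move: (ltn_ord (f i).2); case: (S) (f i).2 => [|S'] s //=.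
    rewrite -{2}(subnKC les) [X in _ - _ * X]exprD mulrA -mulrBl dvdz_mulr //.
    by rewrite -exprMn dvdz_exp_sub // -opprB rpredN [_ * h2%:R]mulrC.
  have -> : z ^+ kk j * e = \sum_(n < N + (zeta i).+1) 'C(zeta i, n)%:R * (z ^+ n * Q0 n j).
    have := @binom_newton int (z * yy (ll j)) (zeta i) (kk j) (N + (zeta i).+1) (leq_addl _ _).
    rewrite -defG /e exprMn -!exprM [(zeta i * _)%N]mulnC exprM => eqb.
    transitivity (z ^+ kk j * h2%:R ^+ (S.-1 * ll j) *
        (g%:R ^+ ll j ^+ zeta i * 'C(zeta i, kk j)%:R)); first by ring.
    rewrite eqb mulr_sumr; apply: eq_bigr => n _; rewrite /Q0.
    case: ifP => lekn; last by rewrite !mulr0.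
    have -> : z ^+ n = z ^+ kk j * z ^+ (n - kk j) by rewrite -exprD subnKC.
    by rewrite exprMn natrM -exprM; ring.
  rewrite big_split_ord /= addrAC subrr add0r; apply: rpred_sum => n _.
  by rewrite exprD -mulrA mulrCA dvdz_mulr.
(* One extra basis vector per column absorbs the error term; its exponent [N] exceeds that of every
   [inl n]. *)
pose P i (m : 'I_N + 'I_N) : int := match m with
  | inl n => 'C(zeta i, n)%:R | inr j => ((A' i j - B0 i j) %/ z ^+ N)%Z end.
pose E (m : 'I_N + 'I_N) : nat := match m with inl n => n | inr _ => N end.
pose Q (m : 'I_N + 'I_N) j : int := match m with inl n => Q0 n j | inr j' => (j' == j)%:R end.
apply: (@dvdz_det_expansion N _ A' P E Q z) => [i j|F injF]; last first.
  exact: (leq_sum_injective injF).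
rewrite big_sumType /= -/(B0 i j) (bigD1 j) //= eqxx mulr1 divzK ?dvdA //.
rewrite big1 ?addr0 => [|j' /negPf->]; last by rewrite !mulr0.
by rewrite addrC subrK.
Qed.
End Divisibility.

(** A nonzero integer is at least as large as its divisors: the left side is the divisor, and the
    right side bounds the determinant column by column. *)
Lemma leq_interpolation (K L R0 S nu g h2 Z X : nat) (h1 : int) :
  1 < g -> 0 < h2 -> h1 != 0%R -> 0 < Z -> R0 <= nu -> L * K.-1 < R0 * S ->
  Z %| g.-1 -> ((Z%:R ^+ (K * L))%R %| (h2%:R * g%:R ^+ nu - h1)%R)%Z ->
  h2 <= X -> `|h1|%N <= X ->
  Z ^ (\sum_(i < K * L) i) <= Z ^ (L * \sum_(k < K) k) *
    ((K * L)`! * ((\prod_(k < K) 'C((R0 + L.-1).-1 + nu * S.-1, k)) ^ L *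
       (g ^ (R0 + L.-1).-1 * X ^ S.-1) ^ (K * \sum_(l < L) l))).
Proof.
move=> g_gt1 h2_gt0 h1_neq0 Z_gt0 leR0 ltLK dvdg dvdh leh2 leh1.
set R := R0 + L.-1; set zM := R.-1 + _; set W := g ^ _ * _.
have [f det_neq0] := interpolation_rows g_gt1 h2_gt0 h1_neq0 leR0 ltLK.
have cardN : #|{: 'I_K * 'I_L}| = K * L by rewrite card_prod !card_ord.
rewrite -cardN in dvdh *.
have := dvdz_interp_det f dvdg (ltnW g_gt1) Z_gt0 dvdh.
set D := (\det _)%R => dvdD.
have leD : (`|D| <= (#|{: 'I_K * 'I_L}|)`!%:R *
    \prod_(j < #|{: 'I_K * 'I_L}|) ('C(zM, (enum_val j).1) * W ^ (enum_val j).2)%N%:R)%R.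
  apply: ler_norm_det => i j; rewrite mxE /interp_entry normrM normrX natrM natrX.
  rewrite [`|'C(_, _)%:R|%R]ger0_norm ?ler0n //.
  set k := (enum_val j).1; set l := (enum_val j).2; case: (f i) => r s /=.
  have ler : r <= R.-1 by rewrite -ltnS (ltn_predK (ltn_ord r)) ltn_ord.
  have les : s <= S.-1 by rewrite -ltnS (ltn_predK (ltn_ord s)) ltn_ord.
  apply: ler_pM; rewrite ?ler0n ?exprn_ge0 //.
    by rewrite ler_nat leq_bin2l // leq_add // leq_mul2l les orbT.
  apply: lerXn2r; rewrite ?nnegrE ?ler0n // /W natrM !natrX.
  rewrite !normrM !normrX !normr_nat -mulrA.
  apply: ler_pM; rewrite ?mulr_ge0 ?exprn_ge0 ?ler0n //.
    by rewrite ler_eXn2l // ltr1n.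
  rewrite -(subnKC les) exprD; apply: ler_pM; rewrite ?exprn_ge0 ?ler0n ?subnKC //.
    by apply: lerXn2r; rewrite ?nnegrE ?ler0n //  -[`|h1|%R]abszE natz lez_nat.
  by apply: lerXn2r; rewrite ?nnegrE ?ler0n // ler_nat.
have : ((Z ^ (\sum_(i < #|{: 'I_K * 'I_L}|) i))%:R <=
    (Z ^ (\sum_(c : 'I_K * 'I_L) c.1) *  ((#|{: 'I_K * 'I_L}|)`! *
     \prod_(c : 'I_K * 'I_L) ('C(zM, c.1) * W ^ c.2)))%:R :> int)%R.
  move: leD; rewrite (big_enum_val_all _
    (fun c : 'I_K * 'I_L => ('C(zM, c.1) * W ^ c.2)%N%:R%R)) -natr_prod -natrM => leD.
  rewrite natrM; apply: le_trans (ler_wpM2l _ leD); rewrite ?ler0n // -abszE -natz -natrM ler_nat.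
  move: dvdD; rewrite dvdzE => /dvdn_leq.
  rewrite absz_gt0 mulf_neq0 ?expf_neq0 ?pnatr_eq0 -?lt0n // => /(_ isT).
  by rewrite abszM !abszX natz absz_nat.
rewrite ler_nat => /leq_trans; apply.
have sumk : \sum_(c : 'I_K * 'I_L) c.1 = L * \sum_(k < K) k.
  rewrite -(pair_bigA _ (fun (k : 'I_K) (l : 'I_L) => k : nat)) big_distrr /=.
  by apply: eq_bigr => k _; rewrite sum_nat_const card_ord.
rewrite sumk leq_mul2l leq_mul2l; apply/orP; right; apply/orP; right.
rewrite -(pair_bigA _ (fun (k : 'I_K) (l : 'I_L) => 'C(zM, k) * W ^ l)) /=.
under eq_bigr => k _ do rewrite big_split prod_nat_const card_ord -expn_sum /=.
rewrite big_split prod_nat_const card_ord /= -expnM [K * _]mulnC.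
by rewrite -(big_morph (expn^~ L) (fun x y => expnMn x y L) (exp1n L)).
Qed.

(** * Numerical estimates and the choice of parameters *)

Lemma sum_ord_double n : (\sum_(i < n) i) * 2 = n * n.-1.
Proof.
elim: n => [|n IHn]; first by rewrite big_ord0.
by rewrite big_ord_recr mulnDl IHn /=; case: n {IHn} => // n; rewrite /= -mulnDr !mulnS; lia.
Qed.

Lemma fact_leq_expn n : n`! <= n ^ n.
Proof.
elim: n => // n IHn; rewrite factS expnS leq_mul2l /=.
by apply: leq_trans IHn _; case: n => // n; rewrite leq_exp2r.
Qed.

(** The factors [k] and [K.-1 - k] are paired: their product is one term of the Vandermonde
    convolution for ['C(2 * m, K.-1)]. *)
Lemma prod_bin_sqr (m K : nat) :
  (\prod_(k < K) 'C(m, k)) ^ 2 <= 'C(2 * m, K.-1) ^ K.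
Proof.
rewrite expnS expn1 [X in X * _](reindex_inj rev_ord_inj) -big_split /=.
rewrite -[X in _ ^ X]card_ord -prod_nat_const; apply: leq_prod => k _.
case: K k => [[]//|K] k /=; rewrite subSS mul2n -addnn -binomial.Vandermonde mulnC.
by rewrite (bigD1 k) //= leq_addr.
Qed.

Lemma bin_fact_leq_expn n m : 'C(n, m) * m`! <= n ^ m.
Proof.
rewrite bin_ffact ffact_prod -[X in _ ^ X]card_ord -prod_nat_const.
by apply: leq_prod => i _; apply: leq_subr.
Qed.

Lemma expnS_leq3 n : n.+1 ^ n <= 3 * n ^ n.
Proof.
case: n => // n; set m := n.+1.
(* This is [(1 + 1 / m) ^ k <= 1 + k / m + (k / m) ^ 2] for [k <= m], cleared of denominators;
   [k = m] gives the constant 3. *)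
have IH k : k <= m -> m.+1 ^ k * m ^ 2 <= m ^ k * (m ^ 2 + k * m + k ^ 2).
  elim: k => [|k IHk] lek; first by rewrite mul0n !addn0.
  have {}IHk := IHk (ltnW lek).
  rewrite [m.+1 ^ k.+1]expnS [m ^ k.+1]expnS -mulnA [m * _]mulnC -mulnA.
  apply: leq_trans (_ : m.+1 * (m ^ k * (m ^ 2 + k * m + k ^ 2)) <= _).
    by rewrite leq_mul2l IHk.
  rewrite mulnCA leq_mul2l; apply/orP; right; nia.
have := IH m (leqnn m); have -> : m ^ 2 + m * m + m ^ 2 = 3 * m ^ 2 by lia.
by rewrite mulnA leq_pmul2r ?expn_gt0 // [_ * 3]mulnC.
Qed.

Lemma expn_leq_fact n : n ^ n <= 3 ^ n * n`!.
Proof.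
elim: n => // n IHn; rewrite [n.+1 ^ _]expnS [3 ^ _]expnS factS -mulnA [3 ^ n * _]mulnCA.
rewrite mulnCA leq_mul2l; apply/orP; right.
by apply: leq_trans (expnS_leq3 n) _; rewrite leq_mul2l IHn.
Qed.

(** Final contradiction of the determinant argument, where [k.+1 = K >= 104] and
    [325 = det_threshold 1]. *)
Lemma expn45_bound k : 103 <= k -> k.+1 ^ 4 * 4 ^ k < 325 * 5 ^ k.
Proof.
move=> lek; rewrite -(subnKC lek); elim: (k - 103) => [|i]; last first.
  rewrite addnS; set m := 103 + i; have : 103 <= m by rewrite leq_addr.
  move: m => m ltm; rewrite [4 ^ m.+1]expnS [5 ^ m.+1]expnS => IHm.
  have step : 4 * m.+2 ^ 4 <= 5 * m.+1 ^ 4.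
    have -> : m.+2 ^ 4 = m.+1 ^ 4 + 4 * m.+1 ^ 3 + 6 * m.+1 ^ 2 + 4 * m.+1 + 1 by lia.
    have : 104 * m.+1 <= m.+1 ^ 2 by rewrite expnS expn1 leq_mul2r ltnS ltm.
    have : 104 * m.+1 ^ 2 <= m.+1 ^ 3 by rewrite [_ ^ 3]expnS leq_mul2r ltnS ltm orbT.
    have : 104 * m.+1 ^ 3 <= m.+1 ^ 4 by rewrite [_ ^ 4]expnS leq_mul2r ltnS ltm orbT.
    by move: (m.+1 ^ 4) (m.+1 ^ 3) (m.+1 ^ 2) => x4 x3 x2; lia.
  rewrite mulnCA [325 * _]mulnCA mulnA.
  apply: leq_ltn_trans (_ : 5 * m.+1 ^ 4 * 4 ^ m < _); first by rewrite leq_mul2r step orbT.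
  by rewrite -mulnA ltn_pmul2l.
by rewrite addn0; lia.
Qed.

(* The threshold above which the determinant with [L = 2u + 1] is conclusive. *)
Definition det_threshold u := (4 * u + 1) * (2 * u + 3) * (8 * u + 5).

(** Here [B] is ['C(Y, M)] and [F] is [M!]. As [M ^ M <= 3 ^ M * F], the binomial is at most
    [(3 * Y / M) ^ M], and the bound on [15 * Y] makes that base at most [4 * nu / 5]. *)
Lemma bin_comparison nu M C Y B F : 0 < M -> 0 < nu ->
  nu ^ M.+1 <= C * B -> B * F <= Y ^ M -> M ^ M <= 3 ^ M * F -> 15 * Y <= 4 * M * nu ->
  nu * 5 ^ M <= C * 4 ^ M.
Proof.
move=> M_gt0 nu_gt0 leB leY leF le15.
have p_gt0 : 0 < (M * nu) ^ M by rewrite expn_gt0 muln_gt0 M_gt0 nu_gt0.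
rewrite -(leq_pmul2r p_gt0) -[C * _ * _]mulnA -expnMn mulnA.
apply: leq_trans (_ : C * (15 * Y) ^ M <= _); last first.
  by rewrite leq_mul2l leq_exp2r // le15 orbT.
rewrite !expnMn (_ : 15 = 5 * 3) // [(5 * 3) ^ M]expnMn.
apply: leq_trans (_ : 5 ^ M * ((3 ^ M * F) * (C * B)) <= _).
  have -> : nu * 5 ^ M * (M ^ M * nu ^ M) = 5 ^ M * (M ^ M * nu ^ M.+1) by rewrite expnS; ring.
  by rewrite leq_mul2l leq_mul ?orbT.
have -> : 5 ^ M * (3 ^ M * F * (C * B)) = C * (5 ^ M * 3 ^ M * (B * F)) by ring.
by rewrite !leq_mul2l leY !orbT.
Qed.

(** The parameters are [L = 2 u + 1], [R0 = rho = 4 (u + 1) L], [S = sg + 1] and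
    [K = 4 (u + 1) sg = 2 H], with [sg] least such that [g ^ R1 <= Z ^ ((u + 1) sg)]. Then
    [W <= Z ^ H], so the entries consume half of the exponent of [Z] left after the column scaling.
    The other half is at least [nu ^ (H * N)] and would have to be covered by the factorial and the
    binomials, which are too small. *)
Lemma no_congruent_power (u Z g h2 nu X : nat) (h1 : int) :
  0 < u -> 1 < Z < g -> Z %| g.-1 -> 0 < h2 <= X -> h1 != 0%R -> `|h1|%N <= X ->
  X <= Z ^ u.+1 -> det_threshold u <= nu <= Z ^ u ->
  (forall N, Z ^ N <= g ^ nu -> ((Z%:R ^+ N)%R %| (h2%:R * g%:R ^+ nu - h1)%R)%Z) ->
  False.
Proof.
move=> u_gt0 /andP[Z_gt1 ltZg] dvdg /andP[h2_gt0 leh2] h1_neq0 leh1 leX /andP[lenu lenuZ] dvdh.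
have [L eL] : {L | L = 2 * u + 1} by exists (2 * u + 1).
have [rho erho] : {rho | rho = 4 * u.+1 * L} by exists (4 * u.+1 * L).
have [R1 eR1] : {R1 | R1 = (4 * u + 1) * (2 * u + 3)} by exists ((4 * u + 1) * (2 * u + 3)).
have L_gt0 : 0 < L by rewrite eL addn1.
have rho_gt0 : 0 < rho by rewrite erho !muln_gt0.
have R1_gt0 : 0 < R1 by rewrite eR1 muln_gt0 !addn_gt0 /= !orbT.
have eqR : (rho + L.-1).-1 = R1 by rewrite erho eR1 eL; lia.
have {}lenu : R1 * (8 * u + 5) <= nu by rewrite eR1.
have Z_gt0 := ltnW Z_gt1; have g_gt1 := ltn_trans Z_gt1 ltZg.
have exs : exists s, g ^ R1 <= Z ^ (u.+1 * s).
  exists (g * R1); rewrite mulnA expnM leq_exp2r //.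
  apply: leq_trans (ltnW (ltn_expl g Z_gt1)) _.
  by rewrite leq_exp2l // leq_pmull.
have [sg leg min_sg] := ex_minnP exs.
have sg_ge : 8 * u + 5 <= sg.
  have : Z ^ R1 < Z ^ (u.+1 * sg) by apply: leq_trans leg; rewrite ltn_exp2r.
  rewrite ltn_exp2l // eR1 => lt1; rewrite leqNgt; apply/negP => lt2.
  have : u.+1 * sg <= u.+1 * (8 * u + 4) by rewrite leq_mul2l; apply/orP; right; lia.
  by lia.
have ltg : Z ^ (u.+1 * sg.-1) < g ^ R1 by rewrite ltnNge; apply/negP => /min_sg; lia.
have [H eH] : {H | H = 2 * u.+1 * sg} by exists (2 * u.+1 * sg).
have [K eK] : {K | K = 2 * H} by exists (2 * H).
have [N eN] : {N | N = K * L} by exists (K * L).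
have eqN : N = rho * sg by rewrite eN eK eH erho; ring.
have N_gt0 : 0 < N by rewrite eqN muln_gt0 rho_gt0; lia.
have K_gt0 : 0 < K by move: N_gt0; rewrite eN muln_gt0 => /andP[].
(* By minimality of [sg], [g ^ R1] exceeds [Z ^ ((u + 1) (sg - 1))], and [nu >= R1 (8 u + 5)]. What
   is needed, [(sg - 1) (8 u + 5) >= sg (8 u + 4)], is just [sg >= 8 u + 5]: hence the last factor
   of [det_threshold]. *)
have leZN : Z ^ N <= g ^ nu.
  rewrite -(leq_exp2r _ _ R1_gt0) -!expnM [nu * _]mulnC [g ^ _]expnM.
  apply: leq_trans (_ : (Z ^ (u.+1 * sg.-1)) ^ nu <= _); last first.
    by case: (nu) => // n; rewrite leq_exp2r // ltnW.
  rewrite -expnM leq_exp2l // eqN.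
  apply: leq_trans (_ : u.+1 * sg.-1 * (R1 * (8 * u + 5)) <= _); last by rewrite leq_mul2l lenu orbT.
  have -> : u.+1 * sg.-1 * (R1 * (8 * u + 5)) = R1 * (u.+1 * (sg.-1 * (8 * u + 5))) by ring.
  have -> : rho * sg * R1 = R1 * (u.+1 * (sg * (8 * u + 4))) by rewrite erho eL; ring.
  rewrite !leq_mul2l; apply/orP; right; apply/orP; right.
  by case: (sg) sg_ge => // s; rewrite /=; nia.
have rho_le : rho <= nu.
  apply: leq_trans lenu; apply: leq_trans (_ : R1 <= _); last by rewrite leq_pmulr // addn_gt0 orbT.
  by rewrite -eqR eL; lia.
have ltLK : L * K.-1 < rho * sg.+1.
  apply: leq_ltn_trans (_ : rho * sg < _); last by rewrite ltn_pmul2l.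
  by rewrite -eqN eN mulnC leq_mul2r leq_pred orbT.
have := dvdh _ leZN; rewrite {1}eN => dvdN.
have := leq_interpolation g_gt1 h2_gt0 h1_neq0 Z_gt0 rho_le ltLK dvdg dvdN leh2 leh1.
rewrite eqR [sg.+1.-1]/= -eN; set zM := R1 + nu * sg; set PC := \prod_(k < K) _.
set W := g ^ R1 * X ^ sg => main.
have leW : W <= Z ^ H.
  have -> : Z ^ H = Z ^ (u.+1 * sg) * Z ^ (u.+1 * sg).
    by rewrite -expnD; congr (_ ^ _); rewrite eH; ring.
  apply: leq_mul; first exact: leg.
  by rewrite expnM; case: (sg) => // s; rewrite leq_exp2r.
have eqLs : \sum_(l < L) l = L * u.
  by apply: double_inj; rewrite -!muln2 sum_ord_double -mulnA; congr (_ * _); rewrite eL addn1 /= mulnC.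
(* [N - 1 = (K - 1) + 2 u K] splits the exponent into the share of the column scaling and two equal
   shares [H * (N * u)]. *)
have eqA : \sum_(i < N) i = L * (\sum_(k < K) k) + H * (N * u) + H * (N * u).
  apply: double_inj; rewrite -!muln2 !mulnDl -[L * _ * 2]mulnA !sum_ord_double.
  have -> : N.-1 = K.-1 + K * (2 * u).
    by rewrite eN eL mulnDr muln1; case: (K) K_gt0 => // k _; rewrite addnS /= addnC.
  by rewrite eN eK; clear; ring.
have le1 : nu ^ (H * N) <= N`! * PC ^ L.
  apply: leq_trans (_ : Z ^ (H * (N * u)) <= _).
    have -> : H * (N * u) = u * (H * N) by ring.
    by rewrite [Z ^ _]expnM; move: (H * N) => [//|e]; rewrite leq_exp2r.
  move: main; rewrite eqLs eqA !expnD -mulnA leq_pmul2l ?expn_gt0 ?Z_gt0 //.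
  have -> : K * (L * u) = N * u by rewrite eN mulnA.
  have leWN : W ^ (N * u) <= Z ^ (H * (N * u)).
    by rewrite [Z ^ _]expnM; move: (N * u) => [//|e]; rewrite leq_exp2r.
  move=> main; rewrite -(leq_pmul2r (_ : 0 < Z ^ (H * (N * u)))) ?expn_gt0 ?Z_gt0 //.
  by apply: leq_trans main _; rewrite -mulnA !leq_mul2l leWN !orbT.
have le2 : nu ^ K <= N ^ 2 * 'C(2 * zM, K.-1).
  rewrite -(leq_exp2r _ _ N_gt0) expnMn -!expnM.
  have -> : K * N = H * N * 2 by rewrite eK; ring.
  rewrite expnM (leq_trans (_ : _ <= (N`! * PC ^ L) ^ 2)) ?leq_exp2r // expnMn.
  apply: leq_mul; first by rewrite mulnC expnM leq_exp2r // fact_leq_expn.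
  rewrite eN expnM -expnM [L * 2]mulnC !expnM leq_exp2r //.
  exact: prod_bin_sqr.
have K_ge : 104 <= K by rewrite eK eH; clear -u_gt0 sg_ge; nia.
(* As [K = 4 (u + 1) sg], the ratio [2 zM / (K - 1)] is close to [nu / (2 (u + 1)) <= nu / 4], which
   leaves room for [4 nu / 15]. *)
have le3 : 30 * zM <= 4 * K.-1 * nu.
  have leR : R1 * 13 <= nu.
    have le13 : 13 <= 8 * u + 5 by clear -u_gt0; lia.
    by apply: leq_trans lenu; apply: leq_mul le13.
  have : K.-1.+1 = 4 * u.+1 * sg by rewrite prednK // eK eH; ring.
  rewrite /zM; move: (K.-1) => M eqM; clear -eqM leR sg_ge u_gt0; nia.
have leNK : N <= K ^ 2.
  by rewrite eN expnS expn1 leq_mul2l; apply/orP; right; rewrite eL eK eH; clear -u_gt0 sg_ge; nia.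
have nu_ge : 325 <= nu by apply: leq_trans lenu; rewrite eR1; clear -u_gt0; nia.
have K1 : 103 <= K.-1 by rewrite -ltnS prednK.
have := expn45_bound K1; rewrite prednK //; apply/negP; rewrite -leqNgt.
apply: leq_trans (_ : nu * 5 ^ K.-1 <= _); first by rewrite leq_mul2r nu_ge orbT.
apply: leq_trans (_ : N ^ 2 * 4 ^ K.-1 <= _); last first.
  have e4 : K ^ 4 = (K ^ 2) ^ 2 by rewrite -expnM.
  by rewrite leq_mul2r e4 leq_exp2r // leNK orbT.
have M_gt0 : 0 < K.-1 by apply: leq_trans K1.
have nu_gt0 : 0 < nu by apply: leq_trans nu_ge.
have le4 : 15 * (2 * zM) <= 4 * K.-1 * nu by rewrite mulnA.
apply: (bin_comparison M_gt0 nu_gt0 _ (bin_fact_leq_expn _ _) (expn_leq_fact _) le4).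
by rewrite prednK.
Qed.

(** * Differences of even length *)

Section QuadraticPowers.
Local Open Scope ring_scope.

(* [(S, T)] with [(sqrt w + sqrt (-c)) ^ m] equal to [S sqrt w + T sqrt (-c)] for odd [m]
   and to [S + T sqrt (-wc)] for even [m]. *)
Fixpoint spow (w c : int) (m : nat) : int * int :=
  if m is m'.+1 then
    let: (s, t) := spow w c m' in
    if odd m' then (w * s - c * t, s + t) else (s - c * t, s + w * t)
  else (1, 0).

Lemma dvdz_add (d x y : int) : (d %| x -> d %| y -> d %| x + y)%Z.
Proof. by move=> dx dy; apply: (rpredD dx dy). Qed.

Lemma dvdz_sub (d x y : int) : (d %| x -> d %| y -> d %| x - y)%Z.
Proof. by move=> dx dy; apply: (rpredB dx dy). Qed.

Lemma Euclid_dvdzM (a : nat) (x y : int) : prime a ->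
  (a%:Z %| x * y)%Z = (a%:Z %| x)%Z || (a%:Z %| y)%Z.
Proof. by move=> pa; rewrite !dvdzE abszM Euclid_dvdM. Qed.

Lemma Euclid_dvdzX (a : nat) (x : int) n : prime a -> (0 < n)%N ->
  (a%:Z %| x ^+ n)%Z = (a%:Z %| x)%Z.
Proof. by move=> pa n_gt0; rewrite !dvdzE abszX Euclid_dvdX // n_gt0 andbT. Qed.

Lemma prime_pow_dvd_diff_sqr (a k : nat) (x y : int) : prime a -> (2 < a)%N ->
  ~~ (a%:Z %| x)%Z -> ((a%:Z) ^+ k %| x ^+ 2 - y ^+ 2)%Z ->
  (a%:Z ^+ k %| x - y)%Z \/ (a%:Z ^+ k %| x + y)%Z.
Proof.
move=> pa a_gt2 nax; rewrite subr_sqr.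
have cop (z : int) : ~~ (a%:Z %| z)%Z -> coprimez (a%:Z ^+ k) z.
  move=> naz; rewrite coprimezE abszX coprimeXl //=.
  by rewrite prime_coprime //; move: naz; rewrite dvdzE.
have [ax|/cop ncop] := boolP (a%:Z %| x - y)%Z; last by rewrite Gauss_dvdzr //; right.
have naxy : ~~ (a%:Z %| x + y)%Z.
  apply: contra nax => axy; have : (a%:Z %| x *+ 2)%Z.
    have -> : x *+ 2 = (x - y) + (x + y) by ring.
    exact: dvdz_add.
  rewrite -mulr_natr Euclid_dvdzM // => /orP[//|].
  by rewrite dvdzE => /dvdn_leq => /(_ isT); rewrite leqNgt absz_nat a_gt2.
by rewrite Gauss_dvdzl ?cop //; left.
Qed.

(** Multiplying by the conjugate [sqrt w - sqrt (- c)] lowers the power by one and pulls out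
    [w + c]; this expression is the coefficient of [sqrt w] in the product. For odd [m] the
    corresponding one is the rational part. *)
Lemma spow_even_conj (w c : int) m : ~~ odd m -> (0 < m)%N ->
  (w + c %| (spow w c m).1 + c * (spow w c m).2)%Z.
Proof.
case: m => //= m; rewrite negbK => om _; case: (spow w c m) => u v; rewrite om /=.
have -> : w * u - c * v + c * (u + v) = (w + c) * u by ring.
exact: dvdz_mulr.
Qed.

Lemma spow_odd_conj (w c : int) m : odd m ->
  (w + c %| w * (spow w c m).1 + c * (spow w c m).2)%Z.
Proof.
case: m => //= m om; case: (spow w c m) => u v; rewrite (negPf om) /=.
have -> : w * (u - c * v) + c * (u + w * v) = (w + c) * u by ring.
exact: dvdz_mulr.
Qed.

Lemma eq_norm_sign (x y : int) : `|x| = `|y| -> exists2 e : int, e ^+ 2 = 1 & x = e * y.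
Proof.
move=> /eqP; rewrite eqr_norm2 => /orP[/eqP->|/eqP->].
  by exists 1; rewrite ?mul1r.
by exists (-1); rewrite ?mulN1r ?sqrrN.
Qed.

Lemma sqr_ge1 (x : int) : x != 0 -> 1 <= x ^+ 2.
Proof. by move=> x0; rewrite -gtz0_ge1 exprn_even_gt0 //= x0. Qed.

Lemma sqr1_norm (e : int) : e ^+ 2 = 1 -> `|e| = 1.
Proof. by move=> /eqP; rewrite sqrf_eq1 => /orP[] /eqP->. Qed.

(** Strong induction on [x] for both shapes at once, since division by [sqrt w + sqrt (- c)]
    exchanges them. Below [x1], size and the condition on [a] leave only the zeroth power. From [x1]
    on, [p ^ 2] and [q ^ 2] (or [s ^ 2] and [(c t) ^ 2]) agree modulo [a ^ x1], hence so do the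
    roots up to sign; this means that [sqrt w + sqrt (- c)] or its conjugate divides, with a
    quotient of exponent [x - x1]. *)
Lemma spow_descent (a x1 : nat) (w c : int) :
  prime a -> (2 < a)%N -> (0 < x1)%N -> 1 < w -> 1 < c -> w + c = a%:Z ^+ x1 ->
  ~~ (a%:Z %| w)%Z -> forall x,
  (forall p q, w * p ^+ 2 + c * q ^+ 2 = a%:Z ^+ x -> ~~ (a%:Z %| p)%Z ->
     exists m, [/\ odd m, x = (m * x1)%N, `|p| = `|(spow w c m).1| & `|q| = `|(spow w c m).2|]) /\
  (forall s t, s ^+ 2 + w * c * t ^+ 2 = a%:Z ^+ x -> ~~ (a%:Z %| s)%Z ->
     exists m, [/\ ~~ odd m, x = (m * x1)%N, `|s| = `|(spow w c m).1| & `|t| = `|(spow w c m).2|]).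
Proof.
move=> pa a_gt2 x1_gt0 w_gt1 c_gt1 eqX naw.
have a_gt0 := prime_gt0 pa; have A_gt0 : 0 < a%:Z by rewrite ltz_nat.
have X_neq0 k : a%:Z ^+ k != 0 by rewrite expf_neq0 // gt_eqF.
have dvdaX : (a%:Z %| w + c)%Z by rewrite eqX -(prednK x1_gt0) exprS dvdz_mulr.
have nac : ~~ (a%:Z %| c)%Z by apply: contra naw => ac; rewrite -(addrK c w) rpredB.
have cop1 : coprimez (a%:Z ^+ x1) c.
  by rewrite coprimezE abszX coprimeXl //= prime_coprime //; move: nac; rewrite dvdzE.
have ndvd1 : ~~ (a%:Z %| 1)%Z by rewrite dvdzE /= dvdn1 gtn_eqF ?prime_gt1.
move=> x; have [n] := ubnP x; elim: n x => // n IHn x /ltnSE lexn.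
have [ltx|lex] := ltnP x x1.
  have ltXx : a%:Z ^+ x < w + c by rewrite eqX ltr_eXn2l // ltz_nat prime_gt1.
  split=> [p q eqn nap|s t eqn nas].
    have p_neq0 : p != 0 by apply: contraNneq nap => ->; rewrite dvdz0.
    have [q0|q_neq0] := eqVneq q 0.
      move: eqn; rewrite q0 expr0n mulr0 addr0 => eqn.
      have : (w %| a%:Z ^+ x)%Z by rewrite -eqn dvdz_mulr.
      have copw : coprimez w (a%:Z ^+ x).
        by rewrite coprimez_sym coprimezE abszX coprimeXl //= prime_coprime //; move: naw; rewrite dvdzE.
      rewrite -[a%:Z ^+ x]mulr1 Gauss_dvdzr // dvdzE /= dvdn1.
      by move=> /eqP w1; clear -w1 w_gt1; lia.
    have p2 := sqr_ge1 p_neq0.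
    have q2 := sqr_ge1 q_neq0.
    by move: ltXx; rewrite -eqn; clear -p2 q2 w_gt1 c_gt1; nia.
  have s_neq0 : s != 0 by apply: contraNneq nas => ->; rewrite dvdz0.
  have s2 := sqr_ge1 s_neq0.
  have [t0|t_neq0] := eqVneq t 0; last first.
    have t2 := sqr_ge1 t_neq0.
    have : w + c <= s ^+ 2 + w * c * t ^+ 2.
      have : w * c <= w * c * t ^+ 2 by rewrite ler_peMr // mulr_ge0 // ltW // (lt_trans ltr01).
      by clear -s2 w_gt1 c_gt1; nia.
    by rewrite eqn leNgt ltXx.
  move: eqn; rewrite t0 expr0n mulr0 addr0 => eqn.
  have x0 : x = 0%N.
    case: x eqn {lexn ltx ltXx} => // x eqn; case/negP: nas.
    by rewrite -(Euclid_dvdzX _ pa (ltn0Sn 1)) eqn exprS dvdz_mulr.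
  exists 0%N; rewrite x0; split=> //=; rewrite normr1; apply: sqr1_norm.
  by rewrite eqn x0.
have [x' eqx] : exists x', x = (x1 + x')%N by exists (x - x1)%N; rewrite subnKC.
have ltx' : (x' < n)%N by rewrite (leq_trans _ lexn) // eqx -{1}[x']add0n ltn_add2r.
have [IH1 IH0] := IHn x' ltx'.
have eqAx : a%:Z ^+ x = (w + c) * a%:Z ^+ x' by rewrite eqX -exprD -eqx.
have X2 : (w + c) ^+ 2 != 0 by rewrite eqX expf_neq0.
have dvdXx : (w + c %| a%:Z ^+ x)%Z by rewrite eqAx dvdz_mulr.
split=> [p q eqn nap|s t eqn nas].
  have [e e2 /dvdzP[r eqr]] : exists2 e : int, e ^+ 2 = 1 & (w + c %| p + e * q)%Z.
    have : (w + c %| p ^+ 2 - q ^+ 2)%Z.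
      rewrite -(@Gauss_dvdzr _ c) ?eqX // -eqX.
      have -> : c * (p ^+ 2 - q ^+ 2) = (w + c) * p ^+ 2 - (w * p ^+ 2 + c * q ^+ 2) by ring.
      by rewrite eqn dvdz_sub // dvdz_mulr.
    rewrite eqX => /(prime_pow_dvd_diff_sqr pa a_gt2 nap) [dvd|dvd].
      by exists (-1); rewrite ?sqrrN ?mulN1r.
    by exists 1; rewrite ?mul1r.
  (* [s + t sqrt (- w c)] is the quotient of [p sqrt w + q sqrt (- c)] by
     [sqrt w - e sqrt (- c)]. *)
  pose s := p - c * r; pose t := e * r.
  have eqp : p = s + e * c * t.
    rewrite /s /t; have -> : e * c * (e * r) = e ^+ 2 * (c * r) by ring.
    by rewrite e2; ring.
  have eqq : q = w * t - e * s.
    have -> : q = e ^+ 2 * q by rewrite e2 mul1r.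
    have -> : e ^+ 2 * q = e * ((p + e * q) - p) by ring.
    by rewrite eqr /s /t; ring.
  clearbody s t.
  have eqst : s ^+ 2 + w * c * t ^+ 2 = a%:Z ^+ x'.
    have wc0 : w + c != 0 by rewrite eqX.
    apply: (mulfI wc0); rewrite -eqAx -eqn {1}eqp eqq.
    have -> : (w + c) * (s ^+ 2 + w * c * t ^+ 2) =
      w * (s ^+ 2 + c ^+ 2 * t ^+ 2) + c * (w ^+ 2 * t ^+ 2 + s ^+ 2) by ring.
    transitivity (w * (s ^+ 2 + e ^+ 2 * c ^+ 2 * t ^+ 2) + c * (w ^+ 2 * t ^+ 2 + e ^+ 2 * s ^+ 2)).
      by rewrite e2; ring.
    by ring.
  have nas : ~~ (a%:Z %| s)%Z.
    apply/negP => as_; case: x' {eqx ltx' IH1 IH0 eqAx} eqst => [|x'] eqst.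
      have t0 : t = 0.
        apply/eqP; apply: contra_eqT eqst => /sqr_ge1 t2; rewrite expr0.
        have : 0 <= s ^+ 2 by rewrite sqr_ge0.
        by clear -t2 w_gt1 c_gt1; nia.
      by case/negP: nap; rewrite eqp t0 mulr0 addr0.
    have : (a%:Z %| w * c * t ^+ 2)%Z.
      have -> : w * c * t ^+ 2 = a%:Z ^+ x'.+1 - s * s by rewrite -eqst; ring.
      by rewrite dvdz_sub ?exprS ?dvdz_mulr.
    rewrite -mulrA Euclid_dvdzM // (negPf naw) /= Euclid_dvdzM // (negPf nac) /= Euclid_dvdzX // => at_.
    by case/negP: nap; rewrite eqp dvdz_add // dvdz_mull.
  have [m [em eqm eqs eqt]] := IH0 s t eqst nas.
  have [e1 e1_2 es] := eq_norm_sign eqs; have [e3 e3_2 et] := eq_norm_sign eqt.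
  (* The quotient is a power or its conjugate, up to sign. If [e1 * e3 * e = -1], multiplying back
     yields the next power; otherwise the power meets the conjugate factor and [a] divides [p],
     unless it is the zeroth power. *)
  have [e4 | e4] : e1 * e3 * e = -1 \/ e1 * e3 * e = 1.
    have : (e1 * e3 * e) ^+ 2 = 1 by rewrite !exprMn e1_2 e3_2 e2 !mulr1.
    by move/eqP; rewrite sqrf_eq1 => /orP[]/eqP->; [right|left].
  - have ee3 : e3 * e = - e1.
      have -> : e3 * e = e1 ^+ 2 * (e3 * e) by rewrite e1_2 mul1r.
      have -> : e1 ^+ 2 * (e3 * e) = e1 * (e1 * e3 * e) by ring.
      by rewrite e4 mulrN1.
    have e33 : e3 = - (e1 * e).
      have -> : e3 = e3 * e ^+ 2 by rewrite e2 mulr1.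
      by rewrite expr2 mulrA ee3 mulNr.
    exists m.+1; rewrite /= em eqx eqm mulSn; split=> //.
      rewrite eqp es et; case: (spow w c m) => u v; rewrite (negPf em) /=.
      have -> : e1 * u + e * c * (e3 * v) = e1 * (u - c * v).
        have -> : e * c * (e3 * v) = (e3 * e) * (c * v) by ring.
      by rewrite ee3; ring.
      by rewrite normrM (sqr1_norm e1_2) mul1r.
    rewrite eqq es et; case: (spow w c m) => u v; rewrite (negPf em) /=.
    have -> : w * (e3 * v) - e * (e1 * u) = - (e1 * e) * (u + w * v).
      by rewrite e33; ring.
    by rewrite normrM normrN normrM (sqr1_norm e1_2) (sqr1_norm e2) !mul1r.
  have ee3 : e3 * e = e1.
    have -> : e3 * e = e1 ^+ 2 * (e3 * e) by rewrite e1_2 mul1r.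
    have -> : e1 ^+ 2 * (e3 * e) = e1 * (e1 * e3 * e) by ring.
    by rewrite e4 mulr1.
  have eqp' : p = e1 * ((spow w c m).1 + c * (spow w c m).2).
    by rewrite eqp es et mulrDr -{3}ee3; congr (_ + _); ring.
  case: m em eqm eqs eqt es et eqp' => [|m] em eqm eqs eqt es et eqp'.
    exists 1%N; rewrite /= eqx eqm mul0n mul1n addn0; split=> //.
      by rewrite eqp' /= !(mulr0, subr0, addr0, mulr1) (sqr1_norm e1_2) normr1.
    by rewrite eqq et es /= !(mulr0, sub0r, addr0, mulr1) normrN normrM (sqr1_norm e1_2) (sqr1_norm e2) mulr1 normr1.
  case/negP: nap; rewrite eqp' dvdz_mull //.
  exact: dvdz_trans dvdaX (spow_even_conj _ _ em (ltn0Sn _)).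
have [e e2 /dvdzP[r eqr]] : exists2 e : int, e ^+ 2 = 1 & (w + c %| s - e * c * t)%Z.
  have nas' : (w + c %| s ^+ 2 - (c * t) ^+ 2)%Z.
    have -> : s ^+ 2 - (c * t) ^+ 2 = (s ^+ 2 + w * c * t ^+ 2) - (w + c) * (c * t ^+ 2) by ring.
    by rewrite eqn dvdz_sub // dvdz_mulr.
  move: nas'; rewrite eqX => /(prime_pow_dvd_diff_sqr pa a_gt2 nas) [dvd|dvd].
    by exists 1; rewrite ?mul1r.
  by exists (-1); rewrite ?sqrrN ?mulN1r ?mulNr ?opprK.
(* [p sqrt w + q sqrt (- c)] is the quotient of [s + t sqrt (- w c)] by [sqrt w - e sqrt (- c)]. *)
pose p := r; pose q := t + e * r.
have eqs : s = w * p + e * c * q.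
  have -> : s = (s - e * c * t) + e * c * t by ring.
  rewrite eqr /p /q; have -> : e * c * (t + e * r) = e * c * t + e ^+ 2 * (c * r) by ring.
  by rewrite e2; ring.
have eqt : t = q - e * p by rewrite /p /q; ring.
clearbody p q.
have eqpq : w * p ^+ 2 + c * q ^+ 2 = a%:Z ^+ x'.
  have wc0 : w + c != 0 by rewrite eqX.
  apply: (mulfI wc0); rewrite -eqAx -eqn {1}eqs eqt.
  transitivity (w ^+ 2 * p ^+ 2 + c ^+ 2 * e ^+ 2 * q ^+ 2 + w * c * q ^+ 2 +
    w * c * e ^+ 2 * p ^+ 2); first by rewrite e2; ring.
  by ring.
have nap : ~~ (a%:Z %| p)%Z.
  apply/negP => ap; case: x' {eqx ltx' IH1 IH0 eqAx} eqpq => [|x'] eqpq.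
    have q0 : q = 0.
      apply/eqP; apply: contra_eqT eqpq => /sqr_ge1 q2; rewrite expr0.
      have : 0 <= w * p ^+ 2 by rewrite mulr_ge0 ?sqr_ge0 // ltW // (lt_trans ltr01).
      by clear -q2 w_gt1 c_gt1; nia.
    by case/negP: nas; rewrite eqs q0 mulr0 addr0 dvdz_mull.
  have : (a%:Z %| c * q ^+ 2)%Z.
    have -> : c * q ^+ 2 = a%:Z ^+ x'.+1 - w * p * p by rewrite -eqpq; ring.
    by apply: dvdz_sub; [rewrite exprS dvdz_mulr | rewrite dvdz_mull].
  rewrite Euclid_dvdzM // (negPf nac) /= Euclid_dvdzX // => aq.
  by case/negP: nas; rewrite eqs dvdz_add // dvdz_mull.
have [m [om eqm eqap eqaq]] := IH1 p q eqpq nap.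
have [e1 e1_2 ep] := eq_norm_sign eqap; have [e3 e3_2 eq_] := eq_norm_sign eqaq.
have [e4 | e4] : e1 * e3 * e = -1 \/ e1 * e3 * e = 1.
  have : (e1 * e3 * e) ^+ 2 = 1 by rewrite !exprMn e1_2 e3_2 e2 !mulr1.
  by move/eqP; rewrite sqrf_eq1 => /orP[]/eqP->; [right|left].
- have ee3 : e3 * e = - e1.
    have -> : e3 * e = e1 ^+ 2 * (e3 * e) by rewrite e1_2 mul1r.
    have -> : e1 ^+ 2 * (e3 * e) = e1 * (e1 * e3 * e) by ring.
    by rewrite e4 mulrN1.
  have e33 : e3 = - (e1 * e).
    have -> : e3 = e3 * e ^+ 2 by rewrite e2 mulr1.
    by rewrite expr2 mulrA ee3 mulNr.
  exists m.+1; rewrite /= om eqx eqm mulSn; split=> //.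
    rewrite eqs ep eq_; case: (spow w c m) => u v /=.
    have -> : w * (e1 * u) + e * c * (e3 * v) = e1 * (w * u - c * v).
      have -> : e * c * (e3 * v) = (e3 * e) * (c * v) by ring.
      by rewrite ee3; ring.
    by rewrite normrM (sqr1_norm e1_2) mul1r.
  rewrite eqt ep eq_; case: (spow w c m) => u v /=.
  have -> : e3 * v - e * (e1 * u) = - (e1 * e) * (u + v) by rewrite e33; ring.
  by rewrite normrM normrN normrM (sqr1_norm e1_2) (sqr1_norm e2) !mul1r.
have ee3 : e3 * e = e1.
  have -> : e3 * e = e1 ^+ 2 * (e3 * e) by rewrite e1_2 mul1r.
  have -> : e1 ^+ 2 * (e3 * e) = e1 * (e1 * e3 * e) by ring.
  by rewrite e4 mulr1.
have eqs' : s = e1 * (w * (spow w c m).1 + c * (spow w c m).2).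
  by rewrite eqs ep eq_ mulrDr -{3}ee3; congr (_ + _); ring.
case/negP: nas; rewrite eqs' dvdz_mull //.
exact: dvdz_trans dvdaX (spow_odd_conj _ _ om).
Qed.
End QuadraticPowers.

Section QuadraticPowersTheory.
Local Open Scope ring_scope.
Variables w c : int.
Notation s m := (spow w c m).1.
Notation t m := (spow w c m).2.

Lemma spowSS_odd n : odd n ->
  s n.+2 = (w - c) * s n - 2 * c * t n /\ t n.+2 = (w - c) * t n + 2 * w * s n.
Proof.
by move=> on /=; case: (spow w c n) => u v; rewrite on /=; split; ring.
Qed.

Lemma spowSS_even n : ~~ odd n ->
  s n.+2 = (w - c) * s n - 2 * w * c * t n /\ t n.+2 = (w - c) * t n + 2 * s n.
Proof.
by move=> /negPf en /=; case: (spow w c n) => u v; rewrite en /=; split; ring.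
Qed.

Lemma odd_ind2 (P : nat -> Prop) : P 1%N -> (forall n, odd n -> P n -> P n.+2) ->
  forall n, odd n -> P n.
Proof.
move=> P1 PS n on; rewrite -(odd_double_half n) on add1n.
by elim: (n./2) => // i IHi; rewrite doubleS; apply: PS => //=; rewrite odd_double.
Qed.

Lemma spow_add_even_odd m n : ~~ odd m -> odd n ->
  s (m + n) = s m * s n - c * t m * t n /\ t (m + n) = s m * t n + w * t m * s n.
Proof.
move=> em; elim/odd_ind2: n / => [|n on [IHs IHt]].
  by rewrite addn1 /=; case: (spow w c m) => u v; rewrite (negPf em) /=; split; ring.
have omn : odd (m + n) by rewrite oddD on (negPf em).
have [-> ->] := spowSS_odd on; rewrite !addnS.
by have [-> ->] := spowSS_odd omn; rewrite IHs IHt; split; ring.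
Qed.

Lemma spow_add_odd_odd m n : odd m -> odd n ->
  s (m + n) = w * s m * s n - c * t m * t n /\ t (m + n) = s m * t n + t m * s n.
Proof.
move=> om; elim/odd_ind2: n / => [|n on [IHs IHt]].
  by rewrite addn1 /=; case: (spow w c m) => u v; rewrite om /=; split; ring.
have emn : ~~ odd (m + n) by rewrite oddD on om.
have [-> ->] := spowSS_odd on; rewrite !addnS.
by have [-> ->] := spowSS_even emn; rewrite IHs IHt; split; ring.
Qed.

Lemma spow_norm n : odd n -> w * s n ^+ 2 + c * t n ^+ 2 = (w + c) ^+ n.
Proof.
elim/odd_ind2: n / => [|n on IHn]; first by rewrite /=; ring.
have [-> ->] := spowSS_odd on.
have -> : (w + c) ^+ n.+2 = (w + c) ^+ 2 * (w + c) ^+ n by rewrite -exprD.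
by rewrite -IHn; ring.
Qed.

Lemma spow_dvd q j : odd q -> odd j -> (s q %| s (q * j))%Z /\ (t q %| t (q * j))%Z.
Proof.
move=> oq; elim/odd_ind2: j / => [|j oj [IHs IHt]]; first by rewrite muln1 !dvdzz.
have -> : (q * j.+2 = (q + q) + q * j)%N by lia.
have e2q : ~~ odd (q + q) by rewrite oddD oq.
have oqj : odd (q * j) by rewrite oddM oq.
have [-> ->] := spow_add_even_odd e2q oqj.
have [-> ->] := spow_add_odd_odd oq oq; split.
  apply: dvdz_sub; first by rewrite dvdz_mull.
  have -> : c * (s q * t q + t q * s q) * t (q * j) = s q * (2 * c * t q * t (q * j)) by ring.
  by rewrite dvdz_mulr.
apply: dvdz_add; first by rewrite dvdz_mull.
have -> : w * (s q * t q + t q * s q) * s (q * j) = t q * (2 * w * s q * s (q * j)) by ring.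
by rewrite dvdz_mulr.
Qed.

Lemma spow_mod_w i :
  (w %| s i.*2.+1 - i.*2.+1%:R * (- c) ^+ i)%Z /\ (w %| t i.*2.+1 - (- c) ^+ i)%Z.
Proof.
elim: i => [|i [/dvdzP[x eqx] /dvdzP[y eqy]]]; first by rewrite /= !(mulr0, addr0, subr0, expr0, mulr1, subrr) dvdz0.
have oi : odd i.*2.+1 by rewrite /= odd_double.
rewrite doubleS; have [-> ->] := spowSS_odd oi.
have {eqx} -> : s i.*2.+1 = x * w + i.*2.+1%:R * (- c) ^+ i by rewrite -eqx subrK.
have {eqy} -> : t i.*2.+1 = y * w + (- c) ^+ i by rewrite -eqy subrK.
rewrite exprS; move: ((- c) ^+ i) => C; split; apply/dvdzP.
  exists ((w - c) * x + i.*2.+1%:R * C - 2 * c * y).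
  by rewrite -[i.*2.+3]addn2 natrD; move: (i.*2.+1%:R); move=> k; ring.
exists ((w - c) * y + C + 2 * (x * w + i.*2.+1%:R * C)).
by move: (i.*2.+1%:R); move=> k; ring.
Qed.

(** The first two terms of the binomial expansion, with ['C(n, 3) = i (4 i ^ 2 - 1) / 3] and
    ['C(n, 2) = i n]. The factors [3 c] and [c] clear the denominator and the exponent [i - 1] of
    [- c]. *)
Lemma spow_mod_w2 i : let n : int := i.*2.+1%:R in
  (w ^+ 2 %| 3 * c * s i.*2.+1 - (- c) ^+ i * (3 * n * c - i%:R * (4 * i%:R ^+ 2 - 1) * w))%Z /\
  (w ^+ 2 %| c * t i.*2.+1 - (- c) ^+ i * (c - i%:R * n * w))%Z.
Proof.
elim: i => [|i [/dvdzP[x eqx] /dvdzP[y eqy]]] n.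
  by rewrite /n /= !(mulr0, mul0r, addr0, subr0, expr0, mulr1, mul1r, subrr) dvdz0.
have oi : odd i.*2.+1 by rewrite /= odd_double.
rewrite /n doubleS; have [-> ->] := spowSS_odd oi.
have e1 : 3 * c * s i.*2.+1 = x * w ^+ 2 + (- c) ^+ i *
  (3 * i.*2.+1%:R * c - i%:R * (4 * i%:R ^+ 2 - 1) * w) by rewrite -eqx subrK.
have e2 : c * t i.*2.+1 = y * w ^+ 2 + (- c) ^+ i * (c - i%:R * i.*2.+1%:R * w) by rewrite -eqy subrK.
have -> : 3 * c * ((w - c) * s i.*2.+1 - 2 * c * t i.*2.+1) =
  (w - c) * (3 * c * s i.*2.+1) - 6 * c * (c * t i.*2.+1) by ring.
have -> : c * ((w - c) * t i.*2.+1 + 2 * w * s i.*2.+1) =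
  (w - c) * (c * t i.*2.+1) + 2 * w * (c * s i.*2.+1) by ring.
have [/dvdzP[z eqz] _] := spow_mod_w i.
have e3 : s i.*2.+1 = z * w + i.*2.+1%:R * (- c) ^+ i by rewrite -eqz subrK.
rewrite e1 e2 e3 [(- c) ^+ i.+1]exprS.
have ei : i.*2.+1%:R = 2 * i%:R + 1 :> int by rewrite -natr1 -mul2n natrM.
have eS : i.*2.+3%:R = 2 * i%:R + 3 :> int by rewrite -[i.*2.+3]addn3 natrD -mul2n natrM.
rewrite ei eS -[i.+1%:R]natr1; move: (i%:R) ((- c) ^+ i) => k C.
split; apply/dvdzP.
  exists ((w - c) * x - 6 * c * y - C * k * (4 * k ^+ 2 - 1)); ring.
exists ((w - c) * y - C * k * (2 * k + 1) + 2 * c * z); ring.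
Qed.
End QuadraticPowersTheory.

Lemma expn_gt_sqr X q : 7 <= X -> 3 <= q -> q ^ 2 < X ^ q.-1.
Proof.
move=> leX leq3; apply: leq_trans (_ : 7 ^ q.-1 <= _); last first.
  by case: q leq3 => // -[|q] // _; rewrite leq_exp2r.
rewrite -(subnKC leq3) /=; elim: (q - 3) => // n IHn.
rewrite addnS expnS; apply: leq_trans (_ : 7 * (3 + n) ^ 2 < _); last by rewrite ltn_pmul2l.
by rewrite ltnS; clear; nia.
Qed.

Lemma PoszX (m n : nat) : Posz (m ^ n) = (Posz m ^+ n)%R.
Proof. by rewrite -!natz natrX. Qed.

Section SameParity.
Variables (a x1 b y c w : nat).
Hypotheses (pa : prime a) (a_ge : 7 <= a) (x1_gt0 : 0 < x1) (nab : ~~ (a %| b)).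
Hypotheses (b_gt1 : 1 < b) (y_gt0 : 0 < y) (c_gt1 : 1 < c) (cop : coprime b c).
Hypotheses (defw : w = b ^ y) (eq1 : a ^ x1 = w + c).
Notation S m := (spow w%:Z c%:Z m).1.
Notation T m := (spow w%:Z c%:Z m).2.

Let ge7 : 7 <= w + c.
Proof. by rewrite -eq1 (leq_trans a_ge) // -{1}[a]expn1 leq_exp2l ?prime_gt1. Qed.

Let w_gt1 : 1 < w.
Proof. by rewrite defw (leq_trans b_gt1) // -{1}[b]expn1 leq_exp2l. Qed.

Let prime_ndvd_c p i : prime p -> p %| b -> ~~ (p%:Z %| ((- c%:Z) ^+ i)%R)%Z.
Proof.
move=> pp pb; rewrite dvdzE abszX abszN !absz_nat Euclid_dvdX // negb_and.
apply/orP; left; apply: contraL cop => pc.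
by rewrite /coprime gtn_eqF // (leq_trans (prime_gt1 pp)) // dvdn_leq ?gcdn_gt0 ?(ltnW b_gt1) // dvdn_gcd pb.
Qed.

Lemma spow_prime_dvd p m : prime p -> p %| b -> odd m -> (p%:Z %| S m)%Z -> p %| m.
Proof.
move=> pp pb om; have em : m = (m./2).*2.+1 by rewrite -{1}(odd_double_half m) om.
rewrite em; move: (m./2) => i {em} pS.
have [dvdw _] := spow_mod_w w%:Z c%:Z i.
have pw : (p%:Z %| w%:Z)%Z by rewrite dvdzE /= defw Euclid_dvdX // pb.
have := dvdz_sub pS (dvdz_trans pw dvdw); rewrite opprB addrC subrK.
by rewrite Euclid_dvdzM // (negPf (prime_ndvd_c _ pp pb)) orbF natz dvdzE.
Qed.

(** Every prime factor of [S q] divides [b], hence the index [q], so [S q] is a power of [q] up to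
    sign. In the expansion modulo [w ^ 2] only [3 c q] survives modulo [q ^ 2], because [q] divides
    both [w] and [4 i ^ 2 - 1 = (2 i + 1) (2 i - 1)]; for [q >= 5] it is not divisible by
    [q ^ 2]. *)
Lemma spow_prime_norm q : prime q -> 5 <= q -> q %| b -> (forall p, prime p -> (p%:Z %| S q)%Z -> p %| b) ->
  S q != 0%R -> (`|S q| <= q)%N.
Proof.
move=> pq q_ge qb primes_b S_neq0.
have oq : odd q by apply: contraLR q_ge => /prime_oddPn-/(_ pq) ->.
have pnatS : q.-nat `|S q|%N.
  apply/pnatP; first by rewrite absz_gt0.
  move=> p pp pS; have pb := primes_b p pp pS.
  by have := spow_prime_dvd pp pb oq pS; rewrite dvdn_prime2 // => /eqP ->; rewrite inE.
have [k eqk] := p_natP pnatS; case: k eqk => [|[|k]] eqk; rewrite eqk ?leqnn ?expn1 //.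
  by rewrite (leq_trans _ q_ge).
have q2S : ((q%:Z ^+ 2)%R %| S q)%Z by rewrite dvdzE abszX absz_nat eqk -[k.+2]addn2 expnD dvdn_mull.
have eq_ : q = (q./2).*2.+1 by rewrite -{1}(odd_double_half q) oq.
have [dvdw2 _] := spow_mod_w2 w%:Z c%:Z q./2; rewrite -eq_ in dvdw2.
have qw : (q%:Z %| w%:Z)%Z by rewrite dvdzE /= defw Euclid_dvdX // qb.
have [v eqw] := dvdzP qw.
have q2w2 : ((q%:Z ^+ 2)%R %| (w%:Z ^+ 2)%R)%Z by rewrite eqw exprMn dvdz_mull.
have := dvdz_sub (dvdz_mull (3 * c%:Z)%R q2S) (dvdz_trans q2w2 dvdw2).
rewrite opprB addrC subrK => dvdq2.
have ei : (4 * (q./2)%:R ^+ 2 - 1 = q%:R * (2 * (q./2)%:R - 1) :> int)%R.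
  have -> : (q%:R = 2 * (q./2)%:R + 1 :> int)%R by rewrite {1}eq_ -natr1 -mul2n natrM.
  by ring.
have qZ : (q%:R = q%:Z)%R by rewrite natz.
have : ((q%:Z ^+ 2)%R %| ((- c%:Z) ^+ q./2 * (3 * c%:Z * q%:Z))%R)%Z.
  have -> : ((- c%:Z) ^+ q./2 * (3 * c%:Z * q%:Z) =
    (- c%:Z) ^+ q./2 * (3 * q%:R * c%:Z - (q./2)%:R * (4 * (q./2)%:R ^+ 2 - 1) * w%:Z) +
    q%:Z ^+ 2 * ((- c%:Z) ^+ q./2 * (q./2)%:R * (2 * (q./2)%:R - 1) * v))%R.
    by rewrite ei eqw qZ; ring.
  by apply: dvdz_add dvdq2 _; rewrite dvdz_mulr.
rewrite mulrA expr2 dvdz_mul2r; last by rewrite eqz_nat -lt0n prime_gt0.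
rewrite !Euclid_dvdzM // (negPf (prime_ndvd_c _ pq qb)) /=.
have := prime_ndvd_c 1 pq qb; rewrite expr1 rpredN => /negPf ->; rewrite orbF.
by rewrite dvdzE /= dvdn_prime2 // => /eqP q3; rewrite q3 in q_ge.
Qed.

(** Here [d] is half of the difference of the exponents. A prime [q] dividing [b] divides the index
    [m], so [S q] divides [b ^ d] and [T q] is a unit. For [q >= 5] the norm
    [w S ^ 2 + c T ^ 2 = (w + c) ^ q] is too large for a coefficient [S q] of size at most [q]; so
    [b] is a power of 3. *)
Lemma same_parity_gt1 d x2 : 0 < d -> a ^ x2 = b ^ (y + 2 * d) + c -> [/\ b = 3, y = 1 & c = 10].
Proof.
move=> d_gt0 eq2.
have naw : ~~ (a%:Z %| w%:Z)%Z by rewrite dvdzE /= defw Euclid_dvdX // negb_and nab.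
have eqX : (w%:Z + c%:Z = a%:Z ^+ x1)%R by rewrite -PoszD -eq1 PoszX.
have a_gt2 : 2 < a by rewrite (leq_trans _ a_ge).
have w1 : (1 < w%:Z)%R by rewrite ltz_nat.
have c1 : (1 < c%:Z)%R by rewrite ltz_nat.
have [+ _] := spow_descent pa a_gt2 x1_gt0 w1 c1 eqX naw x2.
move=> /(_ (Posz (b ^ d)) 1%R) [||m [om eqm eqU eqT]].
- by rewrite expr1n mulr1 -!PoszX -PoszM -PoszD eq2 defw -expnM -expnD [d * 2]mulnC.
- by rewrite dvdzE /= Euclid_dvdX // negb_and nab.
have {}eqU : (b ^ d)%N = `|S m|%N by apply/eqP; rewrite -eqz_nat abszE -eqU.
have {}eqT : `|T m|%N = 1%N by apply/eqP; rewrite -eqz_nat abszE -eqT.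
have key q : prime q -> q %| b -> [/\ odd q, (`|S q| %| b ^ d)%N & `|T q|%N = 1%N].
  move=> pq qb; have qS : (q%:Z %| S m)%Z.
    by rewrite dvdzE -eqU Euclid_dvdX // qb.
  have /dvdnP[j eqj] := spow_prime_dvd pq qb om qS.
  have /andP[oj oq] : odd j && odd q by rewrite -oddM -eqj.
  have [] := spow_dvd w%:Z c%:Z oq oj; rewrite mulnC -eqj !dvdzE eqT dvdn1 eqU => dS /eqP.
  by split.
have three q : prime q -> q %| b -> q = 3.
  move=> pq qb; have [oq dvdS T1] := key q pq qb.
  apply/eqP; rewrite eqn_leq; apply/andP; split; last first.
    by apply: contraLR oq; rewrite -leqNgt leq_eqVlt => /orP[/eqP->//|]; rewrite ltnS leqNgt prime_gt1.
  rewrite leqNgt; apply/negP => q_gt3.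
  have q_ge5 : 5 <= q by apply: contraLR oq; rewrite -ltnNge ltnS leq_eqVlt => /orP[/eqP->//|]; rewrite ltnNge q_gt3.
  have S_neq0 : S q != 0%R.
    by apply: contraTneq dvdS => ->; rewrite absz0 dvd0n expn_eq0 negb_and -lt0n (ltnW b_gt1).
  have primes_b p : prime p -> (p%:Z %| S q)%Z -> p %| b.
    by move=> pp; rewrite dvdzE => /dvdn_trans/(_ dvdS); rewrite Euclid_dvdX // => /andP[].
  have leS := spow_prime_norm pq q_ge5 qb primes_b S_neq0.
  have := spow_norm w%:Z c%:Z oq => normq.
  have {}normq : w * `|S q| ^ 2 + c = (w + c) ^ q.
    apply/eqP; rewrite -eqz_nat PoszD PoszM !PoszX PoszD -normq.
    have T2 : (T q ^+ 2 = 1)%R by rewrite -(ger0_norm (sqr_ge0 (T q))) normrX -abszE T1 expr1n.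
    by rewrite abszE -normrX ger0_norm ?sqr_ge0 // T2 mulr1.
  have : (w + c) ^ q <= (w + c) * q ^ 2.
    rewrite -normq mulnDl leq_add //; first by rewrite leq_mul2l leq_exp2r // leS orbT.
    by rewrite leq_pmulr // expn_gt0 prime_gt0.
  rewrite leqNgt; case/negP; rewrite -{2}(prednK (prime_gt0 pq)) [_ ^ _.-1.+1]expnS ltn_pmul2l.
    by rewrite expn_gt_sqr // ltnW // ltnW.
  by rewrite (leq_trans _ ge7).
have /p_natP[f eqf] : 3.-nat b.
  apply/pnatP; first exact: ltnW.
  by move=> p pp /(three p pp) ->.
have f_gt0 : 0 < f by case: (f) eqf b_gt1 => // ->.
have b3 : 3 %| b by rewrite eqf -(prednK f_gt0) expnS dvdn_mulr.
have [_ dvdS T1] := key 3 isT b3.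
(* [c = 3 w + 1] or [3 w - 1], so [S 3] is [- 8 w - 3] or [- 8 w + 3]. If 9 divides [w], then 3
   divides it exactly once and it is too large to be a power of 3 up to sign; [w = 3] leaves -27,
   with [c = 10], and -21. *)
have [eS eT] : S 3 = (w%:Z - 3 * c%:Z)%R /\ T 3 = (3 * w%:Z - c%:Z)%R.
  by rewrite /=; split; ring.
have [h leh eqh] : exists2 h, h <= f * d & `|S 3|%N = 3 ^ h.
  by move: dvdS; rewrite eqf -expnM => /dvdn_pfactor-/(_ isT) [h leh ->]; exists h.
move: T1 eqh; rewrite eS eT => T1 eqh.
have ew : w = 3 ^ (f * y) by rewrite defw eqf expnM.
have : 0 < f * y by rewrite muln_gt0 f_gt0.
case: (f * y) ew => [//|[|k]] ew _.
  rewrite expn1 in ew.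
  have b_eq3 : b = 3.
    move: ew; rewrite defw => ew; have := b3; rewrite -(prednK y_gt0) expnS in ew => b3'.
    by have := @leq_pmulr b (b ^ y.-1); rewrite ew expn_gt0 ltnW // => /(_ isT); move: (dvdn_leq (ltnW b_gt1) b3); lia.
  have y1 : y = 1.
    by move: ew; rewrite defw b_eq3 => /eqP; rewrite -{2}[3]expn1 eqn_exp2l // => /eqP.
  split=> //; have : c = 8 \/ c = 10 by move: T1; rewrite ew; clear; lia.
  case=> // c8; move: eqh; rewrite ew c8 /=.
  case: (h) => [|[|[|h']]] //.
  by rewrite !expnS; move: (3 ^ h') => z; clear; lia.
exfalso; move: T1 eqh; rewrite (_ : Posz w = (9 * Posz (3 ^ k))%R); last first.
  by rewrite ew -[k.+2]add2n expnD PoszM.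
have : 0 < 3 ^ k by rewrite expn_gt0.
case: h leh => [|[|h]] _; rewrite ?expnS.
- by move: (3 ^ k) => z; clear; lia.
- by move: (3 ^ k) => z; clear; lia.
by move: (3 ^ k) (3 ^ h) => z z'; clear; lia.
Qed.
End SameParity.

(** * The case [c = 1] *)

Lemma exp1_expand (w i : nat) : exists z, (w + 1) ^ i = 1 + i * w + w ^ 2 * z.
Proof.
elim: i => [|i [z eqz]]; first by exists 0; rewrite expn0; lia.
by exists (i + z * (w + 1)); rewrite expnS eqz; ring.
Qed.

Lemma geometric_expand (w q : nat) :
  exists z, \sum_(i < q) (w + 1) ^ i = q + w * (\sum_(i < q) i) + w ^ 2 * z.
Proof.
elim: q => [|q [z eqz]]; first by exists 0; rewrite !big_ord0; lia.
have [z' eqz'] := exp1_expand w q.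
by exists (z + z'); rewrite !big_ord_recr /= eqz eqz'; ring.
Qed.

Lemma predX_geometric (w q : nat) : (w + 1) ^ q = w * (\sum_(i < q) (w + 1) ^ i) + 1.
Proof.
have := predn_exp (w + 1) q; rewrite addn1 /= => <-; rewrite addn1 prednK //.
by rewrite expn_gt0.
Qed.

(** Comparing modulo [w = b ^ y1] gives [x2 = x1 * m], so [b ^ y2 = (w + 1) ^ m - 1]. A prime [q]
    dividing [b] divides [m], hence the sum of [(w + 1) ^ i] over [i < q] divides [b ^ y2]. Modulo
    [w] this sum is [q], so [q] is its only prime factor; for odd [q] it is [q] modulo [q ^ 2],
    hence equal to [q], which is too small. *)
Lemma pow_minus_one_unique (a b x1 x2 y1 y2 : nat) : 7 <= a -> 0 < x1 -> 1 < b -> 0 < y1 ->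
  y1 < y2 -> a ^ x1 = b ^ y1 + 1 -> a ^ x2 = b ^ y2 + 1 -> False.
Proof.
move=> a_ge x1_gt0 b_gt1 y1_gt0 lty eq1 eq2.
have b_gt0 := ltnW b_gt1; have a_gt1 : 1 < a by rewrite (leq_trans _ a_ge).
have [w ew] : {w | w = b ^ y1} by exists (b ^ y1).
have w_gt0 : 0 < w by rewrite ew expn_gt0 b_gt0.
rewrite -ew in eq1.
have w_ge : 6 <= w.
  have : 7 <= a ^ x1 by rewrite (leq_trans a_ge) // -{1}[a]expn1 leq_exp2l.
  by rewrite eq1 addn1.
have dvdw : w %| b ^ y2 by rewrite ew dvdn_exp2l // ltnW.
have dvdx : x1 %| x2.
  have : a ^ (x2 %% x1) = 1 %[mod w].
    have : a ^ x2 = 1 %[mod w] by rewrite eq2 -modnDml (eqP dvdw).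
    rewrite {1}(divn_eq x2 x1) expnD [_ * x1]mulnC expnM eq1 -modnMml -modnXm modnDl.
    by rewrite modnXm exp1n modnMml mul1n.
  have ltr : a ^ (x2 %% x1) < w + 1 by rewrite -eq1 ltn_exp2l // ltn_mod.
  move/eqP; rewrite eqn_mod_dvd ?expn_gt0 ?(ltnW a_gt1) // => dvdr.
  have : a ^ (x2 %% x1) - 1 = 0.
    apply/eqP; apply: contraTT dvdr; rewrite -lt0n => gt0; rewrite gtnNdvd //.
    by move: ltr gt0; clear; lia.
  move/eqP; rewrite subn_eq0 => le1; rewrite /dvdn -leqn0 leqNgt; apply: contraL le1 => r_gt0.
  by rewrite -ltnNge -(expn0 a) ltn_exp2l.
have [m em] : {m | x2 = x1 * m} by exists (x2 %/ x1); rewrite mulnC divnK.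
have eqm : b ^ y2 = w * \sum_(i < m) (w + 1) ^ i.
  by apply: (@addIn 1); rewrite -predX_geometric -eq1 -expnM -em eq2.
have prime_m p : prime p -> p %| b -> p %| m.
  move=> pp pb; have pw : p %| w by rewrite ew Euclid_dvdX // pb.
  have : p %| \sum_(i < m) (w + 1) ^ i.
    suff -> : \sum_(i < m) (w + 1) ^ i = b ^ (y2 - y1) by rewrite Euclid_dvdX // pb subn_gt0.
    apply/eqP; rewrite -(eqn_pmul2l w_gt0) -eqm ew -expnD subnKC //; exact: ltnW.
  have [z ->] := geometric_expand w m.
  by rewrite -addnA dvdn_addl // dvdn_add // ?dvdn_mulr // expnS expn1 -mulnA dvdn_mulr.
have dvd_b q : q %| m -> \sum_(i < q) (w + 1) ^ i %| b ^ y2.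
  case/dvdnP=> k ek.
  have gt0 : 0 < (w + 1) ^ q by rewrite expn_gt0 addn1.
  have -> : b ^ y2 = ((w + 1) ^ q - 1) * \sum_(i < k) ((w + 1) ^ q - 1 + 1) ^ i.
    apply: (@addIn 1); rewrite -predX_geometric subnK // -expnM mulnC -ek -eq1.
    by rewrite -expnM -em eq2.
  by rewrite predX_geometric addnK dvdn_mulr // dvdn_mull.
have [/existsP[i /andP[]]|] := boolP [exists q : 'I_b.+1, [&& prime q, q %| b & odd q]].
  move: (i : nat) => q pq /andP[qb oq].
  have qw : q %| w by rewrite ew Euclid_dvdX // qb.
  have dvdN := dvd_b q (prime_m q pq qb).
  have [z eqz] := geometric_expand w q.
  have qsum : q %| \sum_(i < q) i.
    by rewrite -(@Gauss_dvdl _ _ 2) ?sum_ord_double ?dvdn_mulr // coprimen2.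
  have q2 : exists k, \sum_(i < q) (w + 1) ^ i = q + q ^ 2 * k.
    case/dvdnP: qw => v ev; case/dvdnP: qsum => k ek; exists (v * k + v ^ 2 * z).
    by rewrite eqz ev ek; ring.
  case: q2 => k ek.
  have k_gt0 : 0 < k.
    rewrite lt0n; apply/eqP => k0; move: ek; rewrite k0 muln0 addn0.
    have := prime_gt1 pq; case: (q) => [|[|n]] // _; rewrite big_ord_recr /= => e.
    have : n.+1 <= \sum_(i < n.+1) (w + 1) ^ i.
      rewrite -{1}[n.+1]card_ord -sum1_card; apply: leq_sum => j _.
      by rewrite expn_gt0 addn1.
    have : w + 1 <= (w + 1) ^ n.+1 by rewrite -{1}[w + 1]expn1 leq_exp2l // addn1.
    by move: e w_ge; move: (\sum_(_ < _) _) (_ ^ _) => x y; clear; lia.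
  have : q.-nat (\sum_(i < q) (w + 1) ^ i).
    apply/pnatP; first by rewrite ek addn_gt0 prime_gt0.
    move=> p pp pN; have pb : p %| b.
      by have := dvdn_trans pN dvdN; rewrite Euclid_dvdX // => /andP[].
    have pw : p %| w by rewrite ew Euclid_dvdX // pb.
    move: pN; rewrite eqz -addnA dvdn_addl // ?dvdn_add // ?dvdn_mulr // ?expnS -?mulnA ?dvdn_mulr //.
    by rewrite dvdn_prime2 // => /eqP ->; rewrite inE.
  case/p_natP=> h eqh; move: ek; rewrite eqh.
  case: h {eqh} => [|[|h]]; rewrite ?expn0 ?expn1.
  - by move: (prime_gt1 pq); move: (q ^ 2 * k) => n; clear; lia.
  - have : 0 < q ^ 2 * k by rewrite muln_gt0 expn_gt0 prime_gt0.
    by move: (q ^ 2 * k) => n; clear; lia.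
  move=> e; have : q ^ 2 %| q + q ^ 2 * k by rewrite -e -[h.+2]addn2 expnD dvdn_mull.
  rewrite (dvdn_addl q (dvdn_mulr k (dvdnn (q ^ 2)))).
  by move=> /(dvdn_leq (prime_gt0 pq)); rewrite leqNgt -{1}[q]expn1 ltn_exp2l // prime_gt1.
rewrite negb_exists => /forallP noodd.
have two p : prime p -> p %| b -> p = 2.
  move=> pp pb; have ltp : p < b.+1 by rewrite ltnS dvdn_leq.
  have := noodd (Ordinal ltp); rewrite /= pp pb /= => /negbTE ep.
  by case: (even_prime pp) => // op; rewrite op in ep.
have /p_natP[f ef] : 2.-nat b by apply/pnatP => // p pp /(two p pp) ->.
have b2 : 2 %| b.
  by case: f ef b_gt1 => [->//|f] -> _; rewrite expnS dvdn_mulr.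
(* For [q = 2] the sum is [w + 2], and two powers of 2 that differ by 2 contradict [w >= 6]. *)
have := dvd_b 2 (prime_m 2 isT b2); rewrite !big_ord_recr big_ord0 /= add0n expn1.
rewrite ef -expnM => /dvdn_pfactor-/(_ isT)[h _ eqh].
move: ew; rewrite ef -expnM => ew'; move: eqh w_ge; rewrite ew'.
case: (f * y1) => [|[|[|k]]] //; rewrite !expnS; move: (2 ^ k) => z.
case: h => [|[|[|h]]]; rewrite ?expnS; [clear; lia | clear; lia | clear; lia |].
by move: (2 ^ h) => z'; clear; lia.
Qed.

(** * Differences of odd length: the reduced equation *)

Lemma mul2_bin2 n : 2 * 'C(n, 2) = n * (n - 1).
Proof. by rewrite mulnC subn1 -[2]/(2`!) bin_ffact ffactnS ffactn1. Qed.

Lemma leq_exp_add3 a v : 5 <= a -> 0 < v -> v + 3 <= a ^ v.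
Proof.
move=> a_ge; case: v => // v _; elim: v => [|v IHv]; first by rewrite expn1 (leq_trans _ a_ge).
by rewrite expnS; apply: leq_trans (leq_mul a_ge IHv); clear; lia.
Qed.

(** As [j * 'C(nu, j) = nu * 'C(nu - 1, j - 1)], the binomial loses at most [v = logn a j] of the
    [e] factors [a]. The power [w ^ j] makes them up because [v + i <= j]; for [v > 0] this is
    [v + 3 <= a ^ v <= j]. *)
Lemma bin_pow_dvd (a e t nu w i j : nat) : prime a -> 5 <= a -> 0 < t ->
  a ^ e %| nu -> a ^ t %| w -> 0 < i <= 3 -> i <= j ->
  a ^ e * (a ^ t) ^ i %| 'C(nu, j) * w ^ j.
Proof.
move=> pa a_ge t_gt0 dvdnu dvdw /andP[i_gt0 le3] leij.
have j_gt0 : 0 < j by apply: leq_trans leij.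
pose v := logn a j.
have lev : v + i <= j.
  have := posnP v; case=> [->|v_gt0]; first by rewrite add0n.
  apply: leq_trans (leq_add (leqnn v) le3) _; apply: leq_trans (leq_exp_add3 a_ge v_gt0) _.
  exact: dvdn_leq j_gt0 (pfactor_dvdnn a j).
have dvdC : a ^ e %| a ^ v * 'C(nu, j).
  have : a ^ e %| j * 'C(nu, j).
    rewrite -(prednK j_gt0) -mul_bin_diag; case: (nu) dvdnu => [|m] dvdnu; first by rewrite mul0n dvdn0.
    by rewrite dvdn_mulr.
  rewrite -{1}(partnC a j_gt0) p_part mulnAC -/v Gauss_dvdl // coprimeXl //.
  by rewrite prime_coprime // -p'natE // part_pnat.
case/dvdnP: dvdw => w' ->; rewrite expnMn -[(a ^ t) ^ j]expnM.
have -> : t * j = v + t * i + (t * j - v - t * i).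
  have : v + t * i <= t * j; last by clear; lia.
  by apply: leq_trans (_ : t * (v + i) <= _); [rewrite mulnDr leq_add2r leq_pmull | rewrite leq_mul2l lev orbT].
rewrite 2!expnD [a ^ (t * i)]expnM.
have -> : forall A B C D E : nat, A * (B * (C * D * E)) = (C * A) * D * (B * E) by move=> *; ring.
by apply: dvdn_mulr; apply: dvdn_mul.
Qed.

Lemma binomial_expand (a e t nu w i : nat) : prime a -> 5 <= a -> 0 < t ->
  a ^ e %| nu -> a ^ t %| w -> 0 < i <= 3 ->
  exists M, (w + 1) ^ nu = \sum_(j < i) 'C(nu, j) * w ^ j + a ^ e * (a ^ t) ^ i * M.
Proof.
move=> pa a_ge t_gt0 dvdnu dvdw i_bd.
have -> : (w + 1) ^ nu = \sum_(j < i + nu.+1) 'C(nu, j) * w ^ j.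
  rewrite addnC (addnC i) expnDn.
  rewrite (big_ord_widen (nu.+1 + i) (fun j => 'C(nu, j) * (1 ^ (nu - j) * w ^ j))) ?leq_addr //.
  rewrite big_mkcond; apply: eq_bigr => j _; rewrite exp1n mul1n ltnS.
  by case: leqP => // ltj; rewrite bin_small.
rewrite big_split_ord /=; have : a ^ e * (a ^ t) ^ i %| \sum_(j < nu.+1) 'C(nu, i + j) * w ^ (i + j).
  by apply: dvdn_sum => j _; apply: bin_pow_dvd => //; rewrite leq_addr.
by case/dvdnP=> M ->; exists M; rewrite [M * _]mulnC.
Qed.

Section Reduced.
Variables (a b y n nu e t kap del x1 x2 : nat).
Hypotheses (pa : prime a) (a_ge : 7 <= a) (t_gt0 : 0 < t) (b_gt1 : 1 < b) (y_gt0 : 0 < y).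
Hypotheses (nab : ~~ (a %| b)) (eqb : b ^ n = kap * a ^ t + 1) (nakap : ~~ (a %| kap)).
Hypotheses (eqnu : nu = a ^ e * del) (nadel : ~~ (a %| del)).
Hypotheses (ltx : x1 < x2) (ltby : b ^ y < a ^ x1).
Hypothesis eqn : b ^ y * (b ^ n) ^ nu + a ^ x1 = a ^ x2 + b ^ y.

Let a_gt0 : 0 < a. Proof. exact: prime_gt0. Qed.
Let a_gt1 : 1 < a. Proof. exact: prime_gt1. Qed.
Let a_ge5 : 5 <= a. Proof. exact: leq_trans a_ge. Qed.
Let dvdnu : a ^ e %| nu. Proof. by rewrite eqnu dvdn_mulr. Qed.
Let dvdw : a ^ t %| kap * a ^ t. Proof. exact: dvdn_mull. Qed.

Lemma reduced_expand2 : exists M, (b ^ n) ^ nu = a ^ (t + e) * (del * kap + a ^ t * M) + 1.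
Proof.
have [M] := binomial_expand pa a_ge5 t_gt0 dvdnu dvdw (isT : 0 < 2 <= 3).
rewrite -eqb big_ord_recr big_ord_recr big_ord0 /= bin0 bin1 expn0 expn1 => ->.
by exists M; rewrite eqnu expnD; ring.
Qed.

Lemma reduced_eq_exponent : x1 = t + e.
Proof.
have [M eqM] := reduced_expand2; move: eqn; rewrite eqM.
set N := del * kap + _ => eqN.
have {}eqN : b ^ y * N * a ^ (t + e) + a ^ x1 = a ^ x2.
  by apply: (@addIn (b ^ y)); rewrite -eqN; ring.
have naN : ~~ (a %| b ^ y * N).
  rewrite Euclid_dvdM // Euclid_dvdX // (negPf nab) /= /N dvdn_addl; last first.
    by rewrite dvdn_mulr // -(prednK t_gt0) expnS dvdn_mulr.
  by rewrite Euclid_dvdM // negb_or nadel.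
have dvd2 : a ^ x1.+1 %| a ^ x2 by rewrite dvdn_exp2l.
have [lt1|lt1|//] := ltngtP x1 (t + e).
- have : a ^ x1.+1 %| a ^ x1.
    by rewrite -(dvdn_addr _ (_ : _ %| b ^ y * N * a ^ (t + e))) ?eqN // dvdn_mull // dvdn_exp2l.
  by rewrite dvdn_Pexp2l // ltnn.
- have : a ^ (t + e).+1 %| b ^ y * N * a ^ (t + e).
    rewrite -(dvdn_addl _ (_ : _ %| a ^ x1)) ?dvdn_exp2l // eqN.
    by rewrite dvdn_exp2l // (leq_trans lt1) // ltnW.
  by rewrite expnS dvdn_pmul2r ?expn_gt0 ?a_gt0 // (negPf naN).
Qed.

Lemma reduced_quotient : exists M, b ^ y * (del * kap + a ^ t * M) + 1 = a ^ (x2 - x1).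
Proof.
have [M eqM] := reduced_expand2; exists M.
have X_gt0 : 0 < a ^ x1 by rewrite expn_gt0 a_gt0.
apply/eqP; rewrite -(eqn_pmul2l X_gt0) -expnD subnKC; last exact: ltnW.
by rewrite -(eqn_add2r (b ^ y)) -eqn eqM -reduced_eq_exponent; apply/eqP; ring.
Qed.

Lemma reduced_first_order : t <= x2 - x1 -> a ^ t %| b ^ y * (del * kap) + 1.
Proof.
move=> leD; have [M eqM] := reduced_quotient.
have : a ^ t %| a ^ (x2 - x1) by rewrite dvdn_exp2l.
by rewrite -eqM mulnDr addnAC [_ * (a ^ t * _)]mulnCA dvdn_addl // dvdn_mulr.
Qed.

Lemma reduced_third_power : e + t * 3 <= x2 ->
  a ^ e * (a ^ t) ^ 3 %|
    b ^ y * (nu * (kap * a ^ t) + 'C(nu, 2) * (kap * a ^ t) ^ 2) + a ^ x1.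
Proof.
move=> lex2.
have [M] := binomial_expand pa a_ge5 t_gt0 dvdnu dvdw (isT : 0 < 3 <= 3).
rewrite -eqb !big_ord_recr big_ord0 /= bin0 bin1 expn0 expn1 => eqM.
have : a ^ e * (a ^ t) ^ 3 %| a ^ x2 by rewrite -expnM -expnD dvdn_exp2l.
have -> : a ^ x2 = b ^ y * (nu * (kap * a ^ t) + 'C(nu, 2) * (kap * a ^ t) ^ 2) + a ^ x1 +
    a ^ e * (a ^ t) ^ 3 * (b ^ y * M).
  by apply: (@addIn (b ^ y)); rewrite -eqn eqM; ring.
by rewrite dvdn_addl // dvdn_mulr.
Qed.

(** The third-power congruence, doubled to clear ['C(nu, 2)] and divided by
    [a ^ t * a ^ e = a ^ x1]. *)
Lemma reduced_second_order : 0 < nu -> e + t * 3 <= x2 ->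
  (a ^ t) ^ 2 %| b ^ y * kap * del * (2 + (nu - 1) * (kap * a ^ t)) + 2.
Proof.
move=> nu_gt0 lex2; rewrite -(@dvdn_pmul2l (a ^ t * a ^ e)) ?muln_gt0 ?expn_gt0 ?a_gt0 //.
have := dvdn_mull 2 (reduced_third_power lex2).
rewrite reduced_eq_exponent expnD; congr (_ %| _); first by ring.
transitivity (2 * b ^ y * (nu * (kap * a ^ t)) +
  b ^ y * (2 * 'C(nu, 2)) * (kap * a ^ t) ^ 2 + 2 * (a ^ t * a ^ e)); first by ring.
by rewrite mul2_bin2 [X in b ^ y * (X * _)]eqnu {1}eqnu; ring.
Qed.

Lemma reduced_base_gt : a ^ t < b ^ n.
Proof.
rewrite eqb addn1 ltnS leq_pmull // lt0n; apply: contraNneq nakap => ->; exact: dvdn0.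
Qed.

Lemma reduced_power_lt : (b ^ n) ^ nu < a ^ x2.
Proof.
have by_gt1 : 1 < b ^ y by rewrite -{1}(expn0 b) ltn_exp2l.
have : 0 < (b ^ n) ^ nu by rewrite !expn_gt0 ltnW.
move: eqn ltby by_gt1; move: (b ^ y) ((b ^ n) ^ nu) (a ^ x1) (a ^ x2) => B G X Y; clear; nia.
Qed.

Lemma reduced_exponent_gt : t * nu < x2.
Proof.
rewrite -(@ltn_exp2l a) // expnM; apply: leq_ltn_trans reduced_power_lt.
by case: (nu) => // m; rewrite leq_exp2r // ltnW // reduced_base_gt.
Qed.

(** With [X = a ^ x1], [h2 = b ^ y] and [h1 = b ^ y - a ^ x1], the number [h2 * g ^ nu - h1] is
    exactly [a ^ x2], which exceeds [g ^ nu]; so every [Z ^ N <= g ^ nu] divides it. The bound on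
    [X] comes from [X = Z * a ^ e] and [a ^ e <= nu <= Z ^ u]. *)
Lemma reduced_det_bound u : 0 < u -> det_threshold u <= nu <= (a ^ t) ^ u -> False.
Proof.
move=> u_gt0 /andP[leT leu].
have Z_gt1 : 1 < a ^ t by rewrite -{1}(expn0 a) ltn_exp2l.
have X_gt0 : 0 < a ^ x1 by rewrite expn_gt0 a_gt0.
pose h1 : int := (Posz (b ^ y) - Posz (a ^ x1))%R.
apply: (@no_congruent_power u (a ^ t) (b ^ n) (b ^ y) nu (a ^ x1) h1) => //.
- by rewrite Z_gt1 reduced_base_gt.
- by rewrite eqb addn1 /= dvdn_mull.
- by rewrite expn_gt0 (ltnW b_gt1) ltnW.
- by rewrite subr_eq0 eqz_nat neq_ltn ltby.
- by rewrite /h1 -abszN opprB subzn ?absz_nat ?leq_subr // ltnW.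
- rewrite reduced_eq_exponent expnD expnS leq_mul2l; apply/orP; right.
  by apply: leq_trans leu; rewrite eqnu leq_pmulr // lt0n; apply: contraNneq nadel => ->; rewrite dvdn0.
- by rewrite leT leu.
move=> N leN.
have -> : ((b ^ y)%:R * (b ^ n)%:R ^+ nu - h1 = Posz (a ^ x2))%R.
  rewrite /h1 !natz -PoszX -PoszM; move: eqn; clear; lia.
rewrite natz -PoszX dvdzE /= -expnM dvdn_exp2l // leqNgt; apply/negP => lt2.
have := leq_ltn_trans leN reduced_power_lt; rewrite -expnM ltn_exp2l // ltnNge.
by rewrite ltnW.
Qed.

(** As [b] is 1 modulo [Z = a ^ t], the first-order congruence says that [Z] divides
    [del * kap + 1], and [b < a ^ x1] gives [kap < a ^ e]; hence [Z <= del * kap + 1 <= nu]. *)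
Lemma reduced_order_one : n = 1 -> a ^ t <= nu.
Proof.
move=> n1; have bZ := reduced_base_gt; rewrite n1 expn1 in bZ.
have lebX : b < a ^ x1 by apply: leq_ltn_trans ltby; rewrite -{1}[b]expn1 leq_exp2l.
have e_gt0 : 0 < e.
  have := ltn_trans bZ lebX; rewrite ltn_exp2l // reduced_eq_exponent.
  by rewrite -{1}[t]addn0 ltn_add2l.
have del_gt0 : 0 < del by rewrite lt0n; apply: contraNneq nadel => ->; rewrite dvdn0.
have leD : t <= x2 - x1.
  rewrite leq_subRL ?(ltnW ltx) // reduced_eq_exponent.
  apply: leq_trans (ltnW reduced_exponent_gt).
  apply: leq_trans (_ : t * (e + 3) <= _).
    by rewrite mulnDr; apply: leq_trans (_ : t * e + 2 * t <= _); [move: e t_gt0; clear; nia | clear; lia].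
  rewrite leq_mul2l; apply/orP; right; apply: leq_trans (leq_exp_add3 a_ge5 e_gt0) _.
  by rewrite eqnu leq_pmulr.
have := reduced_first_order leD; move: eqb; rewrite n1 expn1 => eb.
have : b ^ y = 1 %[mod a ^ t] by rewrite -modnXm eb modnMDl modnXm exp1n.
move=> modb; rewrite -[_ %| _]/(_ == 0) -modnDml -modnMml modb modnMml mul1n modnDml => dvd1.
have {}dvd1 : a ^ t <= del * kap + 1 by rewrite dvdn_leq // addn1.
have ltk : kap < a ^ e.
  rewrite -(@ltn_pmul2r (a ^ t)) ?expn_gt0 ?a_gt0 // -expnD addnC -reduced_eq_exponent.
  by apply: leq_trans lebX; rewrite eb addn1.
apply: leq_trans dvd1 _; rewrite eqnu; move: ltk del_gt0; move: (a ^ e) => q; clear; nia.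
Qed.
End Reduced.

(** * Bases of order three: bounding [Z] in terms of [nu] *)

Section SecondOrder.
Local Open Scope ring_scope.

(* [b] is a primitive cube root of unity modulo [Z]; the two congruences determine
   [(3 nu + 1) b] modulo [Z], and the norm form then bounds [Z]. *)
Lemma second_order_congruence (Z b k del nu : int) :
  coprimez Z 3 -> b ^+ 2 + b + 1 = k * Z ->
  (Z ^+ 2 %| 2 * b * (b - 1) * k * del + (nu - 1) * del * b * (b - 1) ^+ 2 * k ^+ 2 * Z + 2)%Z ->
  (Z %| b * (b - 1) * k * del + 1)%Z ->
  exists j, j * Z = 3 * del * k + 2 * b + 1 /\
    (Z %| (6 * del * j + 3 * nu + 3) ^+ 2 + (3 * nu + 1) * (6 * del * j + 3 * nu + 3) +
      (3 * nu + 1) ^+ 2)%Z.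
Proof.
move=> cop eP /dvdzP[m em] /dvdzP[l el].
have Z_neq0 : Z != 0 by apply: contra_eqN em => /eqP Z0; apply/eqP => em'; move: eP em'; rewrite Z0; nia.
(* Modulo [Z], [b (b - 1)] is [- (2 b + 1)] and [(2 b + 1) ^ 2] is -3. So the first-order congruence
   times [2 b + 1] says that [3 del k + 2 b + 1] vanishes; [j] is the quotient. *)
pose j := (2 * b + 1) * l - (2 * b - 3) * k * del * k.
have ej : j * Z = 3 * del * k + 2 * b + 1.
  have -> : j * Z = (2 * b + 1) * (l * Z) - (2 * b - 3) * k * del * (k * Z) by rewrite /j; ring.
  by rewrite -el -eP; ring.
exists j; split=> //; set e0 := 6 * del * j + _ + _.
have d1 : (Z %| 2 * j + del * k ^+ 2 * ((3 * nu + 1) * b - 3 * nu - 3))%Z.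
  apply/dvdzP; exists ((2 * b + 1) * m - (nu - 1) * del * k ^+ 3 * (b - 1) * (2 * b - 3)).
  apply: (mulfI Z_neq0).
  have -> : Z * (((2 * b + 1) * m - (nu - 1) * del * k ^+ 3 * (b - 1) * (2 * b - 3)) * Z) =
    (2 * b + 1) * (m * Z ^+ 2) - (nu - 1) * del * k ^+ 2 * (b - 1) * (2 * b - 3) * (k * Z) * Z by ring.
  rewrite -em -eP.
  transitivity (2 * (j * Z) + Z * (del * k ^+ 2 * ((3 * nu + 1) * b - 3 * nu - 3))); first by ring.
  rewrite ej.
  have -> : 2 * (3 * del * k + 2 * b + 1) + Z * (del * k ^+ 2 * ((3 * nu + 1) * b - 3 * nu - 3)) =
    2 * (3 * del * k + 2 * b + 1) + (k * Z) * (del * k * ((3 * nu + 1) * b - 3 * nu - 3)) by ring.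
  have -> : (2 * b + 1) * (2 * b * (b - 1) * k * del + (nu - 1) * del * b * (b - 1) ^+ 2 * k ^+ 2 * Z + 2) -
     (nu - 1) * del * k ^+ 2 * (b - 1) * (2 * b - 3) * (b ^+ 2 + b + 1) * Z =
     (2 * b + 1) * (2 * b * (b - 1) * k * del + (nu - 1) * del * b * (b - 1) ^+ 2 * k * (k * Z) + 2) -
     (nu - 1) * del * k * (b - 1) * (2 * b - 3) * (b ^+ 2 + b + 1) * (k * Z) by ring.
  by rewrite -eP; ring.
(* Multiplying by [9 del] eliminates [k], since [9 del ^ 2 k ^ 2] is [(2 b + 1) ^ 2], that is -3,
   modulo [Z]. *)
have d2 : (Z %| (3 * nu + 1) * b - e0)%Z.
  have d3 : (Z %| 3 * ((3 * nu + 1) * b - e0))%Z.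
    have -> : 3 * ((3 * nu + 1) * b - e0) =
      Z * (j * (j * Z - 2 * (2 * b + 1)) + 4 * k) * ((3 * nu + 1) * b - 3 * nu - 3) -
       9 * del * (2 * j + del * k ^+ 2 * ((3 * nu + 1) * b - 3 * nu - 3)).
      have -> : Z * (j * (j * Z - 2 * (2 * b + 1)) + 4 * k) =
        (j * Z) * (j * Z - 2 * (2 * b + 1)) + 4 * (k * Z) by ring.
      by rewrite ej -eP /e0; ring.
    by apply: dvdz_sub; [rewrite -mulrA dvdz_mulr | rewrite dvdz_mull].
  by move: d3; rewrite Gauss_dvdzr.
case/dvdzP: d2 => z ez; apply/dvdzP.
have eb : e0 = (3 * nu + 1) * b - z * Z by rewrite -ez; ring.
exists ((3 * nu + 1) ^+ 2 * k - 2 * z * (3 * nu + 1) * b + z ^+ 2 * Z - (3 * nu + 1) * z).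
have -> : ((3 * nu + 1) ^+ 2 * k - 2 * z * (3 * nu + 1) * b + z ^+ 2 * Z - (3 * nu + 1) * z) * Z =
  (3 * nu + 1) ^+ 2 * (k * Z) + (- 2 * z * (3 * nu + 1) * b + z ^+ 2 * Z - (3 * nu + 1) * z) * Z by ring.
by rewrite -eP eb; ring.
Qed.
End SecondOrder.

(** For [y = 1], [Z] divides [A ^ 2 + A B + B ^ 2], at most [(A + B) ^ 2], with
    [A = 6 del J + 3 nu + 3] and [B = 3 nu + 1]; [del J <= 3 nu ^ 2 + 2 nu] bounds [A + B] by the
    inner expression. The cases [y >= 2] stay below this too. *)
Definition order3_bound nu := (18 * nu ^ 2 + 18 * nu + 4) ^ 2.

Section OrderThree.
Variables (a b y k nu e t del x1 x2 : nat).
Hypotheses (pa : prime a) (a_ge : 7 <= a) (t_gt0 : 0 < t) (b_gt1 : 1 < b) (y_gt0 : 0 < y).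
Hypotheses (nab : ~~ (a %| b)) (eqP3 : b ^ 2 + b + 1 = k * a ^ t) (nakap : ~~ (a %| (b - 1) * k)).
Hypotheses (eqnu : nu = a ^ e * del) (nadel : ~~ (a %| del)) (odd_nu : odd nu).
Hypotheses (ltx : x1 < x2) (ltby : b ^ y < a ^ x1) (Z_ge : 1323 <= a ^ t).
Hypothesis eqn : b ^ y * (b ^ 3) ^ nu + a ^ x1 = a ^ x2 + b ^ y.

Let a_gt0 : 0 < a. Proof. exact: prime_gt0. Qed.
Let a_gt1 : 1 < a. Proof. exact: prime_gt1. Qed.
Let a_ge5 : 5 <= a. Proof. exact: leq_trans a_ge. Qed.
Let eqb : b ^ 3 = ((b - 1) * k) * a ^ t + 1.
Proof. by rewrite -mulnA -eqP3; move: b_gt1; clear; case: b => // m _; rewrite subn1 /=; ring. Qed.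
Let eqx1 : x1 = t + e.
Proof. exact: (reduced_eq_exponent pa a_ge t_gt0 nab eqb nakap eqnu nadel ltx eqn). Qed.
Let x2_gt : t * nu < x2.
Proof. exact: (reduced_exponent_gt pa b_gt1 y_gt0 eqb nakap ltby eqn). Qed.
Let del_gt0 : 0 < del. Proof. by rewrite lt0n; apply: contraNneq nadel => ->; rewrite dvdn0. Qed.
Let k_gt0 : 0 < k.
Proof. by rewrite lt0n; apply/eqP => k0; move: eqP3; rewrite k0 mul0n addn1. Qed.
Let b_ge : 36 <= b.
Proof.
have : a ^ t <= b ^ 2 + b + 1.
  by rewrite eqP3 leq_pmull.
move: Z_ge; move: (a ^ t) => Z; clear; nia.
Qed.
Let q_gt0 : 0 < a ^ e. Proof. by rewrite expn_gt0 a_gt0. Qed.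
Let Z_gt0 : 0 < a ^ t. Proof. by rewrite expn_gt0 a_gt0. Qed.
Let le_q_nu : a ^ e <= nu. Proof. by rewrite eqnu leq_pmulr. Qed.
Let eqX : a ^ x1 = a ^ t * a ^ e. Proof. by rewrite eqx1 expnD. Qed.

Let nu_case : nu = 1 /\ e = 0 \/ e + 3 <= nu.
Proof.
have [e0|e_gt0] := posnP e; last first.
  by right; apply: leq_trans (leq_exp_add3 a_ge5 e_gt0) le_q_nu.
by move: odd_nu; rewrite e0; case: nu => [|[|[|m]]] //; [left | right].
Qed.

Let le_quot_t : e + 3 <= nu -> t <= x2 - x1 /\ e + t * 3 <= x2.
Proof.
move=> le3; have : t * (e + 3) <= x2 by apply: leq_trans (ltnW x2_gt); rewrite leq_mul2l le3 orbT.
rewrite leq_subRL ?(ltnW ltx) // eqx1; move: t_gt0; clear; nia.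
Qed.

Let nu1_quotient : nu = 1 -> e = 0 -> b ^ y * ((b - 1) * k) + 1 = a ^ (x2 - x1).
Proof.
move=> nu1 e0; apply/eqP; rewrite -(eqn_pmul2l (_ : 0 < a ^ x1)) ?expn_gt0 ?a_gt0 //.
rewrite -expnD subnKC ?(ltnW ltx) // -(eqn_add2r (b ^ y)) -eqn nu1 expn1 eqb eqX e0 expn0.
by apply/eqP; ring.
Qed.

(** Size alone: [b ^ 3 < Z * a ^ e] and [Z <= b ^ 2 + b + 1] give [b < 2 * a ^ e <= 2 * nu]. *)
Lemma order3_bound_ge3 : 3 <= y -> a ^ t <= order3_bound nu.
Proof.
move=> y_ge; have : b ^ 3 < a ^ t * a ^ e by rewrite -eqX; apply: leq_ltn_trans ltby; rewrite leq_exp2l // ltnW.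
have : a ^ t <= b ^ 2 + b + 1.
  by rewrite eqP3 leq_pmull.
rewrite /order3_bound; move: le_q_nu b_ge; move: (a ^ t) (a ^ e) => Z q leq b36 leZ lt3.
have ltb : b < 2 * q.
  have : b ^ 3 < 2 * b ^ 2 * q.
    apply: leq_trans lt3 _; rewrite leq_mul2r; apply/orP; right; apply: leq_trans leZ _.
    by move: b36; clear; nia.
  by rewrite -mulnA mulnCA expnSr ltn_pmul2l // expn_gt0 (ltnW b_gt1).
have : b ^ 2 + b + 1 <= 2 * b ^ 2 by move: b36; clear; nia.
have : b ^ 2 <= (2 * q) ^ 2 by rewrite leq_exp2r // ltnW.
have : (2 * q) ^ 2 <= (2 * nu) ^ 2 by rewrite leq_exp2r // leq_mul2l leq.
move: leZ; move: (b ^ 2) ((2 * q) ^ 2) => B2 Q2; clear; nia.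
Qed.

(** Modulo [Z], [b ^ 2 (b - 1) ^ 2] is -3, so the first-order congruence becomes [3 del k = b - 1],
    with left side below [6 nu]. If the two numbers differ, [Z] is at most the larger one, and when
    that is [b - 1], [b ^ 2 < Z * a ^ e] gives [Z < a ^ e]. If they are equal, [b] is bounded, and
    so is [Z]. *)
Lemma order3_bound_2 : y = 2 -> a ^ t <= order3_bound nu.
Proof.
move=> y2; have leD : t <= x2 - x1.
  case: nu_case => [[nu1 e0]|/le_quot_t[]//].
  rewrite -(leq_exp2l _ _ a_gt1) -nu1_quotient // y2.
  have := eqX; rewrite e0 expn0 muln1 => eX; move: ltby; rewrite y2 eX => lt2.
  have k1 : k = 1.
    have : k * a ^ t < 2 * a ^ t.
      rewrite -eqP3; move: lt2 b_ge; move: (a ^ t) => Z; clear; nia.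
    rewrite ltn_pmul2r //; by case: (k) k_gt0 => [|[|]].
  rewrite -[a ^ t]mul1n -{1}k1 -eqP3 k1 muln1; move: b_ge; clear; nia.
have := reduced_first_order pa a_ge t_gt0 nab eqb nakap eqnu nadel ltx eqn leD.
rewrite y2 => dvd1.
have dvd2 : (Posz (a ^ t) %| (3 * del%:Z * k%:Z - (b%:Z - 1))%R)%Z.
  have : (Posz (a ^ t) %| ((b%:Z - 1) * Posz (b ^ 2 * (del * ((b - 1) * k)) + 1))%R)%Z.
    by rewrite dvdz_mull // dvdzE.
  have : (Posz (a ^ t) %| ((b%:Z ^+ 2 - 3 * b%:Z + 3) * del%:Z * k%:Z * Posz (k * a ^ t))%R)%Z.
    by rewrite dvdz_mull // PoszM dvdz_mull.
  rewrite -eqP3 => d1 d2; have := dvdz_sub d1 d2.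
  rewrite !(PoszD, PoszM) !PoszX -subzn ?(ltnW b_gt1) //.
  congr (_ %| _)%Z; move: (Posz b) (Posz del) (Posz k) => B L K.
  by ring.
have ltk : k < 2 * a ^ e.
  rewrite -(ltn_pmul2r Z_gt0) -eqP3; move: ltby; rewrite y2 eqX; move: b_ge.
  by rewrite -mulnA [a ^ e * _]mulnC; move: (a ^ t * a ^ e) => X; clear; nia.
have ltA : 3 * (del * k) < 6 * nu.
  have : del * k < del * (2 * a ^ e) by rewrite ltn_pmul2l.
  by rewrite eqnu; move: (a ^ e) (del * k) => q m; clear; lia.
suff le72 : a ^ t <= 72 * nu ^ 2.
  apply: leq_trans le72 _; apply: leq_trans (_ : (18 * nu ^ 2) ^ 2 <= _).
    by move: (nu ^ 2) => N; clear; nia.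
  by rewrite /order3_bound leq_exp2r // -addnA leq_addr.
have nu_gt0 : 0 < nu by apply: leq_trans le_q_nu.
have lePb : a ^ t <= b ^ 2 + b + 1 by rewrite eqP3 leq_pmull.
have [ltAB|ltBA|eqAB] := ltngtP (3 * (del * k)) (b - 1).
- have : (Posz (a ^ t) %| Posz (b - 1 - 3 * (del * k)))%Z.
    move: (dvdz_sub (dvdz0 _) dvd2); rewrite -subzn ?(ltnW ltAB) // -subzn ?(ltnW b_gt1) // !PoszM.
    congr (_ %| _)%Z.
    by move: (Posz del) (Posz k) => L K; ring.
  rewrite dvdzE /= => /dvdn_leq; rewrite subn_gt0 ltAB => /(_ isT) leZ.
  move: ltby; rewrite y2 eqX => lt2.
  have ltZb : a ^ t < b by apply: leq_ltn_trans leZ _; move: b_gt1; clear; lia.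
  have : a ^ t * a ^ t < a ^ t * a ^ e.
    by apply: leq_ltn_trans lt2; rewrite -mulnn; apply: leq_mul; apply: ltnW.
  rewrite ltn_pmul2l // => ltZq; apply: leq_trans (ltnW ltZq) _.
  by apply: leq_trans le_q_nu _; rewrite expnS expn1 mulnA leq_pmull // muln_gt0.
- have : (Posz (a ^ t) %| Posz (3 * (del * k) - (b - 1)))%Z.
    rewrite -subzn ?(ltnW ltBA) //.
    move: dvd2; rewrite -subzn ?(ltnW b_gt1) // !PoszM; congr (_ %| _)%Z.
    by move: (Posz del) (Posz k) => L K; ring.
  rewrite dvdzE /= => /dvdn_leq; rewrite subn_gt0 ltBA => /(_ isT) leZ.
  apply: leq_trans leZ _; apply: leq_trans (leq_subr _ _) _; apply: leq_trans (ltnW ltA) _.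
  by rewrite expnS expn1 mulnA leq_mul2r; apply/orP; right; move: nu_gt0; clear; lia.
apply: leq_trans lePb _; have leb : b <= 6 * nu by move: ltA; rewrite eqAB; clear; lia.
have : b ^ 2 <= (6 * nu) ^ 2 by rewrite leq_exp2r.
by rewrite expnMn; move: b_ge; move: (nu ^ 2) => N; clear; nia.
Qed.

Lemma order3_bound_1 : y = 1 -> a ^ t <= order3_bound nu.
Proof.
move=> y1; have ltb : b < a ^ t * a ^ e by rewrite -eqX -[b]expn1 -{1}y1.
have copZ3 : coprimez (a ^ t)%N 3.
  rewrite coprimezE /= coprimeXl // prime_coprime // gtnNdvd //.
  by rewrite (leq_trans _ a_ge).
(* For [nu = 1] the size of [x2] needs an argument, from [b (b - 1) k + 1 = a ^ (x2 - x1)]. If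
   [x2 - x1 < t], this power divides the smaller positive number [k (2 b + 1) - 1]. If
   [x2 - x1 < 2 t], then [Z] divides [3 k + 2 b + 1], whence [Z < 5 b] and
   [b ^ 3 (b - 1) < 125 b ^ 3], against [Z >= 1323]. *)
have nu1_step : nu = 1 -> e = 0 -> t <= x2 - x1 /\ e + t * 3 <= x2.
  move=> nu1 e0; have := nu1_quotient nu1 e0; rewrite y1 expn1 => eqD.
  have k_pos := k_gt0; have dvdk m : a ^ m %| a ^ t -> a ^ m %| b * ((b - 1) * k) + 1 ->
      a ^ m %| k * (2 * b + 1) - 1.
    move=> d1 d2; have -> : k * (2 * b + 1) - 1 = k * (k * a ^ t) - (b * ((b - 1) * k) + 1).
      rewrite -eqP3; move: b_gt1 k_pos; clear; case: b => // m' _; rewrite subn1 /=; nia.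
    by rewrite dvdn_sub // mulnA dvdn_mull.
  have leD : t <= x2 - x1.
    rewrite leqNgt; apply/negP => ltD; have := dvdk (x2 - x1).
    rewrite eqD dvdnn dvdn_exp2l ?(ltnW ltD) // => /(_ isT isT) /dvdn_leq.
    rewrite -eqD subn_gt0; move: b_ge k_pos; clear; case: b => // m; rewrite subn1 /=; nia.
  split=> //; rewrite e0 add0n leqNgt; apply/negP => ltx2.
  have ltD : a ^ (x2 - x1) < (a ^ t) ^ 2.
    rewrite -expnM ltn_exp2l //; move: ltx2 eqx1 ltx; rewrite e0; clear; lia.
  have := dvdk t (dvdnn _); rewrite eqD dvdn_exp2l // => /(_ isT) dvdZ.
  have {dvdZ} leZ : a ^ t <= 3 * k + (2 * b + 1).
    apply: dvdn_leq; first by rewrite addn_gt0 muln_gt0 k_pos.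
    have : a ^ t %| 4 * k * (k * a ^ t) by rewrite mulnA dvdn_mull.
    rewrite -eqP3; have -> : 4 * k * (b ^ 2 + b + 1) =
      3 * k + (2 * b + 1) + (2 * b + 1) * (k * (2 * b + 1) - 1).
      by move: b_ge k_pos; clear; nia.
    by rewrite dvdn_addl // dvdn_mull.
  move: eqD ltD eqP3 leZ Z_ge b_ge; move: (a ^ (x2 - x1)) (a ^ t) => D Z <- ltD eP leZ Zge bge.
  have lt5 : Z < 5 * b.
    rewrite ltnNge; apply/negP => le5.
    have : Z * Z <= 3 * (b ^ 2 + b + 1) + (2 * b + 1) * Z.
      by rewrite eP mulnA -mulnDl leq_mul2r leZ orbT.
    by move: le5 Zge; clear; nia.
  have lt3 : (b ^ 2 + b + 1) * (b * (b - 1)) < Z ^ 3.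
    rewrite eP; apply: leq_ltn_trans (_ : (b * ((b - 1) * k) + 1) * Z < _).
      by rewrite mulnDl; apply: leq_trans (leq_addr _ _); rewrite leq_eqVlt; apply/orP; left; apply/eqP; ring.
    by rewrite expnSr ltn_pmul2r // (leq_trans _ Zge).
  have : (5 * b) ^ 3 <= 125 * b ^ 3 by rewrite expnMn.
  have : Z ^ 3 < (5 * b) ^ 3 by rewrite ltn_exp2r.
  have : b ^ 3 * (b - 1) <= (b ^ 2 + b + 1) * (b * (b - 1)).
    by rewrite expnSr -mulnA leq_mul2r; apply/orP; right; clear; lia.
  have ltb125 : b ^ 3 * 125 <= b ^ 3 * (b - 1) by rewrite leq_mul2l; apply/orP; right; move: lt5 Zge; clear; lia.
  by move: ltb125 lt3; move: (_ * (b * (b - 1))) (Z ^ 3) ((5 * b) ^ 3) (b ^ 3 * (b - 1)) (b ^ 3) => A B C D' E; clear; lia.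
have [leD lex2] : t <= x2 - x1 /\ e + t * 3 <= x2.
  by case: nu_case => [[/nu1_step H /H]|/le_quot_t].
have dvd1 := reduced_first_order pa a_ge t_gt0 nab eqb nakap eqnu nadel ltx eqn leD.
have nu_gt0 : 0 < nu by apply: leq_trans le_q_nu.
have dvdZ2 := reduced_second_order pa a_ge t_gt0 nab eqb nakap eqnu nadel ltx eqn nu_gt0 lex2.
rewrite y1 expn1 in dvd1 dvdZ2.
have eqP3z : (b%:Z ^+ 2 + b%:Z + 1 = k%:Z * Posz (a ^ t))%R.
  by rewrite -PoszM -eqP3 !PoszD PoszX.
have := @second_order_congruence (Posz (a ^ t)) b k del nu copZ3 eqP3z.
case.
- have : (Posz ((a ^ t) ^ 2) %| Posz (b * ((b - 1) * k) * del *
    (2 + (nu - 1) * ((b - 1) * k * a ^ t)) + 2))%Z by rewrite dvdzE.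
  rewrite !(PoszD, PoszM, PoszX) -!subzn ?(ltnW b_gt1) //; congr (_ %| _)%Z.
  by move: (Posz a ^+ t)%R => Z; move: (Posz b) (Posz k) (Posz nu) (Posz del) => B K N L; ring.
- have : (Posz (a ^ t) %| Posz (b * (del * ((b - 1) * k)) + 1))%Z by rewrite dvdzE.
  rewrite !(PoszD, PoszM, PoszX) -!subzn ?(ltnW b_gt1) //; congr (_ %| _)%Z.
  by move: (Posz b) (Posz k) (Posz del) => B K L; ring.
move=> j [ej dvdj].
have [J eJ] : exists J : nat, j = Posz J.
  exists `|j|%N; rewrite gez0_abs // leNgt; apply/negP => j_lt0.
  have : (j * Posz (a ^ t) < 0)%R by rewrite nmulr_rlt0 // ltz_nat.
  by rewrite ej; clear; lia.
rewrite {j}eJ in ej dvdj.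
have {}ej : J * a ^ t = 3 * (del * k) + 2 * b + 1.
  by apply/eqP; rewrite -eqz_nat PoszM ej !PoszD !PoszM; apply/eqP; ring.
have {}dvdj : a ^ t %| (6 * (del * J) + 3 * nu + 3) ^ 2 +
    (3 * nu + 1) * (6 * (del * J) + 3 * nu + 3) + (3 * nu + 1) ^ 2.
  move: dvdj; rewrite -[(_ %| _)%N]/((Posz _ %| Posz _)%Z).
  rewrite !(PoszD, PoszM, PoszX); congr (_ %| _)%Z.
  by move: (Posz J) (Posz nu) (Posz del) => B K L; ring.
(* [b < Z * a ^ e] bounds [k]; through [J * Z = 3 del k + 2 b + 1] this bounds [J], and finally
   [del * J] by a polynomial in [nu] alone. *)
have lek : k <= (a ^ e) ^ 2 * a ^ t.
  rewrite -(leq_pmul2r Z_gt0) -eqP3.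
  have : (b + 1) ^ 2 <= (a ^ t * a ^ e) ^ 2 by rewrite leq_exp2r // addn1.
  have -> : (a ^ e) ^ 2 * a ^ t * a ^ t = (a ^ t * a ^ e) ^ 2 by ring.
  by apply: leq_trans; clear; nia.
have leJ : J <= 3 * (del * (a ^ e) ^ 2) + 2 * a ^ e.
  rewrite -(leq_pmul2r Z_gt0) ej.
  have : 3 * (del * k) <= 3 * (del * ((a ^ e) ^ 2 * a ^ t)) by rewrite !leq_mul2l lek !orbT.
  have -> : (3 * (del * (a ^ e) ^ 2) + 2 * a ^ e) * a ^ t =
    3 * (del * ((a ^ e) ^ 2 * a ^ t)) + 2 * (a ^ t * a ^ e) by ring.
  by move: ltb; move: (3 * (del * k)) (3 * (del * _)) (a ^ t * _) => A B C; clear; lia.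
have ledJ : del * J <= 3 * nu ^ 2 + 2 * nu.
  have : del * J <= del * (3 * (del * (a ^ e) ^ 2) + 2 * a ^ e) by rewrite leq_mul2l leJ orbT.
  by congr (_ <= _); rewrite eqnu; ring.
apply: leq_trans (dvdn_leq _ dvdj) _; first by rewrite addn_gt0 !expn_gt0 addn1 orbT.
have leE : 6 * (del * J) + 3 * nu + 3 + (3 * nu + 1) <= 18 * nu ^ 2 + 18 * nu + 4.
  by move: ledJ; move: (nu ^ 2) (del * J) => N M; clear; lia.
apply: leq_trans (_ : (6 * (del * J) + 3 * nu + 3 + (3 * nu + 1)) ^ 2 <= _); last by rewrite leq_exp2r.
by rewrite [in X in _ <= X]sqrnD; move: (6 * _ + _ + _) (3 * nu + 1) => A B; clear; nia.
Qed.

Lemma order3_boundP : a ^ t <= order3_bound nu.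
Proof.
case: (ltngtP y 2) => [y_lt2|/order3_bound_ge3 //|/order3_bound_2 //].
by apply: order3_bound_1; apply/eqP; rewrite eqn_leq y_gt0 -ltnS y_lt2.
Qed.
End OrderThree.

(** * Finite verification *)

Local Open Scope N_scope.

(* Nested conditionals replace [&&], whose second argument [vm_compute] would always evaluate. *)

Fixpoint powmod (m g : N) (p : positive) : N :=
  match p with
  | xH => N.modulo g m
  | xO p => let s := powmod m g p in N.modulo (s * s) m
  | xI p => let s := powmod m g p in N.modulo (g * N.modulo (s * s) m) m
  end.

(** Exhausted fuel answers [true], which excludes nothing. *)
Fixpoint is_power (a : N) fuel v :=
  if fuel is f.+1 then
    if N.eqb v 1 then true else
    if N.eqb (N.modulo v a) 0 then is_power a f (N.div v a) else false
  else true.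

Fixpoint all_progression (P : N -> bool) (step : N) n (v : N) :=
  if n is m.+1 then if P v then all_progression P step m (v + step) else false else true.

(** Exhausted fuel answers [false] and fails the verification, so soundness does not depend on the
    fuel. *)
Fixpoint all_powers (P : N -> bool) (bound b : N) fuel v :=
  if fuel is f.+1 then
    if N.leb bound v then true else if P v then all_powers P bound b f (v * b) else false
  else false.

(* The values are [det_threshold u] for [u = 6, 4, 3, 2, 1]. *)
Definition exponent_bound (Z : N) : N :=
  if N.eqb Z 7 then 19875 else if N.eqb Z 13 then 6919 else if N.eqb Z 49 then 3393
  else if N.ltb Z 1323 then 1323 else 325.

Section Exclusion.
Variables (a t Z e q X : N).

(* Powers of [a] are [1], [a] or [a ^ 2] modulo [a ^ 3 - 1]: a cheap test that is nearly always decisive. *)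
Definition power_excluded (B w nu : N) :=
  if nu is Npos p then
    let m := a ^ 3 - 1 in
    let v := (B * powmod m (w + 1) p + (X - B)) mod m in
    if (if N.eqb v 1 then false else if N.eqb v a then false else ~~ N.eqb v (a * a)) then true else
    if N.leb nu 3 then ~~ is_power a 64 (B * (w + 1) ^ nu + (X - B)) else
    (* [x2 > t * nu], so [M] divides [a ^ x2]; the cap [t + e + 6] keeps the modulus small. *)
    let M := a ^ N.min (t * nu + 1) (t + e + 6) in
    ~~ N.eqb ((B * powmod M (w + 1) p + (X - B)) mod M) 0
  else false.

(* For [Z = 7] the determinant with [u = 5] handles [det_threshold 5 <= nu <= 7 ^ 5]. *)
Definition exponent_covered (nu : N) :=
  if N.leb (exponent_bound Z) nu then true else
  if N.eqb Z 7 then if N.leb 12285 nu then N.leb nu 16807 else false else false.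

(** The middle test is the second-order congruence modulo [Z ^ 2], available only for [e + 3 <= nu];
    the equation itself is tested last, as the most expensive. *)
Definition exponent_excluded (B w k del : N) :=
  let nu := q * del in
  if exponent_covered nu then true else
  if (if N.leb (e + 3) nu then
        let k2 := k mod (Z * Z) in let w2 := (k2 * Z) mod (Z * Z) in
        ~~ N.eqb ((B * k2 * (del * (2 + (nu - 1) * w2)) + 2) mod (Z * Z)) 0
      else false) then true else
  power_excluded B w nu.

(* [v] runs through the residues of [u * rho + 1]: by the first-order congruence only the [rho] with
   [v = 0] give candidate residue classes of [del]. *)
Fixpoint classes_excluded (P : N -> bool) (u2 : N) cnt (v rho : N) :=
  if cnt is m.+1 then
    if (if N.eqb v 0 then P rho else true) then
      let v' := v + u2 in
      classes_excluded P u2 m (if N.leb Z v' then v' - Z else v') (rho + 2)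
    else false
  else true.

Definition base_excluded (n : N) (cnt cnt' : nat) (b : N) :=
  if N.leb b 1 then true else
  let w := b ^ n - 1 in let k := w / Z in let k1 := k mod Z in
  all_powers (fun B =>
    let u := (B * k1) mod Z in
    (* The first-order congruence requires [e + 2 <= nu], which fails only for [e = 0] and [nu = 1];
       that case is tested separately. *)
    if (if N.eqb e 0 then exponent_excluded B w k 1 else true) then
      classes_excluded (all_progression (exponent_excluded B w k) (2 * Z) cnt')
        ((2 * u) mod Z) cnt ((u + 1) mod Z) 1
    else false) X b 64 b.
End Exclusion.

(** Since [del] is odd, only [del = 1] remains once [3 * q] reaches the bound, and then it may
    suffice that [q] is covered. Otherwise [b < q * Z] runs through the [q] members of each
    admissible residue class: [om] and [- 1 - om] for order three, 1 for order one. The last is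
    dropped for [Z >= 1323], where order one is impossible. *)
Definition valuation_excluded (a om t Z e q : N) : bool :=
  if (if N.leb (exponent_bound Z) (3 * q) then exponent_covered Z q else false) then true else
  let r := om mod Z in
  let cnt := exponent_bound Z / (2 * q) + 1 in
  let check n v := all_progression
    (base_excluded a t Z e q (q * Z) n (N.to_nat (N.min cnt Z))
      (N.to_nat (cnt / Z + 1))) Z (N.to_nat q) v in
  if check 3 r then if check 3 (Z - 1 - r) then if N.leb 1323 Z then true else check 1 1
  else false else false.

Fixpoint all_valuations (a om t Z : N) fuel e q :=
  if fuel is f.+1 then
    if N.leb (exponent_bound Z) q then true else
    if valuation_excluded a om t Z e q then all_valuations a om t Z f (e + 1) (q * a) else false
  else false.

(* [om] is a primitive cube root of unity modulo every [a ^ t] below the bound on [Z]. *)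
Fixpoint all_orders (a om : N) fuel t Z :=
  if fuel is f.+1 then
    if N.eqb (N.modulo (om * om + om + 1) Z) 0 then
    if all_valuations a om t Z 20 0 1 then all_orders a om f (t + 1) (Z * a) else false else false
  (* This is [order3_bound 325]: the loop must have passed every [Z] that the bound permits. *)
  else N.ltb ((18 * 325 * 325 + 18 * 325 + 4) ^ 2) Z.
Local Close Scope N_scope.

(** * Soundness of the tests *)

Lemma of_natD m n : ofn (m + n) = (ofn m + ofn n)%num.
Proof. exact: Nat2N.inj_add. Qed.
Lemma of_natM m n : ofn (m * n) = (ofn m * ofn n)%num.
Proof. exact: Nat2N.inj_mul. Qed.
Lemma of_natB m n : ofn (m - n) = (ofn m - ofn n)%num.
Proof. exact: Nat2N.inj_sub. Qed.
Lemma of_natX m n : ofn (m ^ n) = (ofn m ^ ofn n)%num.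
Proof.
elim: n => [|n IHn] //; rewrite expnS of_natM IHn Nat2N.inj_succ N.pow_succ_r //.
exact: N.le_0_l.
Qed.
Lemma of_nat_leb m n : N.leb (ofn m) (ofn n) = (m <= n).
Proof. by apply/N.leb_spec0/idP => h; lia. Qed.
Lemma of_nat_eqb m n : N.eqb (ofn m) (ofn n) = (m == n).
Proof. by apply/N.eqb_spec/eqP => h; lia. Qed.
Lemma of_nat_mod m d : N.modulo (ofn m) (ofn d) = ofn (m %% d).
Proof.
case: d => [|d]; first by rewrite modn0; case: (ofn m).
rewrite {1}(divn_eq m d.+1) of_natD of_natM N.add_comm N.Div0.mod_add N.mod_small //.
by have := ltn_pmod m (ltn0Sn d); lia.
Qed.
Lemma of_nat_div m d : N.div (ofn m) (ofn d) = ofn (m %/ d).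
Proof.
case: d => [|d]; first by rewrite divn0; case: (ofn m).
rewrite {1}(divn_eq m d.+1) of_natD of_natM N.div_add_l ?N.div_small ?N.add_0_r //.
by have := ltn_pmod m (ltn0Sn d); lia.
Qed.

Lemma powmodE m g p : N.modulo (powmod m g p) m = N.modulo (g ^ Npos p)%num m.
Proof.
have sqr_mod s h : N.modulo s m = N.modulo h m -> N.modulo (s * s)%num m = N.modulo (h * h)%num m.
  by move=> eqm; rewrite N.Div0.mul_mod eqm -N.Div0.mul_mod.
elim: p => [p /sqr_mod IHp|p /sqr_mod IHp|].
- have -> : Npos (xI p) = (1 + (Npos p + Npos p))%num by lia.
  by rewrite !N.pow_add_r N.pow_1_r [powmod _ _ _]/= N.Div0.mod_mod IHp N.Div0.mul_mod_idemp_r.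
- have -> : Npos (xO p) = (Npos p + Npos p)%num by lia.
  by rewrite N.pow_add_r [powmod _ _ _]/= N.Div0.mod_mod.
by rewrite N.pow_1_r N.Div0.mod_mod.
Qed.

Lemma is_power_expn a f x : 1 < a -> is_power (ofn a) f (ofn (a ^ x)).
Proof.
move=> a_gt1; elim: f x => // f IHf [|x] //=.
rewrite (of_nat_eqb _ 1) of_nat_mod expnS modnMr mulnC of_nat_div mulnK ?(ltnW a_gt1) //=.
by rewrite IHf; case: ifP.
Qed.

Lemma all_progressionP P step n v i :
  all_progression P step n v -> i < n -> P (v + ofn i * step)%num.
Proof.
elim: n v i => // n IHn v i; rewrite [all_progression _ _ _ _]/=; case: ifP => // Pv.
case: i => [_ _|i /IHn H /H]; last by congr (is_true (P _)); lia.
by have -> : (v + ofn 0 * step)%num = v by lia.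
Qed.

Lemma all_powersP P X b f v j : 0 < b ->
  all_powers P (ofn X) (ofn b) f (ofn v) -> v * b ^ j < X -> P (ofn (v * b ^ j)).
Proof.
move=> b_gt0; elim: f v j => // f IHf v j /=; rewrite of_nat_leb; case: (leqP X v) => [leX|_].
  by move=> _; rewrite ltnNge => /negP[]; rewrite (leq_trans leX) // leq_pmulr // expn_gt0 b_gt0.
case: (boolP (P _)) => // Pv; rewrite -of_natM; case: j => [|j]; first by rewrite expn0 muln1.
by rewrite expnS mulnA => /IHf; apply.
Qed.

Lemma classes_excludedP Z P u cnt rho i :
  classes_excluded (ofn Z) P (ofn (2 * u %% Z)) cnt (ofn ((u * rho + 1) %% Z)) (ofn rho) ->
  i < cnt -> Z %| u * (rho + i * 2) + 1 -> P (ofn (rho + i * 2)).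
Proof.
elim: cnt rho i => // cnt IHc rho i /=; rewrite (of_nat_eqb _ 0).
case: i => [|i]; first by rewrite addn0 /dvdn; case: eqP => // _; case: (P _).
case: ifP => // _; rewrite -of_natD of_nat_leb -of_natB -[2%num]/(ofn 2) -of_natD.
set v := if _ then _ else _; have -> : v = ofn ((u * (rho + 2) + 1) %% Z).
  rewrite /v; case: (posnP Z) => [->|Z_gt0].
    by rewrite leq0n !modn0 subn0; congr ofn; ring.
  have -> : u * (rho + 2) + 1 = u * rho + 1 + 2 * u by ring.
  rewrite -[in RHS]modnDm; have := ltn_pmod (u * rho + 1) Z_gt0; have := ltn_pmod (2 * u) Z_gt0.
  move: (_ %% Z) (_ %% Z) => C B ltC ltB; case: leqP => [leZ|ltZ]; last by rewrite modn_small.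
  by rewrite -[in RHS](subnK leZ) modnDr modn_small //; move: ltC ltB leZ; clear; lia.
by move/IHc => H lti; rewrite mulSn addnA => /H; apply.
Qed.

Lemma expn_mod_cube a x : 1 < a -> a ^ x %% (a ^ 3 - 1) \in [:: 1; a; a ^ 2].
Proof.
move=> a_gt1; have m_gt : a ^ 2 < a ^ 3 - 1.
  by rewrite -addn1 leq_subRL ?expn_gt0 ?(ltnW a_gt1) // [a ^ 3]expnS; move: a_gt1; clear; nia.
have a2 : a < a ^ 2 by rewrite -{1}[a]expn1 ltn_exp2l.
have a3 : a ^ 3 = 1 %[mod a ^ 3 - 1].
  by rewrite -{1}(@subnK 1 (a ^ 3)) ?expn_gt0 ?(ltnW a_gt1) // modnDl.
rewrite {1}(divn_eq x 3) expnD [_ * 3]mulnC expnM -modnMm -modnXm a3 modnXm exp1n modnMm mul1n.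
have := ltn_pmod x (isT : 0 < 3); case: (x %% 3) => [|[|[|]]] // _.
- by rewrite expn0 modn_small ?inE // (ltn_trans a_gt1) // (ltn_trans a2).
- by rewrite expn1 modn_small ?inE ?eqxx ?orbT // (ltn_trans a2).
by rewrite modn_small // !inE eqxx !orbT.
Qed.

Section Soundness.
Variables (a t e Z q X b n kap w y del nu x2 : nat).
Hypotheses (eqX : X = q * Z) (eqw : w = kap * Z).
Hypotheses (a_ge5 : 5 <= a) (eqq : q = a ^ e) (Z_gt0 : 0 < Z).
Hypotheses (eqb : b ^ n = w + 1) (b_gt1 : 1 < b) (y_gt0 : 0 < y) (ltby : b ^ y < X).
Hypotheses (eqnu : nu = q * del) (odd_nu : odd nu).
Hypothesis eqn : b ^ y * (b ^ n) ^ nu + X = a ^ x2 + b ^ y.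
Hypothesis x2_gt : t * nu < x2.
Hypothesis first_order : e + 2 <= nu -> Z %| b ^ y * kap * del + 1.
Hypothesis second_order : e + 3 <= nu ->
  Z * Z %| b ^ y * kap * del * (2 + (nu - 1) * w) + 2.
Hypothesis uncovered : ~~ exponent_covered (ofn Z) (ofn nu).

Let eqV : b ^ y * (w + 1) ^ nu + (X - b ^ y) = a ^ x2.
Proof. by rewrite -eqb; move: eqn ltby; clear; lia. Qed.

Lemma power_excludedF :
  power_excluded (ofn a) (ofn t) (ofn e) (ofn X) (ofn (b ^ y)) (ofn w) (ofn nu) = false.
Proof.
have eqVN : (ofn (b ^ y) * (ofn w + 1) ^ ofn nu + (ofn X - ofn (b ^ y)))%num = ofn (a ^ x2).
  by rewrite -eqV of_natD of_natM [ofn (_ ^ nu)]of_natX of_natD of_natB.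
rewrite /power_excluded; case nuE : (ofn nu) => [|p] //; rewrite -nuE.
have Vmod m : N.modulo (ofn (b ^ y) * powmod (ofn m) (ofn w + 1) p + (ofn X - ofn (b ^ y)))%num (ofn m) =
    ofn (a ^ x2 %% m).
  rewrite -N.Div0.add_mod_idemp_l -N.Div0.mul_mod_idemp_r powmodE -nuE.
  by rewrite N.Div0.mul_mod_idemp_r N.Div0.add_mod_idemp_l eqVN of_nat_mod.
have a_gt1 : 1 < a by rewrite (ltn_trans _ a_ge5).
lazy zeta; set tail := (if N.leb (ofn nu) _ then _ else _); have -> : tail = false.
  rewrite /tail; case: ifP => _; first by rewrite eqVN is_power_expn.
  have -> : N.min (ofn t * ofn nu + 1) (ofn t + ofn e + 6) = ofn (minn (t * nu + 1) (t + e + 6)).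
    rewrite -[1%num]/(ofn 1) -[6%num]/(ofn 6) -of_natM -!of_natD -Nat2N.inj_min.
    by congr ofn; clear; lia.
  rewrite -of_natX Vmod; apply/negbF/N.eqb_spec; set M := a ^ minn _ _.
  suff -> : a ^ x2 %% M = 0 by [].
  by apply/eqP/dvdn_exp2l; apply: leq_trans (geq_minl _ _) _; rewrite addn1.
rewrite -[3%num]/(ofn 3) -[1%num]/(ofn 1) -of_natX -of_natB Vmod -of_natM !of_nat_eqb.
by have := expn_mod_cube x2 a_gt1; rewrite !inE mulnn => /or3P[] /eqP ->; rewrite eqxx ?if_same.
Qed.

Lemma exponent_excludedF :
  exponent_excluded (ofn a) (ofn t) (ofn Z) (ofn e) (ofn q) (ofn X)
    (ofn (b ^ y)) (ofn w) (ofn kap) (ofn del) = false.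
Proof.
rewrite /exponent_excluded -of_natM -eqnu (negPf uncovered) power_excludedF; lazy zeta.
rewrite -[3%num]/(ofn 3) -[2%num]/(ofn 2) -[1%num]/(ofn 1) -of_natB.
rewrite -!(of_natD, of_natM) of_nat_leb !(of_nat_mod, =^~ of_natD, =^~ of_natM).
have [/second_order dvd2|//] := boolP (e + 3 <= nu); rewrite (of_nat_eqb _ 0).
suff -> : (b ^ y * (kap %% (Z * Z)) * (del * (2 + (nu - 1) * ((kap %% (Z * Z) * Z) %% (Z * Z)))) + 2) %%
  (Z * Z) = 0 by [].
rewrite modnMml -eqw; set m := Z * Z in dvd2 *.
have eqf : 2 + (nu - 1) * (w %% m) = 2 + (nu - 1) * w %[mod m] by rewrite -modnDmr modnMmr modnDmr.
have eqp : b ^ y * (kap %% m) * (del * (2 + (nu - 1) * (w %% m))) =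
    b ^ y * kap * del * (2 + (nu - 1) * w) %[mod m].
  have eqg : del * (2 + (nu - 1) * (w %% m)) = del * (2 + (nu - 1) * w) %[mod m].
    by rewrite -modnMmr eqf modnMmr.
  by rewrite -modnMm eqg modnMm -modnMml modnMmr modnMml mulnA.
by rewrite -modnDml eqp modnDml; apply/eqP.
Qed.

Let odd_q : odd q. Proof. by move: odd_nu; rewrite eqnu oddM => /andP[]. Qed.
Let odd_del : odd del. Proof. by move: odd_nu; rewrite eqnu oddM => /andP[]. Qed.
Let delE : del = 1 + del./2 * 2.
Proof. by rewrite -{1}[del]odd_double_half odd_del muln2. Qed.

Lemma base_excludedF c : nu <= 2 * q * c ->
  base_excluded (ofn a) (ofn t) (ofn Z) (ofn e) (ofn q) (ofn X)
    (ofn n) (minn c Z) (c %/ Z + 1) (ofn b) = false.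
Proof.
move=> le_nu; apply/negP; rewrite /base_excluded.
have -> : N.leb (ofn b) 1 = false by rewrite (of_nat_leb b 1) leqNgt b_gt1.
lazy zeta; have -> : (ofn b ^ ofn n - 1)%num = ofn w.
  by rewrite -of_natX eqb -(of_natB _ 1) addn1 subn1.
have -> : (ofn w / ofn Z)%num = ofn kap by rewrite of_nat_div eqw mulnK.
move/(all_powersP (j := y.-1) (ltnW b_gt1)).
rewrite -expnS prednK // => /(_ ltby); rewrite (of_nat_eqb e 0).
have [lt_nu|ge_nu] := ltnP nu (e + 2).
  have e0 : e = 0.
    apply/eqP; rewrite -leqn0 leqNgt; apply/negP => /(leq_exp_add3 a_ge5); rewrite -eqq => leq.
    have del_gt0 : 0 < del by case: (del) odd_del.
    move: lt_nu; rewrite ltnNge eqnu; apply/negP/negPn; apply: leq_trans (leq_pmulr q del_gt0).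
    by rewrite (leq_trans _ leq) // leq_add2l.
  have del1 : del = 1.
    have q1 : q = 1 by rewrite eqq e0.
    by move: lt_nu odd_del; rewrite eqnu q1 e0 mul1n; case: (del) => [|[|m]].
  by have := exponent_excludedF; rewrite del1 e0 eqxx => ->.
case: ifP => // _; set u := b ^ y * (kap %% Z) %% Z.
have -> : ((ofn (b ^ y) * (ofn kap mod ofn Z)) mod ofn Z)%num = ofn u.
  by rewrite !(of_nat_mod, =^~ of_natM).
have -> : ((2 * ofn u) mod ofn Z)%num = ofn (2 * u %% Z) by rewrite -(of_natM 2) of_nat_mod.
have -> : ((ofn u + 1) mod ofn Z)%num = ofn ((u * 1 + 1) %% Z) by rewrite muln1 -(of_natD _ 1) of_nat_mod.
have lt_half : del./2 < c.
  have : q * del <= q * (2 * c) by rewrite mulnA [q * 2]mulnC -eqnu.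
  have q_gt0 : 0 < q by case: (q) odd_q.
  by rewrite leq_pmul2l //; move: delE; clear; lia.
(* With [del = 1 + 2 h], the residue class is met at step [h %% Z], and [del] is its member number
   [h %/ Z]. *)
move/(classes_excludedP (rho := 1) (i := del./2 %% Z)).
rewrite ltn_min (leq_ltn_trans (leq_mod _ _) lt_half) ltn_mod Z_gt0 => /(_ isT).
have eq_half : 1 + del./2 %% Z * 2 = del %[mod Z] by rewrite -modnDmr modnMml modnDmr -delE.
have -> : Z %| u * (1 + del./2 %% Z * 2) + 1.
  rewrite /u modnMmr /dvdn -modnDml modnMml -modnMmr eq_half modnMmr modnDml.
  exact: first_order.
move=> /(_ isT)/(all_progressionP (i := del./2 %/ Z)); rewrite addn1 ltnS leq_div2r ?(ltnW lt_half) //.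
move=> /(_ isT); rewrite -[2%num]/(ofn 2) -!(of_natD, of_natM).
have -> : 1 + del./2 %% Z * 2 + del./2 %/ Z * (2 * Z) = del.
  by rewrite [RHS]delE [X in _ = 1 + X * 2](divn_eq _ Z); ring.
by rewrite exponent_excludedF.
Qed.
End Soundness.

(** The product [(b - om) (b + om + 1)] vanishes modulo [a ^ t]. A prime [a] dividing both factors
    would divide [2 om + 1], whose square is -3 modulo [a]. *)
Lemma cube_root_unique (a t b om : nat) : prime a -> 5 <= a ->
  a ^ t %| b ^ 2 + b + 1 -> a ^ t %| om ^ 2 + om + 1 ->
  b = om %[mod a ^ t] \/ a ^ t %| b + om + 1.
Proof.
have [->|t_gt0] := posnP t; first by rewrite expn0 !modn1; left.
move=> pa a_ge5 dvdb dvdom.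
wlog le_om : b om dvdb dvdom / om <= b => [wl|].
  case: (leqP om b) => [|/ltnW] /wl => [H|/(_ dvdom dvdb) []]; first exact: H.
    by move->; left.
  by rewrite [om + b]addnC; right.
have dvdprod : a ^ t %| (b - om) * (b + om + 1).
  have -> : (b - om) * (b + om + 1) = (b ^ 2 + b + 1) - (om ^ 2 + om + 1).
    by move: le_om; clear; nia.
  exact: dvdn_sub.
have [dvd1|ndvd1] := boolP (a %| b - om); last first.
  by right; move: dvdprod; rewrite Gauss_dvdr // coprimeXl // prime_coprime.
have [dvd2|ndvd2] := boolP (a %| b + om + 1); last first.
  left; apply/eqP; rewrite eqn_mod_dvd //.
  by move: dvdprod; rewrite Gauss_dvdl // coprimeXl // prime_coprime.
have dvda m : a ^ t %| m -> a %| m by apply: dvdn_trans; rewrite -{1}[a]expn1 dvdn_exp2l.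
have d3 : a %| 2 * om + 1.
  have -> : 2 * om + 1 = (b + om + 1) - (b - om) by move: le_om; clear; lia.
  exact: dvdn_sub.
have : a %| 4 * (om ^ 2 + om + 1) - (2 * om + 1) * (2 * om + 1).
  by rewrite dvdn_sub ?dvdn_mull // dvda.
have -> : 4 * (om ^ 2 + om + 1) - (2 * om + 1) * (2 * om + 1) = 3 by clear; nia.
by move/dvdn_leq => /(_ isT); rewrite leqNgt (leq_trans _ a_ge5).
Qed.

Lemma cube_root_residue (Z b om : nat) : 0 < Z -> Z %| b + om + 1 -> b %% Z = Z - 1 - om %% Z.
Proof.
move=> Z_gt0 dvd; have : Z %| b %% Z + om %% Z + 1 by rewrite /dvdn -modnDml modnDm modnDml.
have := ltn_pmod b Z_gt0; have := ltn_pmod om Z_gt0.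
move: (b %% Z) (om %% Z) => B C ltC ltB /dvdnP[[|[|k]]]; clear -ltC ltB; nia.
Qed.

Section Reduced.
Variables (a b y n nu e t kap del x1 x2 : nat).
Hypotheses (pa : prime a) (a_ge : 7 <= a) (t_gt0 : 0 < t) (b_gt1 : 1 < b) (y_gt0 : 0 < y).
Hypotheses (nab : ~~ (a %| b)) (eqb : b ^ n = kap * a ^ t + 1) (nakap : ~~ (a %| kap)).
Hypotheses (eqnu : nu = a ^ e * del) (nadel : ~~ (a %| del)) (odd_nu : odd nu).
Hypotheses (ltx : x1 < x2) (ltby : b ^ y < a ^ x1).
Hypothesis eqn : b ^ y * (b ^ n) ^ nu + a ^ x1 = a ^ x2 + b ^ y.

(** The windows [[det_threshold v, Z ^ v]] with [v >= u] cover everything from [det_threshold u] on: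
    the hypothesis makes the first two overlap, and it passes from [v] to [v + 1] because the
    threshold grows at most by the factor [7 <= Z]. *)
Lemma reduced_det_chain u : 0 < u -> det_threshold u.+1 <= (a ^ t) ^ u -> nu < det_threshold u.
Proof.
have Z_ge : 7 <= a ^ t by rewrite (leq_trans a_ge) // -{1}[a]expn1 leq_exp2l // prime_gt1.
have stop v : 0 < v -> det_threshold v <= nu <= (a ^ t) ^ v -> False.
  exact: (reduced_det_bound pa a_ge t_gt0 b_gt1 y_gt0 nab eqb nakap eqnu nadel ltx ltby eqn).
have step v : 0 < v -> det_threshold v.+1 <= 7 * det_threshold v.
  by rewrite /det_threshold; clear; nia.
move=> u_gt0 leT; rewrite ltnNge; apply/negP => leu.
have [m] := ubnP (nu - u); elim: m u u_gt0 leT leu => // m IHm u u_gt0 leT leu ltm.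
have [le_nu|gt_nu] := leqP nu ((a ^ t) ^ u); first by apply: (stop u); rewrite ?leu.
apply: (IHm u.+1) => //.
- apply: leq_trans (step _ _) _ => //; rewrite expnS; apply: leq_mul => //.
- exact: leq_trans leT (ltnW gt_nu).
have : u < (a ^ t) ^ u by rewrite ltn_expl // (leq_trans _ Z_ge).
by move: gt_nu ltm; move: (_ ^ u) => P; clear; lia.
Qed.

(** Each case uses the least [u] with [det_threshold u.+1 <= Z ^ u]: 6, 4 and 3 for [Z = 7, 13, 49],
    then 2, and 1 from 1323 on. The number 59 is the least [Z] with
    [Z ^ 2 >= det_threshold 3 = 3393]. *)
Lemma reduced_uncovered : a ^ t \in [:: 7; 13; 49] \/ 59 <= a ^ t ->
  ~~ exponent_covered (N.of_nat (a ^ t)) (N.of_nat nu).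
Proof.
have chain u : 0 < u -> det_threshold u.+1 <= (a ^ t) ^ u -> nu < det_threshold u.
  exact: reduced_det_chain.
have stop := @reduced_det_bound a b y n nu e t kap del x1 x2 pa a_ge t_gt0 b_gt1 y_gt0 nab eqb nakap eqnu nadel ltx ltby eqn.
move: chain stop; move: (a ^ t) => Z chain stop.
rewrite !inE; case=> [/or3P[] /eqP eZ|Z_ge].
- rewrite {Z}eZ in chain stop *.
  have lt6 : nu < det_threshold 6.
    by apply: chain => //; rewrite (expnD 7 3 3) /det_threshold; clear; lia.
  have stop5 : ~ (det_threshold 5 <= nu <= 343 * 49) by rewrite -(expnD 7 3 2); apply: stop.
  rewrite /exponent_covered (_ : exponent_bound (N.of_nat 7) = 19875%num) //.
  rewrite (_ : N.eqb (N.of_nat 7) 7 = true) //.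
  move: lt6 stop5; rewrite /det_threshold; clear; case: N.leb_spec0 => h1.
    by lia.
  case: N.leb_spec0 => h2 //; case: N.leb_spec0 => h3 //; lia.
- rewrite {Z}eZ in chain stop *.
  have lt4 : nu < det_threshold 4.
    by apply: chain => //; rewrite (expnD 13 2 2) /det_threshold; clear; lia.
  rewrite /exponent_covered (_ : exponent_bound (N.of_nat 13) = 6919%num) //.
  rewrite (_ : N.eqb (N.of_nat 13) 7 = false) //.
  by move: lt4; rewrite /det_threshold; clear; case: N.leb_spec0 => h1 //; lia.
- rewrite {Z}eZ in chain stop *.
  have lt3 : nu < det_threshold 3.
    by apply: chain => //; rewrite (expnD 49 2 1) /det_threshold; clear; lia.
  rewrite /exponent_covered (_ : exponent_bound (N.of_nat 49) = 3393%num) //.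
  rewrite (_ : N.eqb (N.of_nat 49) 7 = false) //.
  by move: lt3; rewrite /det_threshold; clear; case: N.leb_spec0 => h1 //; lia.
have lt2 : nu < det_threshold 2.
  apply: chain => //; rewrite -mulnn; apply: leq_trans (leq_mul Z_ge Z_ge).
  by rewrite /det_threshold; clear; lia.
have lt1 : det_threshold 2 <= Z -> nu < det_threshold 1 by move=> leZ; apply: chain; rewrite // expn1.
move: lt1 lt2 Z_ge; rewrite /exponent_covered /exponent_bound /det_threshold; clear.
case: N.eqb_spec => h1; first by lia.
case: N.eqb_spec => h2; first by lia.
case: N.eqb_spec => h3; first by lia.
case: N.ltb_spec0 => h4; case: N.leb_spec0 => h5 //; lia.
Qed.
End Reduced.

Section Reduced.
Variables (a b y n nu e t kap del x1 x2 : nat).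
Hypotheses (pa : prime a) (a_ge : 7 <= a) (t_gt0 : 0 < t) (b_gt1 : 1 < b) (y_gt0 : 0 < y).
Hypotheses (nab : ~~ (a %| b)) (eqb : b ^ n = kap * a ^ t + 1) (nakap : ~~ (a %| kap)).
Hypotheses (eqnu : nu = a ^ e * del) (nadel : ~~ (a %| del)) (odd_nu : odd nu).
Hypotheses (ltx : x1 < x2) (ltby : b ^ y < a ^ x1).
Hypothesis eqn : b ^ y * (b ^ n) ^ nu + a ^ x1 = a ^ x2 + b ^ y.
Hypothesis uncovered : ~~ exponent_covered (ofn (a ^ t)) (ofn nu).

Let a_gt1 : 1 < a. Proof. exact: prime_gt1. Qed.
Let Z_gt0 : 0 < a ^ t. Proof. by rewrite expn_gt0 ltnW. Qed.
Let q_gt0 : 0 < a ^ e. Proof. by rewrite expn_gt0 ltnW. Qed.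
Let eqx1 : x1 = t + e.
Proof. exact: (reduced_eq_exponent pa a_ge t_gt0 nab eqb nakap eqnu nadel ltx eqn). Qed.
Let x2_gt : t * nu < x2.
Proof. exact: (reduced_exponent_gt pa b_gt1 y_gt0 eqb nakap ltby eqn). Qed.
Let ltbX : b ^ y < a ^ e * a ^ t. Proof. by rewrite -expnD [e + t]addnC -eqx1. Qed.

Lemma reduced_base_excludedF c : nu <= 2 * a ^ e * c ->
  base_excluded (ofn a) (ofn t) (ofn (a ^ t)) (ofn e) (ofn (a ^ e)) (ofn (a ^ e * a ^ t))
    (ofn n) (minn c (a ^ t)) (c %/ a ^ t + 1) (ofn b) = false.
Proof.
apply: (@base_excludedF a t e (a ^ t) (a ^ e) _ b n kap (kap * a ^ t) y del nu x2) => //.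
- exact: leq_trans a_ge.
- by rewrite -expnD [e + t]addnC -eqx1.
- move=> le_nu; rewrite -mulnA [kap * del]mulnC.
  apply: (reduced_first_order pa a_ge t_gt0 nab eqb nakap eqnu nadel ltx eqn).
  rewrite leq_subRL ?(ltnW ltx) // eqx1; apply: leq_trans (ltnW x2_gt).
  apply: leq_trans (_ : t * (e + 2) <= _); last by rewrite leq_mul2l le_nu orbT.
  by move: t_gt0; clear; nia.
move=> le_nu; have lex2 : e + t * 3 <= x2.
  apply: leq_trans (ltnW x2_gt).
  apply: leq_trans (_ : t * (e + 3) <= _); last by rewrite leq_mul2l le_nu orbT.
  by move: t_gt0; clear; nia.
have nu_gt0 : 0 < nu by case: (nu) odd_nu.
rewrite mulnn.
exact: (reduced_second_order pa a_ge t_gt0 nab eqb nakap eqnu nadel ltx eqn nu_gt0 lex2).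
Qed.

Lemma reduced_valuation_excludedF om :
  n = 3 /\ (b = om %[mod a ^ t] \/ a ^ t %| b + om + 1) \/
  [/\ n = 1, b = 1 %[mod a ^ t] & a ^ t < 1323] ->
  valuation_excluded (ofn a) (ofn om) (ofn t) (ofn (a ^ t)) (ofn e) (ofn (a ^ e)) = false.
Proof.
move=> residue; apply/negP; rewrite /valuation_excluded.
have [nm eqnm] : exists nm, exponent_bound (ofn (a ^ t)) = ofn nm.
  by exists (N.to_nat (exponent_bound (ofn (a ^ t)))); rewrite N2Nat.id.
have lt_nu : nu < nm.
  by move: uncovered; rewrite /exponent_covered eqnm of_nat_leb leqNgt; case: (nu < nm).
have del_odd : odd del by move: odd_nu; rewrite eqnu oddM => /andP[].
rewrite eqnm -[3%num]/(ofn 3) -[2%num]/(ofn 2) -[1%num]/(ofn 1) -!of_natM of_nat_leb.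
set shortcut := if nm <= _ then _ else _.
have -> : shortcut = false.
  rewrite /shortcut; case: leqP => // le3; apply/negbTE.
  suff del1 : del = 1 by move: uncovered; rewrite eqnu del1 muln1.
  have : a ^ e * del < a ^ e * 3 by rewrite -eqnu [_ * 3]mulnC (leq_trans lt_nu).
  by rewrite ltn_pmul2l //; case: (del) del_odd => [|[|[|]]].
lazy zeta; rewrite -?(of_natD, of_natM) !of_nat_div -!of_natD -!of_natB !of_nat_mod.
rewrite -Nat2N.inj_min !Nat2N.id.
set c := nm %/ (2 * a ^ e) + 1.
have le_c : nu <= 2 * a ^ e * c.
  rewrite mulnC; apply: ltnW; apply: ltn_trans lt_nu _; rewrite /c addn1 ltn_ceil //.
  by rewrite muln_gt0.
have excl : base_excluded (ofn a) (ofn t) (ofn (a ^ t)) (ofn e) (ofn (a ^ e)) (ofn (a ^ e * a ^ t))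
    (ofn n) (minn c (a ^ t)) (c %/ a ^ t + 1) (ofn b) = false.
  exact: reduced_base_excludedF.
have minE : Nat.min c (a ^ t) = minn c (a ^ t) by clear; lia.
have ltb : b %/ a ^ t < a ^ e.
  by rewrite ltn_divLR // (leq_ltn_trans _ ltbX) // -{1}[b]expn1 leq_exp2l.
have decb : (ofn (b %% a ^ t) + ofn (b %/ a ^ t) * ofn (a ^ t))%num = ofn b.
  by rewrite -of_natM -of_natD addnC -divn_eq.
have cntE : N.to_nat (ofn c / ofn (a ^ t) + ofn 1) = c %/ a ^ t + 1.
  by rewrite of_nat_div -of_natD Nat2N.id.
rewrite minE cntE; case: ifP => // chk1; case: ifP => // chk2.
have check r m : all_progression
  (base_excluded (ofn a) (ofn t) (ofn (a ^ t)) (ofn e) (ofn (a ^ e)) (ofn (a ^ e * a ^ t))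
    (ofn m) (minn c (a ^ t)) (c %/ a ^ t + 1))
  (ofn (a ^ t)) (a ^ e) (ofn r) -> r = b %% a ^ t -> m = n -> False.
  by move=> /all_progressionP/(_ ltb) + er em; rewrite er em decb excl.
case: residue => [[n3 [eqr|/(cube_root_residue Z_gt0) eqr]] _|[n1 eqr ltZ]].
- exact: check _ _ chk1 (esym eqr) (esym n3).
- by rewrite -of_natB in chk2; exact: check _ _ chk2 (esym eqr) (esym n3).
case: ifP => [/N.leb_spec0 le_Z|_ chk3]; first by move: ltZ le_Z; move: (a ^ t); clear; lia.
by apply: (check _ _ chk3) => //; rewrite eqr modn_small // -{1}(expn0 a) ltn_exp2l.
Qed.

Lemma all_valuationsF om f :
  n = 3 /\ (b = om %[mod a ^ t] \/ a ^ t %| b + om + 1) \/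
  [/\ n = 1, b = 1 %[mod a ^ t] & a ^ t < 1323] ->
  all_valuations (ofn a) (ofn om) (ofn t) (ofn (a ^ t)) f 0 1 = false.
Proof.
move=> residue; apply/negP.
suff gen e0 : e0 <= e ->
    all_valuations (ofn a) (ofn om) (ofn t) (ofn (a ^ t)) f (ofn e0) (ofn (a ^ e0)) -> False.
  by move/(gen 0 (leq0n _)).
have lt_nu : N.leb (exponent_bound (ofn (a ^ t))) (ofn nu) = false.
  by move: uncovered; rewrite /exponent_covered; case: N.leb.
elim: f e0 => // f IHf e0 le_e; rewrite [all_valuations _ _ _ _ _ _ _]/=.
case: N.leb_spec0 => [le_bound|_].
  have : a ^ e0 <= nu.
    have del_gt0 : 0 < del by rewrite lt0n; apply: contraNneq nadel => ->; rewrite dvdn0.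
    by rewrite eqnu; apply: leq_trans (leq_pmulr _ del_gt0); rewrite leq_exp2l.
  by move/N.leb_spec0: lt_nu; move: le_bound; move: (a ^ e0) (exponent_bound _); clear; lia.
case: ifP => // vex; rewrite -(of_natD _ 1) -of_natM addn1 -expnSr; apply: IHf.
rewrite ltn_neqAle le_e andbT; apply/eqP => ee; move: vex.
by rewrite ee reduced_valuation_excludedF.
Qed.
End Reduced.

Section SmallBase.
Variables (a b y n nu e t kap del x1 x2 : nat).
Hypotheses (pa : prime a) (a_ge : 7 <= a) (t_gt0 : 0 < t) (b_gt1 : 1 < b) (y_gt0 : 0 < y).
Hypotheses (nab : ~~ (a %| b)) (eqb : b ^ n = kap * a ^ t + 1) (nakap : ~~ (a %| kap)).
Hypotheses (eqnu : nu = a ^ e * del) (nadel : ~~ (a %| del)) (odd_nu : odd nu).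
Hypotheses (ltx : x1 < x2) (ltby : b ^ y < a ^ x1).
Hypothesis eqn : b ^ y * (b ^ n) ^ nu + a ^ x1 = a ^ x2 + b ^ y.
Hypothesis order : n = 1 \/ n = 3 /\ a ^ t %| b ^ 2 + b + 1.

(** As [1323 = det_threshold 2], larger [Z] allow the window with [u = 1], so [nu < 325]; order one
    would then require [Z <= nu]. *)
Lemma reduced_order_bound :
  a ^ t < 1323 \/ [/\ n = 3, nu < 325 & a ^ t <= order3_bound nu].
Proof.
have [ltZ|leZ] := ltnP (a ^ t) 1323; [by left | right].
have lt_nu : nu < 325.
  rewrite -[325]/(det_threshold 1).
  apply: (reduced_det_chain pa a_ge t_gt0 b_gt1 y_gt0 nab eqb nakap eqnu nadel ltx ltby eqn) => //.
case: order => [n1|[n3 /dvdnP[k eqk]]].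
  have := reduced_order_one pa a_ge t_gt0 b_gt1 y_gt0 nab eqb nakap eqnu nadel ltx ltby eqn n1.
  by move: leZ lt_nu; move: (a ^ t); clear; lia.
have eqkap : kap = (b - 1) * k.
  apply/eqP; rewrite -(@eqn_pmul2r (a ^ t)) ?(leq_trans _ leZ) // -(eqn_add2r 1) -eqb n3 -mulnA -eqk.
  by apply/eqP; move: b_gt1; clear; case: b => // m _; rewrite subn1 /=; ring.
split=> //; apply: (@order3_boundP a b y k nu e t del x1 x2) => //; first by rewrite -eqkap.
by rewrite -n3.
Qed.

(** The loop over [t0] either reaches the actual [t], where the tests cannot exclude the given
    solution, or ends with [a ^ t0] beyond the bound on [Z]. *)
Lemma reduced_small_base om f : a \in [:: 7; 13] \/ 59 <= a ->
  all_orders (ofn a) om f 1 (ofn a) -> False.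
Proof.
move=> a_small; rewrite -[om]N2Nat.id; move: (N.to_nat om) => m {om}.
have a_gt1 : 1 < a by apply: prime_gt1.
suff gen t0 : t0 <= t -> all_orders (ofn a) (ofn m) f (ofn t0) (ofn (a ^ t0)) -> False.
  by rewrite -{2}[a]expn1; apply: (gen 1).
have uncov : ~~ exponent_covered (ofn (a ^ t)) (ofn nu).
  apply: (reduced_uncovered pa a_ge t_gt0 b_gt1 y_gt0 nab eqb nakap eqnu nadel ltx ltby eqn).
  have leaZ i : i <= t -> a ^ i <= a ^ t by move=> lei; rewrite leq_exp2l.
  case: a_small => [|ge59]; last by right; rewrite (leq_trans ge59) // -{1}[a]expn1 leaZ.
  rewrite !inE; case: (t) t_gt0 leaZ => [|[|[|s]]] // _ leaZ /orP[]/eqP ea; rewrite ea in leaZ *.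
  1-3: by left.
  - by right.
  - by right; apply: leq_trans (leaZ 3 _).
  - by right; apply: leq_trans (leaZ 2 _).
elim: f t0 => [|f IHf] t0 le_t; cbn [all_orders].
  move/N.ltb_spec0; have : a ^ t0 <= a ^ t by rewrite leq_exp2l.
  have [ltZ|[_ lt_nu leZ]] := reduced_order_bound.
    by move: ltZ; move: (a ^ t) (a ^ t0); clear; lia.
  have les : 18 * nu ^ 2 + 18 * nu + 4 <= 18 * (325 * 325) + 18 * 325 + 4.
    by move: lt_nu; clear; nia.
  move: leZ les; rewrite /order3_bound -mulnn; move: (18 * nu ^ 2 + _ + _) (a ^ t) (a ^ t0).
  by clear => v Z Z0 leZ lev leZ0; have := leq_trans leZ (leq_mul lev lev); move: leZ0; clear; lia.
case: N.eqb_spec => // root; case: ifP => // vals.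
have [et|lt_t] := eqVneq t0 t; last first.
  by rewrite -(of_natD _ 1) -of_natM addn1 -expnSr; apply: IHf; rewrite ltn_neqAle lt_t.
move: vals root; rewrite {t0 le_t}et => vals root _; move: vals.
rewrite (all_valuationsF pa a_ge t_gt0 b_gt1 y_gt0 nab eqb nakap eqnu nadel odd_nu ltx ltby eqn uncov) //.
have root_nat : a ^ t %| m ^ 2 + m + 1.
  move: root; rewrite -[1%num]/(ofn 1) -!(of_natD, of_natM) of_nat_mod -mulnn /dvdn; clear.
  by move: (_ %% _) => r; lia.
case: order => [n1|[n3 dvdb]]; last first.
  by left; split=> //; apply: (cube_root_unique pa) => //; apply: leq_trans a_ge.
right; split=> //; first by move: eqb; rewrite n1 expn1 => ->; rewrite modnMDl.
by have [|[n3]] := reduced_order_bound => //; move: n3; rewrite n1.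
Qed.
End SmallBase.

(** * The order of the base modulo a *)

(* The second arguments are roots of [X ^ 2 + X + 1] modulo [a ^ f], [f] being the third one. *)
Lemma all_orders_7 : all_orders 7 272170172759 14 1 7. Proof. by vm_compute. Qed.
Lemma all_orders_13 : all_orders 13 229491597351 11 1 13. Proof. by vm_compute. Qed.
Lemma all_orders_97 : all_orders 97 2789067613 6 1 97. Proof. by vm_compute. Qed.
Lemma all_orders_193 : all_orders 193 3788464248 5 1 193. Proof. by vm_compute. Qed.
Lemma all_orders_769 : all_orders 769 346291826252 4 1 769. Proof. by vm_compute. Qed.
Lemma all_orders_12289 : all_orders 12289 922502154060 3 1 12289. Proof. by vm_compute. Qed.
Lemma all_orders_786433 : all_orders 786433 308936440704 2 1 786433. Proof. by vm_compute. Qed.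
Lemma all_orders_3221225473 : all_orders 3221225473 1610563584 1 1 3221225473.
Proof. by vm_compute. Qed.
Lemma all_orders_206158430209 : all_orders 206158430209 103079608320 1 1 206158430209.
Proof. by vm_compute. Qed.

(** [3 * 2 ^ 41] already exceeds [order3_bound 325], so for [r >= 41] no power [a ^ t] respects the
    bound on [Z]. *)
Lemma r_list_cases (r : nat) a : r \in r_list -> a = 2 ^ r * 3 + 1 ->
  (a \in [:: 7; 13] \/ 59 <= a) /\
  ((exists om f, all_orders (ofn a) om f 1 (ofn a)) \/
   order3_bound 325 < a).
Proof.
have large s : 41 <= s -> order3_bound 325 < 2 ^ s * 3 + 1.
  move=> s_ge; apply: leq_ltn_trans (_ : 2 ^ 41 * 3 < _); last first.
    by rewrite addn1 ltnS leq_mul2r leq_exp2l.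
  rewrite (expnD 2 11 30) (expnM 2 10 3) -[2 ^ 11]/2048 -[2 ^ 10]/1024 expnS -mulnn.
  rewrite /order3_bound -!mulnn; clear; lia.
have ofa s : ofn (2 ^ s * 3 + 1) = (2 ^ ofn s * 3 + 1)%num.
  by rewrite of_natD of_natM of_natX.
have chk s m om f : (2 ^ ofn s * 3 + 1)%num = m -> all_orders m om f 1 m ->
    exists om f, all_orders (ofn (2 ^ s * 3 + 1)) om f 1 (ofn (2 ^ s * 3 + 1)).
  by move=> es ch; exists om, f; rewrite ofa es.
rewrite /r_list !inE => r_in ->; split.
  move: r_in; case: r => [|[|[|[|[|s]]]]] //=; try by left.
  by right; rewrite addn1 ltnW // ltnS (leq_trans _ (_ : 2 ^ 5 * 3 <= _)) // leq_mul2r leq_exp2l.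
have [s_ge|s_lt] := leqP 41 r; first by right; apply: large.
left; move: r_in s_lt.
case/orP=> [/eqP-> _|]; first exact: (@chk 1 _ _ _ _ all_orders_7).
case/orP=> [/eqP-> _|]; first exact: (@chk 2 _ _ _ _ all_orders_13).
case/orP=> [/eqP-> _|]; first exact: (@chk 5 _ _ _ _ all_orders_97).
case/orP=> [/eqP-> _|]; first exact: (@chk 6 _ _ _ _ all_orders_193).
case/orP=> [/eqP-> _|]; first exact: (@chk 8 _ _ _ _ all_orders_769).
case/orP=> [/eqP-> _|]; first exact: (@chk 12 _ _ _ _ all_orders_12289).
case/orP=> [/eqP-> _|]; first exact: (@chk 18 _ _ _ _ all_orders_786433).
case/orP=> [/eqP-> _|]; first exact: (@chk 30 _ _ _ _ all_orders_3221225473).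
case/orP=> [/eqP-> _|]; first exact: (@chk 36 _ _ _ _ all_orders_206158430209).
have absurd m (P : Prop) : 41 <= m -> r == m -> r < 41 -> P by move=> m_ge /eqP->; rewrite ltnNge m_ge.
by do ?[case/orP; first exact: absurd]; exact: absurd.
Qed.

Lemma expn_gcd_mod1 a b m k : 0 < m -> b ^ m = 1 %[mod a] -> b ^ k = 1 %[mod a] ->
  b ^ gcdn m k = 1 %[mod a].
Proof.
move=> m_gt0 bm bk; case: (egcdnP k m_gt0) => u v eq_uv _.
have one i j : b ^ i = 1 %[mod a] -> b ^ (j * i) = 1 %[mod a].
  by move=> bi; rewrite mulnC expnM -modnXm bi modnXm exp1n.
have := one _ u bm; rewrite eq_uv expnD -modnMml (one _ v bk) modnMml mul1n.
by [].
Qed.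

Lemma odd_difference_false r a b y d x1 x2 :
  r \in r_list -> a = 2 ^ r * 3 + 1 -> prime a -> 1 < b -> coprime a b -> 0 < y -> 0 < x1 ->
  x1 < x2 -> odd d -> b ^ y < a ^ x1 -> b ^ y * b ^ d + a ^ x1 = a ^ x2 + b ^ y -> False.
Proof.
move=> r_in ea pa b_gt1 cop y_gt0 x1_gt0 ltx odd_d ltby eqn.
have nab : ~~ (a %| b) by rewrite -prime_coprime.
have a_ge : 7 <= a.
  have [[a_in|ge59] _] := r_list_cases r_in ea; last exact: leq_trans ge59.
  by move: a_in; rewrite !inE => /orP[] /eqP->.
have a_gt1 : 1 < a by apply: prime_gt1.
have d_gt0 : 0 < d by case: (d) odd_d.
have b_gt0 : 0 < b by apply: ltnW.
have bd : b ^ d = 1 %[mod a].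
  apply/eqP; rewrite eqn_mod_dvd ?expn_gt0 ?b_gt0 //.
  rewrite -(@Gauss_dvdr _ (b ^ y)) ?coprimeXr // mulnBr muln1.
  have -> : b ^ y * b ^ d - b ^ y = a ^ x2 - a ^ x1 by move: eqn; clear; lia.
  by rewrite dvdn_sub // -{1}[a]expn1 dvdn_exp2l // (ltn_trans x1_gt0).
have b3 : b ^ gcdn d (2 ^ r * 3) = 1 %[mod a].
  apply: expn_gcd_mod1 => //; have := @Euler_exp_totient b a.
  by rewrite totient_prime // {2}ea addn1 coprime_sym; apply.
rewrite Gauss_gcdr in b3; last by rewrite coprimeXr // coprimen2.
(* [n = 3] is taken only if [a] does not divide [b - 1]; then [a ^ t] divides the other factor
   [b ^ 2 + b + 1] of [b ^ 3 - 1]. *)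
have [n [n13 dvdnd bn n3]] : exists n, [/\ n = 1 \/ n = 3, n %| d, b ^ n = 1 %[mod a] & n = 3 -> ~~ (a %| b - 1)].
  have [b1|nb1] := boolP (a %| b - 1).
    exists 1; split=> //; [by left|].
    by apply/eqP; rewrite expn1 eqn_mod_dvd.
  exists 3; have g3 : gcdn d 3 = 3.
    apply/gcdn_idPr; apply: contraR nb1 => n3d; move: b3; rewrite (_ : gcdn d 3 = 1).
      by rewrite expn1 => /eqP; rewrite eqn_mod_dvd.
    by apply/eqP; rewrite -/(coprime d 3) coprime_sym prime_coprime.
  by split; [right | rewrite -g3 dvdn_gcdl | rewrite -g3 | ].
have n_gt0 : 0 < n by case: n13 => ->.
have bn_gt1 : 1 < b ^ n by rewrite -{1}(exp1n n) ltn_exp2r.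
have [|kap copk eqw] := @pfactor_coprime a (b ^ n - 1) pa; first by rewrite subn_gt0.
set t := logn a (b ^ n - 1) in eqw.
have eqb : b ^ n = kap * a ^ t + 1 by rewrite -eqw subnK // ltnW.
have t_gt0 : 0 < t.
  rewrite /t logn_gt0 mem_primes pa subn_gt0 bn_gt1 -eqn_mod_dvd ?(ltnW bn_gt1) //.
  exact/eqP.
have nakap : ~~ (a %| kap) by rewrite -prime_coprime.
pose nu := d %/ n; have eqd : d = n * nu by rewrite mulnC divnK.
have nu_gt0 : 0 < nu by move: d_gt0; rewrite eqd muln_gt0 => /andP[].
have odd_nu : odd nu by move: odd_d; rewrite eqd oddM => /andP[].
have [del copd eqnu] := pfactor_coprime pa nu_gt0.
set e := logn a nu in eqnu; rewrite mulnC in eqnu.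
have nadel : ~~ (a %| del) by rewrite -prime_coprime.
rewrite eqd expnM in eqn.
have ord : n = 1 \/ n = 3 /\ a ^ t %| b ^ 2 + b + 1.
  case: n13 => [|en]; [by left | right; split=> //].
  have : a ^ t %| (b - 1) * (b ^ 2 + b + 1).
    have -> : (b - 1) * (b ^ 2 + b + 1) = b ^ n - 1.
      by rewrite en; move: b_gt0; clear; case: b => // m _; rewrite subn1 /= !expnS; nia.
    by rewrite eqw dvdn_mull.
  by rewrite Gauss_dvdr // coprimeXl // prime_coprime // n3.
have [a_small [[om [f chk]]|a_large]] := r_list_cases r_in ea.
  exact: (reduced_small_base pa a_ge t_gt0 b_gt1 y_gt0 nab eqb nakap eqnu nadel odd_nu ltx ltby eqn ord a_small chk).
have leaZ : a <= a ^ t by rewrite -{1}[a]expn1 leq_exp2l.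
have := reduced_order_bound pa a_ge t_gt0 b_gt1 y_gt0 nab eqb nakap eqnu nadel odd_nu ltx ltby eqn ord.
have le_bound m : m <= 325 -> order3_bound m <= order3_bound 325.
  move=> le_m; rewrite /order3_bound leq_exp2r //.
  by rewrite leq_add2r leq_add // leq_mul2l ?leq_exp2r.
case=> [ltZ|[_ /ltnW/le_bound lt_nu leZ]].
  have : 1323 < order3_bound 325 by rewrite /order3_bound -!mulnn; clear; lia.
  by move: a_large leaZ ltZ; move: (order3_bound 325) (a ^ t); clear; lia.
by move: (leq_trans leaZ (leq_trans leZ lt_nu)); rewrite leqNgt a_large.
Qed.

(** * Pairs of solutions and the exceptional triple *)

Lemma two_solutions_exceptional r a b c x1 y1 x2 y2 :
  r \in r_list -> a = 2 ^ r * 3 + 1 -> prime a -> 1 < b -> 0 < c ->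
  coprime a b -> coprime b c -> 0 < x1 -> 0 < y1 -> y1 < y2 ->
  a ^ x1 = b ^ y1 + c -> a ^ x2 = b ^ y2 + c ->
  [/\ b = 3, y1 = 1 & c = 10].
Proof.
move=> r_in ea pa b_gt1 c_gt0 copab copbc x1_gt0 y1_gt0 lty eq1 eq2.
have a_ge : 7 <= a.
  have [[a_in|ge59] _] := r_list_cases r_in ea; last exact: leq_trans ge59.
  by move: a_in; rewrite !inE => /orP[] /eqP->.
have a_gt1 : 1 < a by apply: prime_gt1.
have nab : ~~ (a %| b) by rewrite -prime_coprime.
have lt12 : b ^ y1 < b ^ y2 by rewrite ltn_exp2l.
have ltx : x1 < x2 by rewrite -(ltn_exp2l _ _ a_gt1) eq1 eq2 ltn_add2r.
have c_gt1 : 1 < c.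
  rewrite ltn_neqAle c_gt0 andbT; apply/eqP => c1; rewrite -c1 in eq1 eq2.
  exact: (pow_minus_one_unique a_ge x1_gt0 b_gt1 y1_gt0 lty eq1 eq2).
have eqd : b ^ y2 = b ^ y1 * b ^ (y2 - y1) by rewrite -expnD subnKC // ltnW.
have [odd_d|even_d] := boolP (odd (y2 - y1)).
  exfalso; apply: (odd_difference_false r_in ea pa b_gt1 copab y1_gt0 x1_gt0 ltx odd_d).
    by rewrite eq1 -[X in X < _]addn0 ltn_add2l.
  by rewrite -eqd eq1 eq2; clear; lia.
have d2 : y2 = y1 + 2 * (y2 - y1)./2.
  by rewrite mul2n even_halfK // subnKC // ltnW.
rewrite d2 in eq2; apply: (same_parity_gt1 pa a_ge x1_gt0 nab b_gt1 y1_gt0 c_gt1 copbc erefl eq1 _ eq2).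
by rewrite -double_gt0 even_halfK // subn_gt0.
Qed.

Theorem theorem1p3 (r a b c : nat) :
  r \in r_list -> a = 2 ^ r * 3 + 1 -> prime a ->
  1 < b -> 0 < c ->
  coprime a b -> coprime a c -> coprime b c ->
  ((a, b, c) <> (13, 3, 10) ->
     forall s t : nat * nat, is_sol a b c s -> is_sol a b c t -> s = t) /\
  ((a, b, c) = (13, 3, 10) ->
     exists s t : nat * nat, s <> t /\ is_sol a b c s /\ is_sol a b c t /\
       forall u, is_sol a b c u -> u = s \/ u = t).
Proof.
move=> r_in ea pa b_gt1 c_gt0 copab _ copbc.
have a_gt1 : 1 < a by apply: prime_gt1.
have exc x1 y1 x2 y2 := @two_solutions_exceptional r a b c x1 y1 x2 y2 r_in ea pa b_gt1 c_gt0 copab copbc.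
have inj s t : is_sol a b c s -> is_sol a b c t -> s.2 = t.2 -> s = t.
  case: s t => [x1 y1] [x2 y2] [/= _ [_ eq1]] [/= _ [_ eq2]] eqy; congr (_, _) => //.
  by apply/eqP; rewrite -(eqn_exp2l _ _ a_gt1) eq1 eq2 eqy.
split=> [nexc s t sol_s sol_t | [ea13 eb3 ec10]].
  have ordered x1 y1 x2 y2 : is_sol a b c (x1, y1) -> is_sol a b c (x2, y2) -> y1 < y2 -> False.
    move=> [/= x1_gt0 [y1_gt0 eq1]] [/= _ [_ eq2]] lty; apply: nexc.
    have [eb ey ec] := exc _ _ _ _ x1_gt0 y1_gt0 lty eq1 eq2.
    rewrite eb ey ec in eq1 *; congr (_, _, _); apply/eqP.
    by rewrite -(dvdn_prime2 pa (isT : prime 13)) -[13]eq1 -(prednK x1_gt0) expnS dvdn_mulr.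
  apply: inj => //; case: s t sol_s sol_t => [x1 y1] [x2 y2] sol_s sol_t /=.
  by case: (ltngtP y1 y2) => // lty; [case: (ordered _ _ _ _ sol_s sol_t) | case: (ordered _ _ _ _ sol_t sol_s)].
have sol1 : is_sol a b c (1, 1) by rewrite ea13 eb3 ec10.
have sol7 : is_sol a b c (3, 7) by rewrite ea13 eb3 ec10.
exists (1, 1), (3, 7); split; first by [].
do 2!split=> //; case=> [x y] sol.
(* Paired with [(3, 7)], a solution with [y < 7] has [y = 1], and one with [y > 7] would force
   [7 = 1]. *)
have [y_lt7|y_gt7|y7] := ltngtP y 7; last by right; apply: inj.
  left; apply: inj => //=; case: sol sol7 => [/= x_gt0 [y_gt0 eqx]] [/= _ [_ eq7]].
  by case: (exc _ _ _ _ x_gt0 y_gt0 y_lt7 eqx eq7).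
case: sol sol7 => [/= _ [_ eqx]] [/= g3 [g7 eq7]].
by case: (exc _ _ _ _ g3 g7 y_gt7 eq7 eqx).
Qed.
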